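(* Let $\mu$ be a finite Borel measure on $[0,1)$, let $g$ be the Radon-Nikodym derivative (with respect to Lebesgue measure) of its absolutely continuous part, and let $\mu_s$ be its singular part. Suppose $g$ is supported in some closed interval $[c,d]$ with $c>0$, and that $g$ is bounded above and below on its support. Suppose also that there is a closed interval $[a,b]$ with $a>0$, disjoint from $[c,d]$, such that $\mu_s([a,b]^c)=0$. Then there is a Bessel sequence $\{g_n\}_{n=-\infty}^{\infty}$ in $L^2(\mu)$ that is dextrodual to $\{e^{2\pi i n x}\}_{n=-\infty}^{\infty}$ in $L^2(\mu)$. Furthermore, if $L^2(\mu_s)$ is finite-dimensional, then such a sequence $\{g_n\}$ can be chosen to be a frame for $L^2(\mu)$.
   Context: Measures are positive; ''absolutely continuous'' and ''singular'' are with respect to Lebesgue measure, and $\mu=\mu_a+\mu_s$ is the Lebesgue decomposition, $d\mu_a=g\,dx$. The support of $g$ means $\{x: g(x)>0\}$ (up to Lebesgue null sets); $g$ bounded above and below on its support means there are constants $0<m\le M<\infty$ with $m\le g\le M$ almost everywhere on $\{g>0\}$. A sequence $\{g_n\}$ in a Hilbert space $H$ is a Bessel sequence if there is $B>0$ with $\sum_n|\langle f,g_n\rangle|^2\le B\|f\|^2$ for all $f\in H$, and a frame if moreover there is $A>0$ with $A\|f\|^2\le\sum_n|\langle f,g_n\rangle|^2$ for all $f\in H$. A sequence $\{g_n\}$ is dextrodual to a sequence $\{x_n\}$ in $H$ if for all $x\in H$, $x=\sum_n\langle x,g_n\rangle x_n$, with (possibly conditional) convergence in norm. For sequences indexed by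 $\mathbb Z$, the sum is the limit of the symmetric partial sums $\sum_{n=-M}^{M}$ as $M\to\infty$. *)

(* Defs.v *)
From HB Require Import structures.
From mathcomp Require Import all_boot all_order all_algebra.
From mathcomp Require Import complex.
From mathcomp Require Import all_classical all_reals all_analysis.

Set Implicit Arguments.
Unset Strict Implicit.
Unset Printing Implicit Defensive.

Import Order.TTheory GRing.Theory Num.Theory.
Import numFieldNormedType.Exports.

Local Open Scope classical_set_scope.
Local Open Scope ring_scope.
Local Open Scope complex_scope.

Definition mutually_singular d (T : measurableType d) (R : realType)
    (mu nu : {measure set T -> \bar R}) : Prop :=
  exists A : set T, [/\ measurable A, mu A = 0%E & nu (~` A) = 0%E].

Definition lebesgue_decomposition (R : realType)
    (mu mu_a mu_s : {measure set (measurableTypeR R) -> \bar R}) : Prop :=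
  [/\ forall A : set (measurableTypeR R), measurable A -> mu A = (mu_a A + mu_s A)%E,
      mu_a `<< @lebesgue_measure R
    & mutually_singular mu_s (@lebesgue_measure R)].

(* Elements of the complex space L^2(mu) are represented by square-integrable
   functions T -> R[i]; functions that agree mu-almost everywhere represent
   the same element. All the notions below are invariant under this
   identification. *)
Section complex_L2.
Context d (T : measurableType d) (R : realType).
Variable mu : {measure set T -> \bar R}.
Implicit Types f g : T -> R[i].

Definition measurable_cfun f : Prop :=
  measurable_fun [set: T] (fun x => complex.Re (f x)) /\
  measurable_fun [set: T] (fun x => complex.Im (f x)).

Definition L2norm f : \bar R := 'N[mu]_(2%:E)[EFin \o (fun x => Normc.normc (f x))].

Definition L2 f : Prop := measurable_cfun f /\ (L2norm f < +oo)%E.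

Definition cintegral f : R[i] :=
  (\int[mu]_x complex.Re (f x)) +i* (\int[mu]_x complex.Im (f x)).

Definition L2inner f g : R[i] := cintegral (fun x => f x * (g x)^*).

Definition bessel_sequence (I : choiceType) (G : I -> T -> R[i]) : Prop :=
  (forall n, L2 (G n)) /\
  exists2 B : R, 0 < B &
    forall f, L2 f ->
      (\esum_(n in [set: I]) (Normc.normc (L2inner f (G n)) ^+ 2)%:E
         <= B%:E * L2norm f ^+ 2)%E.

Definition frame (I : choiceType) (G : I -> T -> R[i]) : Prop :=
  bessel_sequence G /\
  exists2 A : R, 0 < A &
    forall f, L2 f ->
      (A%:E * L2norm f ^+ 2
         <= \esum_(n in [set: I]) (Normc.normc (L2inner f (G n)) ^+ 2)%:E)%E.

(* The index k < 2M + 1 stands for the integer n = k - M in [-M, M]. *)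
Definition symmetric_partial_sum (u : int -> R[i]) (M : nat) : R[i] :=
  \sum_(k < M.*2.+1) u (k%:Z - M%:Z).

Definition dextrodual (G X : int -> T -> R[i]) : Prop :=
  forall f, L2 f ->
    L2norm (fun x => f x - symmetric_partial_sum
                             (fun n => L2inner f (G n) * X n x) M)
      @[M --> \oo] --> 0%E.

Definition finite_dimensional_L2 : Prop :=
  exists (k : nat) (h : 'I_k -> T -> R[i]),
    (forall i, L2 (h i)) /\
    forall f, L2 f -> exists c : 'I_k -> R[i],
      {ae mu, forall x, f x = \sum_(i < k) c i * h i x}.

End complex_L2.

Definition fourier_exp (R : realType) (n : int) (x : R) : R[i] :=
  cos (2 * pi * n%:~R * x) +i* sin (2 * pi * n%:~R * x).

(* Main.v *)
(* Write e_n(x) = exp(2 pi i n x) and let nu be the singular part, living on an interval that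
   avoids 0.  The Kaczmarz iteration r_0 = f, r_(n+1) = e_(-1) (r_n - <r_n, 1> / nu(T)) gives
   coefficients c_n = <f, h_n>, n >= 0, with f = c_0 e_0 + ... + c_(n-1) e_(n-1) + e_n r_n and
   sum |c_n|^2 <= |f|^2 / nu(T).  It suffices to see that r_n -> 0 for f = e_(-1).  In that case
   b(z) = z sum c_n z^n satisfies C (1 - b) = 1 up to a small error inside the disc, C being the
   Cauchy transform of nu / nu(T), so 1 - |b|^2 is at most a multiple of the Poisson integral
   2 Re C - 1, whose radial limits vanish almost everywhere because nu is singular; hence
   sum |c_n|^2 is as large as it can be.

   On a set Y at positive distance (modulo 1) from the support of nu, the same identity makes
   sum c_n e_n(t) converge uniformly to <f, Q_t> for a bounded kernel Q.  Let E = {g > 0} and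
   phi = 1_E f - 1_Y <f, Q_t>.  The Fourier series of phi converges to phi in L^2(0, 1), and to 0
   in L^2(nu) because phi vanishes near the support of nu.  Adding its coefficients to the c_n
   gives a series whose symmetric partial sums tend to f both on E and in L^2(nu), and the
   coefficients are the inner products of f with a Bessel sequence.

   If L^2(nu) has a finite orthonormal basis (u_i), add to phi the function sum <f, u_i> 1_(J_i)
   with disjoint intervals J_i in Y \ E.  The series still represents f, and by Parseval the
   squares of its coefficients now dominate the square norm of f. *)

(* The radial limits of the overview are replaced by an estimate at a fixed radius r < 1. For a
   truncation b_n of b, the mean over the circle of 1 - |b_n|^2 is at least 1 - sum |c_k|^2, and up
   to a truncation error it is controlled by the mean of a Poisson integral. There a set of t of
   small Lebesgue measure and a set of x of small nu-measure are discarded, and the kernel is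
   uniformly small on the rest. No boundary values of analytic functions enter.

   The case of e_(-1) suffices because the iteration maps e_(k+1) to e_k plus a multiple of e_(-1),
   while e_(-k-1) = e_(-k) e_(-1) is a limit of combinations of frequencies at least -k. Density of
   trigonometric polynomials and contractivity of the iteration do the rest.

   The obstacle on the absolutely continuous side is that the series of the c_n e_n, built for nu
   alone, has a nonzero sum on E. The kernel Q computes that sum as a bounded function of f, so that
   it can be subtracted. Positivity of a and c matters because 0 and 1 are the same point of the
   circle. *)
Require Import Defs.
From mathcomp Require Import all_boot all_order all_algebra.
From mathcomp Require Import complex.
From mathcomp Require Import all_classical all_reals all_analysis.
From mathcomp Require Import measurable_realfun.
From mathcomp Require Import ring lra zify.

Set Implicit Arguments.
Unset Strict Implicit.
Unset Printing Implicit Defensive.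

Import Order.TTheory GRing.Theory Num.Theory.
Import numFieldNormedType.Exports.

Local Open Scope classical_set_scope.
Local Open Scope ring_scope.

(** * The squared modulus *)

Section complex_numbers.
Variable R : realType.
Implicit Types (z w : R[i]).
Local Open Scope complex_scope.
Local Open Scope ring_scope.

(** Real-valued and polynomial in the two components: estimates stay within reach of [ring], [lra]
    and [nra], without square roots. *)
Definition sqc z : R := complex.Re z ^+ 2 + complex.Im z ^+ 2.

Lemma conjE z : z^* = conjc z.
Proof. by []. Qed.

Lemma sqc_ge0 z : 0 <= sqc z.
Proof. by rewrite addr_ge0 ?sqr_ge0. Qed.

Lemma sqcM z w : sqc (z * w) = sqc z * sqc w.
Proof. by case: z => a b; case: w => c d; rewrite /sqc /=; ring. Qed.

Lemma sqc_conj z : sqc z^* = sqc z.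
Proof. by rewrite conjE; case: z => a b; rewrite /sqc /=; ring. Qed.

Lemma sqcN z : sqc (- z) = sqc z.
Proof. by case: z => a b; rewrite /sqc /=; ring. Qed.

Lemma sqc0 : sqc 0 = 0.
Proof. by rewrite /sqc /= expr0n addr0. Qed.

Lemma sqc1 : sqc 1 = 1.
Proof. by rewrite /sqc /= expr1n expr0n addr0. Qed.

Lemma sqc_real (r : R) : sqc r%:C = r ^+ 2.
Proof. by rewrite /sqc /= expr0n addr0. Qed.

Lemma sqcX z n : sqc (z ^+ n) = sqc z ^+ n.
Proof. by elim: n => [|n IH]; rewrite ?expr0 ?sqc1// !exprS sqcM IH. Qed.

Lemma sqcD_le z w : sqc (z + w) <= 2 * sqc z + 2 * sqc w.
Proof.
case: z => a b; case: w => c d; rewrite /sqc /=.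
rewrite -subr_ge0; apply: le_trans (addr_ge0 (sqr_ge0 (a - c)) (sqr_ge0 (b - d))) _.
by rewrite le_eqVlt; apply/orP; left; apply/eqP; ring.
Qed.

Lemma mulc_conj z : z * z^* = (sqc z)%:C.
Proof. by rewrite conjE; case: z => a b; rewrite /sqc; simpc; congr (_ +i* _); ring. Qed.

Lemma sqc_eq0 z : (sqc z == 0) = (z == 0).
Proof.
by case: z => a b; rewrite eq_complex /sqc /= paddr_eq0 ?sqr_ge0// !sqrf_eq0.
Qed.

Lemma sqcV z : sqc z^-1 = (sqc z)^-1.
Proof.
have [->|z0] := eqVneq z 0; first by rewrite invr0 sqc0 invr0.
have s0 : sqc z != 0 by rewrite sqc_eq0.
by apply: (mulfI s0); rewrite -sqcM !mulfV// sqc1.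
Qed.

Lemma normc_sqc z : Normc.normc z ^+ 2 = sqc z.
Proof. by case: z => a b; rewrite /= sqr_sqrtr ?addr_ge0 ?sqr_ge0. Qed.

Lemma Re_le_sqc z : complex.Re z ^+ 2 <= sqc z.
Proof. by rewrite lerDl sqr_ge0. Qed.

Lemma Im_le_sqc z : complex.Im z ^+ 2 <= sqc z.
Proof. by rewrite lerDr sqr_ge0. Qed.

Lemma ReD z w : complex.Re (z + w) = complex.Re z + complex.Re w.
Proof. by case: z; case: w. Qed.
Lemma ImD z w : complex.Im (z + w) = complex.Im z + complex.Im w.
Proof. by case: z; case: w. Qed.
Lemma ReM z w : complex.Re (z * w) =
  complex.Re z * complex.Re w - complex.Im z * complex.Im w.
Proof. by case: z; case: w. Qed.
Lemma ImM z w : complex.Im (z * w) =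
  complex.Re z * complex.Im w + complex.Im z * complex.Re w.
Proof. by case: z; case: w. Qed.
Lemma Re_conj z : complex.Re z^* = complex.Re z.
Proof. by rewrite conjE; case: z. Qed.
Lemma Im_conj z : complex.Im z^* = - complex.Im z.
Proof. by rewrite conjE; case: z. Qed.

Lemma conj_real (r : R) : (r%:C)^* = r%:C.
Proof. by rewrite conjE conjc_real. Qed.

Lemma conjM z w : (z * w)^* = z^* * w^*.
Proof. exact: rmorphM. Qed.

Lemma conjV z : (z^-1)^* = (z^*)^-1.
Proof. exact: fmorphV. Qed.

Lemma addCJ z : z + z^* = 2 * (complex.Re z)%:C.
Proof. by rewrite conjE addcJ. Qed.

End complex_numbers.
Arguments sqc {R} z.

(** * Square-integrable complex functions *)

#[local] Arguments L2inner : simpl never.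
Section L2_toolbox.
Context d (T : measurableType d) (R : realType).
Variable mu : {measure set T -> \bar R}.
Implicit Types (f g h : T -> R[i]) (a b : R[i]) (u v : T -> R).
Local Open Scope complex_scope.
Local Open Scope ring_scope.

Local Notation rint u := (mu.-integrable [set: T] (EFin \o u)).

Lemma mcf_cst a : measurable_cfun ((fun=> a) : T -> R[i]).
Proof. by split; exact: measurable_cst. Qed.

Lemma mcfD f g : measurable_cfun f -> measurable_cfun g ->
  measurable_cfun (f + g).
Proof.
move=> [f1 f2] [g1 g2]; split => /=.
- under eq_fun do rewrite ReD; exact: measurable_funD.
- under eq_fun do rewrite ImD; exact: measurable_funD.
Qed.

Lemma mcfM f g : measurable_cfun f -> measurable_cfun g ->
  measurable_cfun (fun x => f x * g x).
Proof.
move=> [f1 f2] [g1 g2]; split => /=.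
- under eq_fun do rewrite ReM.
  by apply: measurable_funB; exact: measurable_funM.
- under eq_fun do rewrite ImM.
  by apply: measurable_funD; exact: measurable_funM.
Qed.

Lemma mcfZ a f : measurable_cfun f -> measurable_cfun (a *: f).
Proof. by move=> mf; exact: (mcfM (mcf_cst a) mf). Qed.

Lemma mcf_conj f : measurable_cfun f -> measurable_cfun (fun x => (f x)^*).
Proof.
move=> [f1 f2]; split => /=.
- by under eq_fun do rewrite Re_conj.
- under eq_fun do rewrite Im_conj; exact: measurable_funN.
Qed.

Lemma mcf_real u : measurable_fun [set: T] u ->
  measurable_cfun (fun x => (u x)%:C).
Proof. by move=> mu'; split => //=; exact: measurable_cst. Qed.

Lemma mcf_sqc f : measurable_cfun f -> measurable_fun [set: T] (sqc \o f).
Proof. by move=> [f1 f2]; apply: measurable_funD; exact: measurable_funX. Qed.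

Lemma L2normE f : L2norm mu f = ((\int[mu]_x (sqc (f x))%:E) `^ (2^-1))%E.
Proof.
rewrite /L2norm unlock; congr (_ `^ _)%E; apply: eq_integral => x _ /=.
by rewrite powR_mulrn// real_normK ?num_real// normc_sqc.
Qed.

(** A real number in all cases: a divergent integral gives the default value 0, hence the many
    hypotheses [L2] below. *)
Definition nsq f : R := \int[mu]_x (sqc (f x)).

Lemma L2P f : L2 mu f <-> measurable_cfun f /\ rint (sqc \o f).
Proof.
rewrite /L2 L2normE; split=> -[mf H]; split=> //.
- apply/integrableP; split; first exact/measurable_EFinP/mcf_sqc.
  under eq_integral => x _ do rewrite gee0_abs ?lee_fin ?sqc_ge0//.
  by apply: lty_poweRy H; rewrite invr_neq0.
- move/integrableP : H => [_].
  under eq_integral => x _ do rewrite gee0_abs ?lee_fin ?sqc_ge0//.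
  exact: poweR_lty.
Qed.

Lemma L2_mcf f : L2 mu f -> measurable_cfun f.
Proof. by case/L2P. Qed.

Lemma L2_rint f : L2 mu f -> rint (sqc \o f).
Proof. by case/L2P. Qed.

Lemma nsqE f : L2 mu f -> (\int[mu]_x (sqc (f x))%:E = (nsq f)%:E)%E.
Proof.
move=> /L2_rint H; rewrite /nsq /Rintegral fineK//.
exact: integrable_fin_num.
Qed.

Lemma nsq_ge0 f : 0 <= nsq f.
Proof. by apply: Rintegral_ge0 => x _; exact: sqc_ge0. Qed.

Lemma L2norm_nsq f : L2 mu f -> L2norm mu f = (Num.sqrt (nsq f))%:E.
Proof. by move=> Hf; rewrite L2normE nsqE//= powR12_sqrt// nsq_ge0. Qed.

Lemma L2norm_sqr f : L2 mu f -> (L2norm mu f ^+ 2 = (nsq f)%:E)%E.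
Proof.
move=> Hf; rewrite L2norm_nsq// expe2 -EFinM -expr2 sqr_sqrtr// nsq_ge0//.
Qed.

Lemma le_rint u v : measurable_fun [set: T] u -> rint v ->
  (forall x, `|u x| <= v x) -> rint u.
Proof.
move=> mu' iv uv; apply: le_integrable iv => //; first exact/measurable_EFinP.
by move=> x _; rewrite /= lee_fin (le_trans (uv x))// ler_norm.
Qed.

Lemma rintD u v : rint u -> rint v -> rint (fun x => u x + v x).
Proof. by move=> iu iv; exact: (integrableD measurableT iu iv). Qed.

Lemma rintZ (k : R) u : rint u -> rint (fun x => k * u x).
Proof. by move=> iu; exact: (integrableZl measurableT k iu). Qed.

Lemma L2_of_le f u : measurable_cfun f -> rint u ->
  (forall x, sqc (f x) <= u x) -> L2 mu f.
Proof.
move=> mf iu fu; apply/L2P; split=> //; apply: (le_rint _ iu).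
  exact: mcf_sqc.
by move=> x /=; rewrite ger0_norm ?sqc_ge0.
Qed.

Lemma L2D f g : L2 mu f -> L2 mu g -> L2 mu (f + g).
Proof.
move=> /L2P[mf If] /L2P[mg Ig].
apply: (L2_of_le (mcfD mf mg) (rintD (rintZ 2 If) (rintZ 2 Ig))) => x.
exact: sqcD_le.
Qed.

Lemma L2Z a f : L2 mu f -> L2 mu (a *: f).
Proof.
move=> /L2P[mf If]; apply: (L2_of_le (mcfZ a mf) (rintZ (sqc a) If)) => x /=.
by rewrite -sqcM.
Qed.

Lemma L2N f : L2 mu f -> L2 mu (- f).
Proof. by rewrite -scaleN1r; exact: L2Z. Qed.

Lemma L2B f g : L2 mu f -> L2 mu g -> L2 mu (f - g).
Proof. by move=> Hf Hg; apply: L2D => //; exact: L2N. Qed.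

Lemma L20 : L2 mu (0 : T -> R[i]).
Proof.
apply: (@L2_of_le _ (cst 0)); [exact: mcf_cst|exact: integrable0|].
by move=> x /=; rewrite /GRing.zero /= sqc0.
Qed.

Lemma L2_sum (I : Type) (r : seq I) (P : pred I) (F : I -> T -> R[i]) :
  (forall i, P i -> L2 mu (F i)) -> L2 mu (\sum_(i <- r | P i) F i).
Proof. by move=> HF; elim/big_ind: _ => //; [exact: L20|exact: L2D]. Qed.

Definition cintegrable f :=
  rint (fun x => complex.Re (f x)) /\ rint (fun x => complex.Im (f x)).

Lemma cintegrable_le f u : measurable_cfun f -> rint u ->
  (forall x, 0 <= u x) -> (forall x, sqc (f x) <= u x ^+ 2) -> cintegrable f.
Proof.
move=> [f1 f2] iu u0 fu; split; apply: (le_rint _ iu) => // x.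
- rewrite -(@ler_pXn2r _ 2) ?nnegrE// real_normK ?num_real//.
  exact: le_trans (Re_le_sqc _) (fu x).
- rewrite -(@ler_pXn2r _ 2) ?nnegrE// real_normK ?num_real//.
  exact: le_trans (Im_le_sqc _) (fu x).
Qed.

Lemma cintegralD f g : cintegrable f -> cintegrable g ->
  cintegral mu (f + g) = cintegral mu f + cintegral mu g.
Proof.
move=> [f1 f2] [g1 g2]; rewrite /cintegral; congr (_ +i* _).
- by under eq_Rintegral do rewrite ReD; rewrite RintegralD.
- by under eq_Rintegral do rewrite ImD; rewrite RintegralD.
Qed.

Lemma cintegralZ a f : cintegrable f ->
  cintegral mu (a *: f) = a * cintegral mu f.
Proof.
move=> [f1 f2]; case: a => a b; rewrite /cintegral; congr (_ +i* _).
- under eq_Rintegral do rewrite ReM -mulNr/=.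
  by rewrite RintegralD ?RintegralZl ?mulNr//; exact: rintZ.
- under eq_Rintegral do rewrite ImM/=.
  by rewrite RintegralD ?RintegralZl//; exact: rintZ.
Qed.

Lemma cintegral_conj f : cintegrable f ->
  cintegral mu (fun x => (f x)^*) = (cintegral mu f)^*.
Proof.
move=> [f1 f2]; rewrite /cintegral; congr (_ +i* _).
- by under eq_Rintegral do rewrite Re_conj.
- under eq_Rintegral do rewrite Im_conj -mulN1r/=.
  by rewrite RintegralZl// mulN1r.
Qed.

Lemma cintegrable_inner f g : L2 mu f -> L2 mu g ->
  cintegrable (fun x => f x * (g x)^*).
Proof.
move=> /L2P[mf If] /L2P[mg Ig].
apply: (cintegrable_le (mcfM mf (mcf_conj mg)) (rintD If Ig)) => x /=.
  by rewrite addr_ge0 ?sqc_ge0.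
rewrite sqcM sqc_conj sqrrD; have := sqc_ge0 (f x); have := sqc_ge0 (g x).
by move=> ? ?; nra.
Qed.

Local Notation ip := (L2inner mu).

Lemma ipDl f g h : L2 mu f -> L2 mu g -> L2 mu h ->
  ip (f + g) h = ip f h + ip g h.
Proof.
move=> Hf Hg Hh; rewrite -cintegralD; try exact: cintegrable_inner.
by congr cintegral; apply/funext => x; rewrite [LHS]mulrDl.
Qed.

Lemma ipZl a f h : L2 mu f -> L2 mu h -> ip (a *: f) h = a * ip f h.
Proof.
move=> Hf Hh; rewrite -cintegralZ; last exact: cintegrable_inner.
by congr cintegral; apply/funext => x; exact/esym/mulrA.
Qed.

Lemma ipC f g : L2 mu f -> L2 mu g -> ip f g = (ip g f)^*.
Proof.
move=> Hf Hg; rewrite -cintegral_conj; last exact: cintegrable_inner.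
by congr cintegral; apply/funext => x; rewrite rmorphM/= conjCK mulrC.
Qed.

Lemma ipNl f h : L2 mu f -> L2 mu h -> ip (- f) h = - ip f h.
Proof. by move=> Hf Hh; rewrite -scaleN1r ipZl// mulN1r. Qed.

Lemma ipBl f g h : L2 mu f -> L2 mu g -> L2 mu h ->
  ip (f - g) h = ip f h - ip g h.
Proof. by move=> Hf Hg Hh; rewrite ipDl ?ipNl//; exact: L2N. Qed.

Lemma ipDr f g h : L2 mu f -> L2 mu g -> L2 mu h ->
  ip f (g + h) = ip f g + ip f h.
Proof.
move=> Hf Hg Hh; rewrite ipC//; last exact: L2D.
by rewrite ipDl// rmorphD (ipC Hf Hg) (ipC Hf Hh).
Qed.

Lemma ipZr a f h : L2 mu f -> L2 mu h -> ip f (a *: h) = a^* * ip f h.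
Proof.
move=> Hf Hh; rewrite ipC//; last exact: L2Z.
by rewrite ipZl// rmorphM (ipC Hf Hh).
Qed.

Lemma ipBr f g h : L2 mu f -> L2 mu g -> L2 mu h ->
  ip f (g - h) = ip f g - ip f h.
Proof.
move=> Hf Hg Hh; rewrite ipC//; last exact: L2B.
by rewrite ipBl// rmorphB (ipC Hf Hg) (ipC Hf Hh).
Qed.

Lemma ip0l h : L2 mu h -> ip 0 h = 0.
Proof. by move=> Hh; rewrite -(scale0r (0 : T -> R[i])) ipZl ?mul0r//; exact: L20. Qed.

Lemma ip0r h : L2 mu h -> ip h 0 = 0.
Proof. by move=> Hh; rewrite ipC ?ip0l ?rmorph0//; exact: L20. Qed.

Lemma ip_suml (I : Type) (r : seq I) (F : I -> T -> R[i]) h :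
  (forall i, L2 mu (F i)) -> L2 mu h ->
  ip (\sum_(i <- r) F i) h = \sum_(i <- r) ip (F i) h.
Proof.
move=> HF Hh; elim: r => [|i r IH]; first by rewrite !big_nil ip0l.
by rewrite !big_cons ipDl ?IH//; exact: L2_sum.
Qed.

Lemma ip_sumr (I : Type) (r : seq I) (F : I -> T -> R[i]) h :
  (forall i, L2 mu (F i)) -> L2 mu h ->
  ip h (\sum_(i <- r) F i) = \sum_(i <- r) ip h (F i).
Proof.
move=> HF Hh; elim: r => [|i r IH]; first by rewrite !big_nil ip0r.
by rewrite !big_cons ipDr ?IH//; exact: L2_sum.
Qed.

Lemma ip_nsq f : ip f f = (nsq f)%:C.
Proof.
rewrite /L2inner /cintegral; under eq_Rintegral do rewrite mulc_conj/=.
congr (_ +i* _); under eq_Rintegral do rewrite mulc_conj/=.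
by rewrite Rintegral_cst// mul0r.
Qed.

Lemma nsqD f g : L2 mu f -> L2 mu g ->
  nsq (f + g) = nsq f + nsq g + 2 * complex.Re (ip f g).
Proof.
move=> Hf Hg; have Hfg := L2D Hf Hg; apply: (@complexI R); rewrite -ip_nsq.
rewrite ipDl// !ipDr// !ip_nsq (ipC Hg Hf); case: (ip f g) => a b; simpc.
by congr (_ +i* _) => /=; ring.
Qed.

Lemma nsqZ a f : L2 mu f -> nsq (a *: f) = sqc a * nsq f.
Proof.
move=> Hf; apply: (@complexI R); rewrite -ip_nsq ipZl ?ipZr ?ip_nsq//; last exact: L2Z.
by rewrite mulrA mulc_conj rmorphM.
Qed.

Lemma nsqN f : nsq (- f) = nsq f.
Proof. by apply: eq_Rintegral => x _; rewrite sqcN. Qed.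

Lemma nsqB f g : L2 mu f -> L2 mu g ->
  nsq (f - g) = nsq f + nsq g - 2 * complex.Re (ip f g).
Proof.
move=> Hf Hg; rewrite nsqD ?nsqN//; last exact: L2N.
rewrite -scaleN1r ipZr// rmorphN1 mulN1r; case: (ip f g) => a b /=.
by rewrite mulrN.
Qed.

Lemma nsq0 : nsq 0 = 0.
Proof. by rewrite /nsq; under eq_Rintegral do rewrite sqc0; rewrite Rintegral_cst// mul0r. Qed.

Lemma nsqD_le f g : L2 mu f -> L2 mu g -> nsq (f + g) <= 2 * nsq f + 2 * nsq g.
Proof.
move=> Hf Hg; have := nsq_ge0 (f - g); rewrite nsqB// nsqD//; lra.
Qed.

Lemma le_nsq f g : L2 mu f -> L2 mu g -> (forall x, sqc (f x) <= sqc (g x)) ->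
  nsq f <= nsq g.
Proof. by move=> Hf Hg fg; apply: le_Rintegral => //; exact: L2_rint. Qed.

Lemma cauchy_schwarz f g : L2 mu f -> L2 mu g ->
  sqc (ip f g) <= nsq f * nsq g.
Proof.
move=> Hf Hg; set z := ip f g.
(* This is the squared norm of f - t z g, a real quadratic in t; the factor z = <f, g> makes the
   cross term real. *)
have key t : 0 <= nsq f + t ^+ 2 * sqc z * nsq g - 2 * t * sqc z.
  have := nsq_ge0 (f - (t%:C * z) *: g).
  rewrite nsqB ?nsqZ//; last exact: L2Z.
  rewrite ipZr// -/z sqcM sqc_real.
  have -> : complex.Re ((t%:C * z)^* * z) = t * sqc z.
    by case: (z) => x y; rewrite /sqc /=; ring.
  by rewrite mulrA.
(* If g is null, the quadratic is affine in t and a large t makes it negative unless z = 0.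
   Otherwise its minimum is at t = 1 / nsq g. *)
have [g0|g0] := eqVneq (nsq g) 0.
  rewrite g0 mulr0 leNgt; apply/negP => z0.
  have := key ((nsq f + 1) / sqc z); rewrite g0 mulr0 addr0.
  rewrite -mulrA mulfVK ?gt_eqF// => H; have := nsq_ge0 f; lra.
have gp : 0 < nsq g by rewrite lt_def g0 nsq_ge0.
have H := key (nsq g)^-1; rewrite -subr_ge0.
have -> : nsq f * nsq g - sqc z = nsq g * (nsq f + (nsq g)^-1 ^+ 2 * sqc z * nsq g -
  2 * (nsq g)^-1 * sqc z) by field.
exact: mulr_ge0 (ltW gp) H.
Qed.

End L2_toolbox.

Section L2_more.
Context d (T : measurableType d) (R : realType).
Variable mu : {measure set T -> \bar R}.
Implicit Types (f g h : T -> R[i]) (a b : R[i]).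
Local Open Scope complex_scope.
Local Open Scope ring_scope.

Local Notation rint u := (mu.-integrable [set: T] (EFin \o u)).
Local Notation ip := (L2inner mu).

Lemma mcf_inv f : measurable_cfun f -> measurable_cfun (fun x => (f x)^-1).
Proof.
move=> mf; have ms := mcf_sqc mf; case: (mf) => f1 f2.
have mi : measurable_fun [set: T] (fun x => (sqc (f x))^-1).
  (* The reciprocal is written as a real power of exponent -1, whose measurability is known. *)
  rewrite (_ : (fun _ => _) = (fun x => sqc (f x) `^ (-1))); last first.
    by apply/funext => x; rewrite powR_inv1 ?sqc_ge0.
  apply: (@measurableT_comp _ _ _ _ _ _ (fun y : R => y `^ (-1)) _ (sqc \o f)) => //.
have E x : (f x)^-1 = complex.Re (f x) * (sqc (f x))^-1 +i* (- complex.Im (f x) * (sqc (f x))^-1).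
  by case: (f x) => u v; rewrite /sqc /GRing.inv /= mulNr.
split.
- by under eq_fun do rewrite E/=; exact: measurable_funM.
- by under eq_fun do rewrite E/=; apply: measurable_funM => //; exact: measurable_funN.
Qed.

Lemma mcf_indic (A : set T) : measurable A ->
  measurable_cfun (fun x => (\1_A x : R)%:C).
Proof. by move=> mA; apply: mcf_real; exact: measurable_indic. Qed.

Lemma L2M (K : R) h f : measurable_cfun h -> (forall x, sqc (h x) <= K) ->
  L2 mu f -> L2 mu (fun x => h x * f x).
Proof.
move=> mh hK /L2P[mf If]; apply: (L2_of_le (mcfM mh mf) (rintZ K If)) => x /=.
by rewrite sqcM ler_wpM2r ?sqc_ge0.
Qed.

Lemma nsqM_le (K : R) h f : measurable_cfun h -> (forall x, sqc (h x) <= K) ->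
  L2 mu f -> nsq mu (fun x => h x * f x) <= K * nsq mu f.
Proof.
move=> mh hK Hf; rewrite /nsq -RintegralZl//; last exact: L2_rint.
apply: le_Rintegral => //; first exact: (L2_rint (L2M mh hK Hf)).
  exact: (rintZ K (L2_rint Hf)).
by move=> x _; rewrite sqcM ler_wpM2r ?sqc_ge0.
Qed.

Section ae.
Variable X : set T.
Hypotheses (mX : measurable X) (X0 : mu (~` X) = 0%E).

Lemma ae_on (P : T -> Prop) : (forall x, X x -> P x) -> {ae mu, forall x, P x}.
Proof.
move=> HP; exists (~` X); split => //; first exact: measurableC.
by move=> x /= nP Xx; apply: nP; exact: HP.
Qed.

Lemma eq_integral_on (u v : T -> \bar R) : measurable_fun setT u ->
  measurable_fun setT v -> (forall x, X x -> u x = v x) ->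
  (\int[mu]_x u x = \int[mu]_x v x)%E.
Proof.
move=> m1 m2 uv; apply: ae_eq_integral => //.
by apply: ae_on => x Xx _; exact: uv.
Qed.

Lemma eq_Rintegral_on (u v : T -> R) : measurable_fun setT u ->
  measurable_fun setT v -> (forall x, X x -> u x = v x) ->
  \int[mu]_x u x = \int[mu]_x v x.
Proof.
move=> m1 m2 uv; congr fine; apply: eq_integral_on.
- exact/measurable_EFinP.
- exact/measurable_EFinP.
- by move=> x /uv ->.
Qed.

Lemma eq_cintegral_on f g : measurable_cfun f -> measurable_cfun g ->
  (forall x, X x -> f x = g x) -> cintegral mu f = cintegral mu g.
Proof.
move=> [f1 f2] [g1 g2] fg; rewrite /cintegral; congr (_ +i* _).
- by apply: eq_Rintegral_on => // x /fg ->.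
- by apply: eq_Rintegral_on => // x /fg ->.
Qed.

Lemma eq_ip_on f g f' g' : L2 mu f -> L2 mu g -> L2 mu f' -> L2 mu g' ->
  (forall x, X x -> f x * (g x)^* = f' x * (g' x)^*) -> ip f g = ip f' g'.
Proof.
move=> /L2_mcf Hf /L2_mcf Hg /L2_mcf Hf' /L2_mcf Hg' E.
by apply: eq_cintegral_on => //; apply: mcfM => //; exact: mcf_conj.
Qed.

Lemma eq_nsq_on f g : L2 mu f -> L2 mu g -> (forall x, X x -> f x = g x) ->
  nsq mu f = nsq mu g.
Proof.
move=> Hf Hg fg; apply: eq_Rintegral_on.
- exact: mcf_sqc (L2_mcf Hf).
- exact: mcf_sqc (L2_mcf Hg).
- by move=> x /fg ->.
Qed.

End ae.
End L2_more.

Section finite_L2.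
Context d (T : measurableType d) (R : realType).
Variable mu : {finite_measure set T -> \bar R}.
Implicit Types (f g h : T -> R[i]) (a b : R[i]).
Local Open Scope complex_scope.
Local Open Scope ring_scope.

Definition mass : R := fine (mu setT).

Lemma mass_ge0 : 0 <= mass.
Proof. by rewrite fine_ge0. Qed.

Lemma massE : mu setT = mass%:E.
Proof. by rewrite /mass fineK// fin_num_measure. Qed.

Lemma rint_cst (r : R) : mu.-integrable [set: T] (EFin \o (fun=> r)).
Proof. exact: finite_measure_integrable_cst. Qed.

Lemma L2_bounded (K : R) f : measurable_cfun f -> (forall x, sqc (f x) <= K) ->
  L2 mu f.
Proof. by move=> mf fK; exact: (L2_of_le mf (rint_cst K)). Qed.

Lemma L2_cst a : L2 mu (fun=> a).
Proof. by apply: (@L2_bounded (sqc a)); [exact: mcf_cst|]. Qed.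

Lemma nsq_bounded (K : R) f : measurable_cfun f -> (forall x, sqc (f x) <= K) ->
  nsq mu f <= K * mass.
Proof.
move=> mf fK; rewrite -Rintegral_cst//.
by apply: le_Rintegral => //; [exact: (L2_rint (L2_bounded mf fK))|exact: rint_cst].
Qed.

Lemma nsq_cst a : nsq mu (fun=> a) = sqc a * mass.
Proof. by rewrite /nsq Rintegral_cst. Qed.

End finite_L2.

(** * Algebra of the exponentials *)

Section fourier_exp_theory.
Variable R : realType.
Implicit Types (n m : int) (x t : R).
Local Open Scope complex_scope.
Local Open Scope ring_scope.
Local Notation e := (@fourier_exp R).

Lemma fourier_expD n m x : e (n + m) x = e n x * e m x.
Proof.
rewrite /fourier_exp intrD !mulrDr mulrDl cosD sinD; simpc.
by congr (_ +i* _); rewrite addrC.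
Qed.

Lemma fourier_exp0 x : e 0 x = 1.
Proof. by rewrite /fourier_exp mulr0 mul0r cos0 sin0. Qed.

Lemma fourier_exp_conj n x : (e n x)^* = e (- n) x.
Proof. by rewrite conjE /fourier_exp /= mulrNz mulrN mulNr cosN sinN. Qed.

Lemma sqc_fourier_exp n x : sqc (e n x) = 1.
Proof. by rewrite /sqc /fourier_exp/= cos2Dsin2. Qed.

Lemma fourier_expN n x : e (- n) x = (e n x)^-1.
Proof.
have H : e n x * e (- n) x = 1 by rewrite -fourier_expD subrr fourier_exp0.
have n0 : e n x != 0 by rewrite -sqc_eq0 sqc_fourier_exp oner_eq0.
by apply: (mulfI n0); rewrite H mulfV.
Qed.

Lemma fourier_expB n x t : e n (x - t) = e n x * e (- n) t.
Proof.
rewrite /fourier_exp mulrBr cosB sinB /= !(mulrNz, mulrN, mulNr) cosN sinN; simpc.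
by congr (_ +i* _); rewrite ?mulrN ?opprK ?addrA// ?mulNr addrC.
Qed.

Lemma fourier_exp_nat (k : nat) x : e k x = e 1 x ^+ k.
Proof.
elim: k => [|k IH]; first by rewrite fourier_exp0 expr0.
by rewrite exprS -IH -fourier_expD -intS.
Qed.

Lemma mcf_fourier_exp n : measurable_cfun (e n : measurableTypeR R -> R[i]).
Proof.
have ml : measurable_fun [set: measurableTypeR R] (fun x : R => 2 * pi * n%:~R * x).
  exact: mulrl_measurable.
split => /=; apply: continuous_measurable_fun => x; apply: continuous_comp.
- exact: mulrl_continuous.
- exact: continuous_cos.
- exact: mulrl_continuous.
- exact: continuous_sin.
Qed.

End fourier_exp_theory.

(** * Lebesgue measure on [0, 1) *)

Section unit_interval_measure.
Variable R : realType.
Local Open Scope complex_scope.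
Local Open Scope ring_scope.
Local Notation leb := (@lebesgue_measure R).
Local Notation e := (@fourier_exp R).

Let mI : measurable (`[0, 1[%classic : set (measurableTypeR R)).
Proof. exact: measurable_itv. Qed.

Let finI : (leb `[0%R, 1%R[%classic < +oo)%E.
Proof. by rewrite lebesgue_measure_itv/= lte01 oppr0 adde0 ltry. Qed.

(** Kept as a finite measure on the whole line, so that it has the type of nu and both share the
    same L^2 toolbox. *)
Definition lam : {finite_measure set (measurableTypeR R) -> \bar R} :=
  mfrestr mI finI.

Lemma lamE (A : set (measurableTypeR R)) : lam A = leb (A `&` `[0%R, 1%R[).
Proof. by []. Qed.

Lemma lam_setC : lam (~` `[0%R, 1%R[%classic) = 0%E.
Proof. by rewrite lamE setICl measure0. Qed.

Lemma mass_lam : mass lam = 1.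
Proof.
by rewrite /mass lamE setTI lebesgue_measure_itv/= lte01 oppr0 adde0.
Qed.

Lemma integral_lam (u : measurableTypeR R -> \bar R) : measurable_fun setT u ->
  (\int[lam]_x u x = \int[leb]_(x in `[0%R, 1%R[) u x)%E.
Proof.
move=> mu; rewrite (eq_integral_on mI lam_setC (v := u \_ `[0%R, 1%R[)) //.
- rewrite -integral_mkcond; apply: eq_measure_integral => A mA AD.
  by apply: etrans (lamE A) _; rewrite setIidl.
- by apply/(measurable_restrictT u mI); exact: measurable_funTS.
- by move=> x xD; rewrite patchE mem_set.
Qed.

Lemma lam_FTC (f F : R -> R) : continuous f -> (forall x : R, is_derive x 1 F (f x)) ->
  \int[lam]_x f x = F 1 - F 0.
Proof.
move=> cf dF; have mf : measurable_fun [set: measurableTypeR R] f.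
  exact: continuous_measurable_fun.
rewrite /Rintegral integral_lam; last exact/measurable_EFinP.
rewrite integral_itv_bndo_bndc; last exact/measurable_EFinP/measurable_funTS.
have cF : continuous F.
  by move=> x; apply: differentiable_continuous; apply/derivable1_diffP.
rewrite (@continuous_FTC2 _ _ F)//.
- exact: continuous_subspaceT.
- split => //.
  + apply: cvg_at_right_filter; exact: cF.
  + apply: cvg_at_left_filter; exact: cF.
- by move=> x _; rewrite derive1E derive_val.
Qed.

Lemma fourier_exp1 n : e n 1 = 1.
Proof.
have H (k : nat) : e k 1 = 1.
  rewrite fourier_exp_nat (_ : e 1 1 = 1) ?expr1n//.
  by rewrite /fourier_exp !mulr1 mulr_natl cos2pi sin2pi.
case: n => k //; rewrite NegzE fourier_expN H invr1//.
Qed.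

Lemma cintegral_fourier_exp n : cintegral lam (e n) = (n == 0)%:R.
Proof.
have [->|n0] := eqVneq n 0.
  rewrite /cintegral; under eq_Rintegral do rewrite fourier_exp0 /=.
  under [X in _ +i* X]eq_Rintegral do rewrite fourier_exp0 /=.
  by rewrite !Rintegral_cst// mul0r mul1r [fine _]mass_lam.
set w : R := 2 * pi * n%:~R.
have w0 : w != 0 by rewrite /w !mulf_eq0 intr_eq0 (negPf n0) orbF pnatr_eq0/= gt_eqF ?pi_gt0.
have /(congr1 (@complex.Re _)) /= c1 := fourier_exp1 n.
have /(congr1 (@complex.Im _)) /= s1 := fourier_exp1 n.
rewrite /= /cintegral; congr (_ +i* _).
- have cf : continuous (fun x => cos (w * x)).
    by move=> x; apply: continuous_comp; [exact: mulrl_continuous|exact: continuous_cos].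
  have dF (x : R) : is_derive x 1 (fun x : R => w^-1 * sin (w * x)) (cos (w * x)).
    by apply: is_derive_eq; rewrite /GRing.scale/= mulr1; field.
  by apply: etrans (lam_FTC cf dF) _; rewrite mulr0 sin0 /w s1 !mulr0 subr0.
- have cf : continuous (fun x => sin (w * x)).
    by move=> x; apply: continuous_comp; [exact: mulrl_continuous|exact: continuous_sin].
  have dF (x : R) : is_derive x 1 (fun x : R => - w^-1 * cos (w * x)) (sin (w * x)).
    by apply: is_derive_eq; rewrite /GRing.scale/= mulr1; field.
  by apply: etrans (lam_FTC cf dF) _; rewrite mulr0 cos0 /w c1 !mulr1 subrr.
Qed.

Lemma L2_fourier_exp (nu : {finite_measure set (measurableTypeR R) -> \bar R}) n :
  L2 nu (e n).
Proof.
apply: (@L2_bounded _ _ _ _ 1); first exact: mcf_fourier_exp.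
by move=> x; rewrite sqc_fourier_exp.
Qed.

Lemma ip_fourier_exp n m : L2inner lam (e n) (e m) = (n == m)%:R.
Proof.
rewrite -subr_eq0 -cintegral_fourier_exp /L2inner; congr cintegral.
by apply/funext => x; rewrite [RHS]fourier_expD -fourier_exp_conj.
Qed.

End unit_interval_measure.

(** * Density of trigonometric polynomials *)

Section dominated.
Context d (T : measurableType d) (R : realType).
Variable mu : {measure set T -> \bar R}.
Local Open Scope complex_scope.
Local Open Scope ring_scope.

Lemma nsq_cvg0 (X : set T) (h_ : nat -> T -> R[i]) (u : T -> R) :
  measurable X -> mu (~` X) = 0%E ->
  (forall n, measurable_cfun (h_ n)) ->
  mu.-integrable [set: T] (EFin \o u) ->
  (forall n x, X x -> sqc (h_ n x) <= u x) ->
  (forall x, X x -> sqc (h_ n x) @[n --> \oo] --> 0) ->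
  nsq mu (h_ n) @[n --> \oo] --> 0.
Proof.
move=> mX X0 mh iu hu h0.
have [|||||] := @dominated_convergence _ T R mu setT measurableT
    (fun n x => (sqc (h_ n x))%:E) (cst 0%E) (EFin \o u).
- by move=> n; apply/measurable_EFinP; exact: mcf_sqc.
- exact: measurable_cst.
- apply: (ae_on mX X0) => x Xx _; apply/fine_cvgP; split; first exact: nearW.
  exact: h0.
- exact: iu.
- apply: (ae_on mX X0) => x Xx n _.
  by rewrite /= ger0_norm ?sqc_ge0// lee_fin hu.
move=> _ _; rewrite integral0 => /fine_cvgP[_].
exact.
Qed.

End dominated.

Lemma cvg0_near (R : realType) (u : nat -> R) : u n @[n --> \oo] --> 0 ->
  forall eps, 0 < eps -> exists N, forall n, (N <= n)%N -> `|u n| < eps.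
Proof. by move=> /cvgr0_norm_lt H eps /H[N _ HN]; exists N => n /HN. Qed.

Lemma near_cvg0 (R : realType) (u : nat -> R) :
  (forall eps, 0 < eps -> exists N, forall n, (N <= n)%N -> `|u n| < eps) ->
  u n @[n --> \oo] --> 0.
Proof. by move=> H; apply/cvgr0Pnorm_lt => eps /H[N HN]; exists N. Qed.

Section density.
Variable R : realType.
Local Open Scope complex_scope.
Local Open Scope ring_scope.
Local Notation TR := (measurableTypeR R).
Local Notation e := (@fourier_exp R).

Inductive trigpoly : (TR -> R[i]) -> Prop :=
| trigpoly_exp n : trigpoly (e n)
| trigpolyD f g : trigpoly f -> trigpoly g -> trigpoly (f + g)
| trigpolyZ a f : trigpoly f -> trigpoly (a *: f).

Lemma trigpoly_cst a : trigpoly (fun=> a).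
Proof.
rewrite (_ : (fun=> a) = a *: e 0); first exact/trigpolyZ/trigpoly_exp.
by apply/funext => x; rewrite [RHS](_ : _ = a * e 0 x)// fourier_exp0 mulr1.
Qed.

Lemma trigpolyM f g : trigpoly f -> trigpoly g -> trigpoly (fun x => f x * g x).
Proof.
move=> Hf Hg; elim: Hf => [n|f1 f2 _ H1 _ H2|a f1 _ H1].
- elim: Hg => [m|g1 g2 _ H1 _ H2|a g1 _ H1].
  + rewrite (_ : (fun x => _) = e (n + m)); first exact: trigpoly_exp.
    by apply/funext => x; rewrite fourier_expD.
  + rewrite (_ : (fun x => _) = (fun x => e n x * g1 x) + (fun x => e n x * g2 x)).
      exact: trigpolyD.
    by apply/funext => x; exact: mulrDr.
  + rewrite (_ : (fun x => _) = a *: (fun x => e n x * g1 x)); first exact: trigpolyZ.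
    by apply/funext => x; exact: mulrCA.
- rewrite (_ : (fun x => _) = (fun x => f1 x * g x) + (fun x => f2 x * g x)).
    exact: trigpolyD.
  by apply/funext => x; exact: mulrDl.
- rewrite (_ : (fun x => _) = a *: (fun x => f1 x * g x)); first exact: trigpolyZ.
  by apply/funext => x; exact/esym/mulrA.
Qed.

Lemma trigpolyX f n : trigpoly f -> trigpoly (fun x => f x ^+ n).
Proof.
move=> Hf; elim: n => [|n IH]; first exact: trigpoly_cst.
rewrite (_ : (fun _ => _) = (fun x => f x * f x ^+ n)); first exact: trigpolyM.
by apply/funext => x; rewrite exprS.
Qed.

Lemma trigpoly_cos s : trigpoly (fun x => (cos (2 * pi * (x - s)))%:C).
Proof.
rewrite (_ : (fun _ => _) = (2^-1 * e (-1) s) *: e 1 + (2^-1 * e 1 s) *: e (-1)).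
  by apply: trigpolyD; apply/trigpolyZ/trigpoly_exp.
apply/funext => x; rewrite [RHS](_ : _ = 2^-1 * (e 1 (x - s) + e (-1) (x - s))).
  have -> : cos (2 * pi * (x - s)) = complex.Re (e 1 (x - s)).
    by rewrite /fourier_exp/= mulr1.
  by rewrite -fourier_exp_conj addCJ mulrA mulVf ?mul1r// pnatr_eq0.
by rewrite !fourier_expB opprK mulrDr !mulrA -[LHS]/(_ * _ + _ * _); congr (_ + _); rewrite mulrAC.
Qed.

Lemma trigpoly_mcf f : trigpoly f -> measurable_cfun f.
Proof.
elim=> [n|g h _ Hg _ Hh|a g _ Hg]; first exact: mcf_fourier_exp.
- exact: mcfD.
- exact: mcfZ.
Qed.

Lemma trigpoly_bounded f : trigpoly f -> exists K : R, forall x, sqc (f x) <= K.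
Proof.
elim=> [n|g h _ [K HK] _ [L HL]|a g _ [K HK]].
- by exists 1 => x; rewrite sqc_fourier_exp.
- exists (2 * K + 2 * L) => x; apply: le_trans (sqcD_le _ _) _.
  by rewrite lerD// ler_pM2l.
- by exists (sqc a * K) => x; rewrite sqcM ler_wpM2l ?sqc_ge0.
Qed.

Variable nu : {finite_measure set TR -> \bar R}.
Local Notation N := (nsq nu).

Lemma trigpoly_L2 f : trigpoly f -> L2 nu f.
Proof.
by move=> Hf; have [K] := trigpoly_bounded Hf; apply: L2_bounded; exact: trigpoly_mcf.
Qed.

Definition trig_approx f := L2 nu f /\
  forall eps : R, 0 < eps -> exists2 p, trigpoly p & N (f - p) < eps.

Lemma trig_approx_L2 f : trig_approx f -> L2 nu f. Proof. by case. Qed.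

Lemma trig_approx_trigpoly p : trigpoly p -> trig_approx p.
Proof.
move=> Hp; split; first exact: trigpoly_L2.
by move=> eps eps0; exists p => //; rewrite subrr nsq0.
Qed.

Lemma trig_approx_lim f : L2 nu f ->
  (forall eps : R, 0 < eps -> exists2 h, trig_approx h & N (f - h) < eps) ->
  trig_approx f.
Proof.
move=> Hf H; split=> // eps eps0.
have e4 : 0 < eps / 4 by rewrite divr_gt0.
have [h [Hh /(_ _ e4)[p Hp hp]] fh] := H _ e4; exists p => //.
rewrite (_ : f - p = (f - h) + (h - p)); last by rewrite addrA subrK.
have Lp := trigpoly_L2 Hp.
by have := nsqD_le (L2B Hf Hh) (L2B Hh Lp); lra.
Qed.

Lemma trig_approxD f g : trig_approx f -> trig_approx g -> trig_approx (f + g).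
Proof.
move=> [Hf af] [Hg ag]; split; first exact: L2D.
move=> eps eps0; have e4 : 0 < eps / 4 by rewrite divr_gt0.
have [p Hp fp] := af _ e4; have [q Hq gq] := ag _ e4.
exists (p + q); first exact: trigpolyD.
have Lp := trigpoly_L2 Hp; have Lq := trigpoly_L2 Hq.
rewrite opprD addrACA.
by have := nsqD_le (L2B Hf Lp) (L2B Hg Lq); lra.
Qed.

(** Multiplication by a bounded h is continuous in L^2, so f may be replaced by a nearby
    trigonometric polynomial. *)
Lemma trig_approxM_aux f h (K : R) : measurable_cfun h ->
  (forall x, sqc (h x) <= K) -> trig_approx f ->
  (forall p, trigpoly p -> trig_approx (fun x => h x * p x)) ->
  trig_approx (fun x => h x * f x).
Proof.
move=> mh hK [Hf af] H; apply: trig_approx_lim; first exact: L2M hK Hf.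
move=> eps eps0; pose L := `|K| + 1.
have hL x : sqc (h x) <= L by rewrite (le_trans (hK x))// (le_trans (ler_norm _))// lerDl.
have L0 : 0 < L by rewrite ltr_wpDl.
have [p Hp fp] := af _ (divr_gt0 eps0 L0).
exists (fun x => h x * p x); first exact: H.
have -> : (fun x => h x * f x) - (fun x => h x * p x) = (fun x => h x * (f - p) x).
  by apply/funext => x; rewrite [RHS]mulrBr.
apply: le_lt_trans (nsqM_le mh hL (L2B Hf (trigpoly_L2 Hp))) _.
by rewrite mulrC -ltr_pdivlMr.
Qed.

(** Two passes of [trig_approxM_aux]: the first reduces f to a trigonometric polynomial p; the
    second, with p as the bounded factor, reduces h to one. *)
Lemma trig_approxM f h (K : R) : trig_approx h -> 
  (forall x, sqc (h x) <= K) -> trig_approx f -> trig_approx (fun x => h x * f x).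
Proof.
move=> Hh hK Hf; apply: (trig_approxM_aux _ hK) => //.
  exact/L2_mcf/trig_approx_L2.
move=> p Hp; rewrite (_ : (fun _ => _) = (fun x => p x * h x)); last first.
  by apply/funext => x; rewrite mulrC.
have [L HL] := trigpoly_bounded Hp.
apply: (trig_approxM_aux _ HL) => //; first exact: trigpoly_mcf.
by move=> q Hq; apply: trig_approx_trigpoly; exact: trigpolyM.
Qed.

Lemma trig_approxZ a f : trig_approx f -> trig_approx (a *: f).
Proof.
move=> Hf; apply: (@trig_approxM _ (fun=> a) (sqc a)) => //.
exact/trig_approx_trigpoly/trigpoly_cst.
Qed.

Lemma trig_approx_dominated f (f_ : nat -> TR -> R[i]) (u : TR -> R) :
  L2 nu f -> nu.-integrable [set: TR] (EFin \o u) ->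
  (forall n, trig_approx (f_ n)) ->
  (forall n x, sqc (f x - f_ n x) <= u x) ->
  (forall x, sqc (f x - f_ n x) @[n --> \oo] --> 0) ->
  trig_approx f.
Proof.
move=> Hf iu Hf_ fu f0; apply: trig_approx_lim => // eps eps0.
have : N (f - f_ n) @[n --> \oo] --> 0.
  apply: (@nsq_cvg0 _ _ _ _ setT _ u) => //.
  - by rewrite setCT measure0.
  - by move=> n; exact: (L2_mcf (L2B Hf (trig_approx_L2 (Hf_ n)))).
- by move=> n x _; exact: fu.
- by move=> x _; exact: f0.
move=> /cvg0_near/(_ _ eps0)[n /(_ n (leqnn n))].
by rewrite ger0_norm ?nsq_ge0// => H; exists (f_ n).
Qed.

(** These sets turn out to form a sigma-algebra, so density comes down to finding a generating
    family inside it. *)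
Definition trig_set (A : set TR) :=
  measurable A /\ trig_approx (fun x => (\1_A x : R)%:C).

Lemma sqc_indic (A : set TR) x : sqc (\1_A x : R)%:C <= 1.
Proof. by rewrite sqc_real indicE; case: (_ \in _); rewrite ?expr1n ?expr0n. Qed.

Lemma L2_indic (A : set TR) : measurable A -> L2 nu (fun x => (\1_A x : R)%:C).
Proof. by move=> mA; apply: (@L2_bounded _ _ _ _ 1); [exact: mcf_indic|exact: sqc_indic]. Qed.

Lemma trig_setT : trig_set setT.
Proof.
split => //; rewrite (_ : (fun _ => _) = (fun=> 1)).
  exact/trig_approx_trigpoly/trigpoly_cst.
by apply/funext => x; rewrite indicT.
Qed.

Lemma trig_setC A : trig_set A -> trig_set (~` A).
Proof.
move=> [mA HA]; split; first exact: measurableC.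
rewrite (_ : (fun _ => _) = (fun=> 1) + (-1) *: (fun x => (\1_A x : R)%:C)).
  apply: trig_approxD; last exact: trig_approxZ.
  exact/trig_approx_trigpoly/trigpoly_cst.
apply/funext => x; rewrite [RHS](_ : _ = 1 + -1 * (\1_A x : R)%:C)//.
rewrite !indicE in_setC; case: (x \in A) => /=; first by rewrite mulr1 subrr.
by rewrite mulr0 addr0.
Qed.

Lemma trig_setI A B : trig_set A -> trig_set B -> trig_set (A `&` B).
Proof.
move=> [mA HA] [mB HB]; split; first exact: measurableI.
rewrite (_ : (fun _ => _) = (fun x => (\1_A x : R)%:C * (\1_B x : R)%:C)).
  by apply: (trig_approxM (K := 1)) => //; exact: sqc_indic.
by apply/funext => x; rewrite indicI/= rmorphM.
Qed.

Lemma trig_setU A B : trig_set A -> trig_set B -> trig_set (A `|` B).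
Proof.
move=> HA HB; rewrite -[_ `|` _]setCK setCU.
by apply: trig_setC; apply: trig_setI; exact: trig_setC.
Qed.

Lemma trig_set_limit (A_ : nat -> set TR) A : measurable A ->
  (forall n, trig_set (A_ n)) ->
  (forall x, \forall n \near \oo, (x \in A_ n) = (x \in A)) -> trig_set A.
Proof.
move=> mA HA_ lim; split=> //.
apply: (@trig_approx_dominated _ (fun n x => (\1_(A_ n) x : R)%:C) (fun=> 4)).
- exact: L2_indic.
- exact: rint_cst.
- by move=> n; have [] := HA_ n.
- move=> n x; apply: le_trans (sqcD_le _ _) _; rewrite sqcN.
  by have := sqc_indic A x; have := sqc_indic (A_ n) x; lra.
- move=> x; apply: cvg_near_cst; apply: filterS (lim x) => n E.
  by rewrite !indicE E subrr sqc0.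
Qed.

Lemma trig_set_bigcup (F : nat -> set TR) :
  (forall n, trig_set (F n)) -> trig_set (\bigcup_n F n).
Proof.
move=> HF; apply: (@trig_set_limit (fun n => \big[setU/set0]_(i < n) F i)).
- by apply: bigcup_measurable => n _; case: (HF n).
- move=> n; elim: n => [|n IH]; first by rewrite big_ord0 -setCT; exact/trig_setC/trig_setT.
  by rewrite big_ord_recr; exact: trig_setU.
- move=> x; have [[n _ Fn]|nF] := pselect ((\bigcup_n F n) x).
    exists n.+1 => // k /= nk; rewrite !mem_set//; first by exists n.
    by rewrite -bigcup_mkord; exists n.
  apply: nearW => n; rewrite !memNset// -bigcup_mkord => -[i _ Fi].
  by apply: nF; exists i.
Qed.

Lemma trig_set_eq (X A B : set TR) : measurable X -> nu (~` X) = 0%E ->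
  measurable A -> (forall x, X x -> A x <-> B x) -> trig_set B -> trig_set A.
Proof.
move=> mX X0 mA AB [mB HB]; split=> //; apply: trig_approx_lim; first exact: L2_indic.
move=> eps eps0; exists (fun x => (\1_B x : R)%:C) => //.
have LA := L2_indic mA; have LB := L2_indic mB.
rewrite (@eq_nsq_on _ _ _ _ X mX X0 _ 0) ?nsq0//; first exact: L2B.
  exact: L20.
move=> x Xx; rewrite [LHS](_ : _ = (\1_A x : R)%:C - (\1_B x : R)%:C)// !indicE.
rewrite (_ : x \in A = (x \in B)) ?subrr//.
by apply/idP/idP; rewrite !inE => /(AB _ Xx).
Qed.

End density.

(** * Powers that approximate a step function *)

Section real_sequences.
Variable R : realType.
Implicit Types (q r y : R).

Lemma bernoulli_ge q (n : nat) : -1 <= q -> 1 + n%:R * q <= (1 + q) ^+ n.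
Proof.
move=> q1; elim: n => [|n IH]; first by rewrite expr0 mul0r addr0.
have q0 : 0 <= 1 + q by lra.
rewrite exprS; apply: le_trans (ler_wpM2l q0 IH).
have := mulr_ge0 (ler0n R n) (sqr_ge0 q); rewrite -natr1; lra.
Qed.

(** With s the square root of r, Bernoulli bounds n s^n by a constant, and the other factor s^n
    tends to 0. *)
Lemma cvg_natM_expr r : 0 <= r < 1 -> n%:R * r ^+ n @[n --> \oo] --> 0.
Proof.
move=> /andP[r0 r1]; have [->|rN0] := eqVneq r 0.
  apply: cvg_near_cst; exists 1%N => // n /= n0.
  by rewrite expr0n gtn_eqF// mulr0.
have rp : 0 < r by rewrite lt_def rN0.
set s := Num.sqrt r; have s0 : 0 < s by rewrite sqrtr_gt0.
have s1 : s < 1 by rewrite -sqrtr1 ltr_sqrt.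
have d0 : 0 < s^-1 - 1 by rewrite subr_gt0 invf_gt1.
apply: (@squeeze_cvgr _ _ _ _ (cst 0) (fun n => (s^-1 - 1)^-1 * s ^+ n)).
- apply: nearW => n; rewrite mulr_ge0 ?exprn_ge0//=.
  have -> : r ^+ n = s ^+ n * s ^+ n by rewrite -exprMn -expr2 sqr_sqrtr.
  rewrite mulrA ler_wpM2r ?exprn_ge0 ?(ltW s0)// mulrC -ler_pdivlMl ?exprn_gt0//.
  rewrite ler_pdivlMr// -exprVn.
  have := @bernoulli_ge (s^-1 - 1) n; rewrite addrCA subrr addr0 => /(_ _).
  by move=> H; apply: le_trans (H _); rewrite ?lerDr//; lra.
- exact: cvg_cst.
- rewrite -[X in _ --> X](mulr0 (s^-1 - 1)^-1); apply: cvgMr; apply: cvg_expr.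
  by rewrite ger0_norm// ltW.
Qed.

(** Bernoulli gives the lower bound 1 - n (2 y)^n. The exponents n and n 2^n put the jump of the
    limit at y = 1/2. *)
Lemma cutoff_cvg1 y : 0 <= y < 1 / 2 ->
  (1 - y ^+ n) ^+ (n * 2 ^ n) @[n --> \oo] --> (1 : R).
Proof.
move=> /andP[y0 y1].
have H : 1 - n%:R * (2 * y) ^+ n @[n --> \oo] --> (1 : R).
  by rewrite -[X in _ --> X]subr0; apply: cvgB; [exact: cvg_cst|apply: cvg_natM_expr; lra].
apply: (@squeeze_cvgr _ _ _ _ (fun n => 1 - n%:R * (2 * y) ^+ n) (cst 1)).
2: exact: H. 2: exact: cvg_cst.
apply: nearW => n; have yn1 : y ^+ n <= 1 by rewrite exprn_ile1//; lra.
have yn0 : 0 <= y ^+ n by rewrite exprn_ge0.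
apply/andP; split; last by rewrite exprn_ile1//; lra.
have := @bernoulli_ge (- y ^+ n) (n * 2 ^ n); rewrite natrM natrX mulrN exprMn mulrA.
by apply; lra.
Qed.

(** Since (1 - y^n) (1 + y^n) <= 1, it is enough that (1 + y^n)^(n 2^n) >= 1 + n (2 y)^n is large;
    the factor n makes this work even at y = 1/2. *)
Lemma cutoff_cvg0 y : 1 / 2 <= y <= 1 ->
  (1 - y ^+ n) ^+ (n * 2 ^ n) @[n --> \oo] --> (0 : R).
Proof.
move=> /andP[y0 y1].
apply: (@squeeze_cvgr _ _ _ _ (cst 0) (@harmonic R)).
2: exact: cvg_cst. 2: exact: cvg_harmonic.
apply: nearW => n; have yn1 : y ^+ n <= 1 by rewrite exprn_ile1//; lra.
have yn0 : 0 <= y ^+ n by rewrite exprn_ge0//; lra.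
rewrite exprn_ge0 ?subr_ge0//=.
have B := @bernoulli_ge (y ^+ n) (n * 2 ^ n).
have {}B : n.+1%:R <= (1 + y ^+ n) ^+ (n * 2 ^ n).
  apply: le_trans (B _); last by lra.
  rewrite natrM natrX -mulrA -exprMn -natr1 addrC lerD2l.
  by rewrite ler_peMr// exprn_ege1//; lra.
rewrite /harmonic /= -[leRHS]mul1r ler_pdivlMr ?ltr0n//.
apply: le_trans (ler_wpM2l _ B) _; first by rewrite exprn_ge0 ?subr_ge0.
rewrite -exprMn exprn_ile1//; nra.
Qed.

Lemma cutoff_ge0_le1 y n : 0 <= y <= 1 -> 0 <= (1 - y ^+ n) ^+ (n * 2 ^ n) <= 1.
Proof.
move=> /andP[y0 y1]; have yn1 : y ^+ n <= 1 by rewrite exprn_ile1//; lra.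
have yn0 : 0 <= y ^+ n by rewrite exprn_ge0//; lra.
by rewrite exprn_ge0 ?subr_ge0//= exprn_ile1//; lra.
Qed.

Lemma sin_2pi_gt0 (u : R) : 0 < u < 1 / 2 -> 0 < sin (2 * pi * u).
Proof.
move=> /andP[u0 u1]; apply: sin_gt0_pi; have p0 := @pi_gt0 R.
by rewrite !mulr_gt0//=; nra.
Qed.

Lemma sin_2pi_le0 (u : R) : - (1 / 2) <= u <= 0 -> sin (2 * pi * u) <= 0.
Proof.
move=> /andP[u0 u1]; rewrite -oppr_ge0 -sinN; apply: sin_ge0_pi.
by have p0 := @pi_gt0 R; apply/andP; split; nra.
Qed.

Lemma sin_2piB1 (u : R) : sin (2 * pi * (u - 1)) = sin (2 * pi * u).
Proof.
by rewrite mulrBr mulr1 -sinD2pi mulr_natl subrK.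
Qed.

End real_sequences.

Import HBSimple HBNNSimple.

(** * Density, from half circles to all square-integrable functions *)

Section trigpoly_dense.
Variable R : realType.
Local Open Scope complex_scope.
Local Open Scope ring_scope.
Local Notation TR := (measurableTypeR R).
Local Notation e := (@fourier_exp R).
Variable nu : {finite_measure set TR -> \bar R}.

Lemma trig_set_half s : trig_set nu [set x : TR | 0 < sin (2 * pi * (x - s))].
Proof.
(* This is (1 - sin (2 pi (x - s))) / 2, with values in [0, 1] and below 1/2 exactly on the half
   circle. The shift by 1/4 turns the sine into a cosine. *)
pose y (x : TR) : R := 2^-1 + - (2^-1 * cos (2 * pi * (x - (s + 1/4)))).
have yE x : y x = 2^-1 - 2^-1 * sin (2 * pi * (x - s)).
  rewrite /y opprD addrA mulrBr (_ : 2 * pi * (1 / 4) = pi / 2) ?cosBpihalf//.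
  by field.
have y01 x : 0 <= y x <= 1.
  by rewrite yE; have := sin_geN1 (2 * pi * (x - s)); have := sin_le1 (2 * pi * (x - s)); lra.
have tpy : trigpoly (fun x => (y x)%:C).
  rewrite (_ : (fun _ => _) = (fun=> (2^-1)%:C) +
     (- 2^-1)%:C *: (fun x => (cos (2 * pi * (x - (s + 1/4))))%:C)).
    by apply: trigpolyD; [exact: trigpoly_cst|apply/trigpolyZ/trigpoly_cos].
  apply/funext => x; rewrite [RHS](_ : _ = (2^-1)%:C + (- 2^-1)%:C * (cos (2 * pi * (x - (s + 1/4))))%:C)//.
  by rewrite -rmorphM -rmorphD mulNr.
pose f_ n x := ((1 - y x ^+ n) ^+ (n * 2 ^ n))%:C.
have tpf n : trigpoly (f_ n).
  rewrite (_ : f_ n = fun x => ((fun=> 1) + (-1) *: (fun x => (y x)%:C ^+ n)) x ^+ (n * 2 ^ n)).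
    by apply/trigpolyX/trigpolyD; [exact: trigpoly_cst|apply/trigpolyZ/trigpolyX].
  apply/funext => x; rewrite /f_ rmorphXn rmorphB rmorph1 rmorphXn.
  by congr (_ ^+ _); rewrite -mulN1r.
have mH : measurable [set x : TR | 0 < sin (2 * pi * (x - s))].
  rewrite (_ : [set x | _] = [set x | y x < 1 / 2]); last first.
    by apply/seteqP; split => x /=; rewrite yE => H; lra.
  have my : measurable_fun [set: TR] y by have [] := trigpoly_mcf tpy.
  by rewrite -[X in measurable X]setTI; apply: measurable_fun_ltr => //; exact: measurable_cst.
split=> //; apply: (@trig_approx_dominated _ _ _ f_ (fun=> 4)).
- exact: L2_indic.
- exact: rint_cst.
- by move=> n; exact: trig_approx_trigpoly.
- move=> n x; apply: le_trans (sqcD_le _ _) _; rewrite sqcN.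
  rewrite /f_ !sqc_real indicE.
  have /andP[c0 c1] := cutoff_ge0_le1 n (y01 x).
  have c2 : ((1 - y x ^+ n) ^+ (n * 2 ^ n)) ^+ 2 <= 1 by rewrite exprn_ile1.
  by case: (_ \in _); rewrite ?expr1n ?expr0n/=; lra.
- move=> x; set A := [set x : TR | _].
  have H : (1 - y x ^+ n) ^+ (n * 2 ^ n) @[n --> \oo] --> (\1_A x : R).
    rewrite indicE; case: (boolP (x \in A)).
      rewrite inE /A /= => sx; apply: cutoff_cvg1; have /andP[y0 _] := y01 x.
      by rewrite y0 yE; lra.
    rewrite notin_setE /A /= => /negP; rewrite -leNgt => sx; apply: cutoff_cvg0.
    by have /andP[_ ->] := y01 x; rewrite yE andbT; lra.
  rewrite (_ : (fun n => _) = fun n => (\1_A x - (1 - y x ^+ n) ^+ (n * 2 ^ n)) ^+ 2).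
    rewrite -[X in _ --> X](expr0n _ 2) -(subrr (\1_A x : R)).
    by apply: cvgM; apply: cvgB => //; exact: cvg_cst.
  by apply/funext => n; rewrite /f_ -rmorphB sqc_real.
Qed.

Hypothesis nu_unit : nu (~` `[0, 1[%classic) = 0%E.

Let mU : measurable (`[0, 1[%classic : set TR). Proof. exact: measurable_itv. Qed.

Lemma trig_set_ray (p : R) : trig_set nu `]p, +oo[%classic.
Proof.
have mp : measurable (`]p, +oo[%classic : set TR) by exact: measurable_itv.
have [p0|p0] := ltP p 0.
  apply: (trig_set_eq mU nu_unit mp (B := setT)); last exact: trig_setT.
  by move=> x /=; rewrite !in_itv/= andbT => /andP[x0 _]; split=> // _; exact: lt_le_trans x0.
have [p1'|p1'] := leP 1 p.
  apply: (trig_set_eq mU nu_unit mp (B := ~` setT)); last exact/trig_setC/trig_setT.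
  move=> x /=; rewrite !in_itv/= andbT => /andP[_ x1]; split=> [px|[]//].
  by have := lt_trans (le_lt_trans p1' px) x1; rewrite ltxx.
pose H s := [set x : TR | 0 < sin (2 * pi * (x - s))].
have Hle0 s (x : R) : - (1 / 2) <= x - s <= 0 -> H s x -> False.
  by move=> /sin_2pi_le0; rewrite /H /= leNgt => /negP.
have Hle0' s (x : R) : 1 / 2 <= x - s <= 1 -> H s x -> False.
  move=> h; rewrite /H /= -sin_2piB1 ltNge sin_2pi_le0//; lra.
have Hgt0 s (x : R) : 0 < x - s < 1/2 -> H s x by exact: sin_2pi_gt0.
(* Inside [0, 1), H p and H (1/2) cover ]p, p + 1/2[ and ]1/2, 1[. The third half circle catches the
   endpoint p + 1/2, which the first two miss when p = 0. *)
have [p1|p1] := ltP p (1/2).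
- apply: (trig_set_eq mU nu_unit mp (B := H p `|` H (1/2) `|` H ((p + 1/2)/2))); last first.
    by do ?apply: trig_setU; exact: trig_set_half.
  move=> /= x; rewrite !in_itv/= andbT => /andP[x0 x1]; split.
  + move=> px; have [h|h|h] := ltgtP (x : R) (p + 1/2).
    * by left; left; apply: Hgt0; lra.
    * by left; right; apply: Hgt0; lra.
    * by right; apply: Hgt0; lra.
  + by move=> h; rewrite ltNge; apply/negP => xp; case: h => [[]|] /Hle0; apply; lra.
(* For p >= 1/2 the half circle H p wraps around 0; intersecting with H (1/2) removes the part that
   wraps. *)
- apply: (trig_set_eq mU nu_unit mp (B := H p `&` H (1/2))); last first.
    by apply: trig_setI; exact: trig_set_half.
  move=> /= x; rewrite !in_itv/= andbT => /andP[x0 x1]; split.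
  + by move=> px; split; apply: Hgt0; lra.
  + move=> [h1 h2]; rewrite ltNge; apply/negP => xp.
    have [h|h] := leP x (1/2); first by apply: (Hle0 _ _ _ h2); lra.
    by apply: (Hle0 _ _ _ h1); lra.
Qed.

Lemma trig_set_measurable (A : set TR) : measurable A -> trig_set nu A.
Proof.
move=> mA; have : <<s RGenOInfty.G (R:=R) >> A.
  exact: (eq_ind _ (fun S : set (set R) => S A) mA _ (RGenOInfty.measurableE R)).
apply: smallest_sub => //; last by move=> _ [x ->]; exact: trig_set_ray.
split.
- by rewrite -setCT; apply: trig_setC; exact: trig_setT.
- by move=> B; rewrite setTD; exact: trig_setC.
- exact: trig_set_bigcup.
Qed.

Lemma trig_approx_sfun (f : {sfun TR >-> R}) : trig_approx nu (fun x => (f x)%:C).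
Proof.
rewrite (_ : (fun _ => _) = \sum_(y <- finmap.enum_fset (fset_set (range f))) y%:C *: (fun x => (\1_(f @^-1` [set y]) x : R)%:C)).
  elim/big_ind: _ => //.
  - rewrite (_ : 0 = fun=> 0)//; exact/trig_approx_trigpoly/trigpoly_cst.
  - exact: trig_approxD.
  - move=> y _; apply: trig_approxZ; apply: (trig_set_measurable _).2.
    exact: measurable_funPTI.
apply/funext => x; rewrite fimfunE fsbig_finite//= fct_sumE rmorph_sum.
by apply: eq_bigr => y _; rewrite rmorphM.
Qed.

Lemma trig_approx_ge0 (u : TR -> R) : L2 nu (fun x => (u x)%:C) ->
  (forall x, 0 <= u x) -> trig_approx nu (fun x => (u x)%:C).
Proof.
move=> Lu u0; have mu : measurable_fun setT (EFin \o u).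
  by apply/measurable_EFinP; have [] := L2_mcf Lu.
pose f_ := nnsfun_approx measurableT mu.
have cf (x : TR) : f_ n x @[n --> \oo] --> u x.
  have u0' (y : TR) : setT y -> (0 <= (EFin \o u) y)%E by move=> _; rewrite lee_fin.
  by have /fine_cvgP[] := cvg_nnsfun_approx measurableT mu u0' (I : setT x).
have fu n (x : TR) : f_ n x <= u x.
  have ndf : {homo (fun n => f_ n x) : n m / (n <= m)%N >-> n <= m}.
    by move=> i j ij; have /lefP := nd_nnsfun_approx measurableT mu ij; exact.
  rewrite -(cvg_lim (@Rhausdorff R) (cf x)); apply: nondecreasing_cvgn_le => //.
  by apply/cvg_ex; exists (u x).
apply: (@trig_approx_dominated _ _ _ (fun n x => (f_ n x)%:C) (fun x => sqc (u x)%:C)) => //.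
- exact: (L2_rint Lu).
- by move=> n; exact: trig_approx_sfun.
- move=> n x; rewrite -rmorphB !sqc_real ler_sqr ?nnegrE//.
  + by rewrite gerBl.
  + by rewrite subr_ge0.
- move=> x; rewrite (_ : (fun n => _) = fun n => (u x - f_ n x) ^+ 2); last first.
    by apply/funext => n; rewrite -rmorphB sqc_real.
  rewrite -[X in _ --> X](expr0n _ 2) -(subrr (u x)).
  by apply: cvgM; apply: cvgB => //; exact: cvg_cst.
Qed.

Lemma trig_approx_real (u : TR -> R) : L2 nu (fun x => (u x)%:C) ->
  trig_approx nu (fun x => (u x)%:C).
Proof.
move=> Lu; have [mu _] := L2_mcf Lu.
rewrite (_ : (fun _ => _) = (fun x => (Num.max (u x) 0)%:C) + (-1) *: (fun x => (Num.max (- u x) 0)%:C)).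
  apply: trig_approxD; [|apply: trig_approxZ].
  - apply: trig_approx_ge0; last by move=> x; rewrite le_max lexx orbT.
    apply: (L2_of_le _ (L2_rint Lu)).
      by apply: mcf_real; apply: measurable_maxr => //; exact: measurable_cst.
    by move=> x; rewrite [leRHS](_ : _ = sqc (u x)%:C)// !sqc_real; case: (leP (u x) 0) => h; rewrite ?expr0n/= ?sqr_ge0.
  - apply: trig_approx_ge0; last by move=> x; rewrite le_max lexx orbT.
    apply: (L2_of_le _ (L2_rint Lu)).
      by apply: mcf_real; apply: measurable_maxr; [exact: measurable_funN|exact: measurable_cst].
    by move=> x; rewrite [leRHS](_ : _ = sqc (u x)%:C)// !sqc_real; case: (leP (- u x) 0) => h; rewrite ?expr0n/= ?sqrrN ?sqr_ge0.
apply/funext => x; rewrite [RHS](_ : _ = (Num.max (u x) 0)%:C + -1 * (Num.max (- u x) 0)%:C)//.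
rewrite mulN1r -rmorphB; congr (_%:C); case: (leP (u x) 0) => h1; case: (leP (- u x) 0) => h2; lra.
Qed.

Theorem trigpoly_dense f : L2 nu f -> trig_approx nu f.
Proof.
move=> Lf; have [m1 m2] := L2_mcf Lf.
rewrite (_ : f = (fun x => (complex.Re (f x))%:C) + 'i%C *: (fun x => (complex.Im (f x))%:C)).
  apply: trig_approxD; [|apply: trig_approxZ]; apply: trig_approx_real.
  - apply: (L2_of_le _ (L2_rint Lf)); first exact: mcf_real.
    by move=> x; rewrite sqc_real Re_le_sqc.
  - apply: (L2_of_le _ (L2_rint Lf)); first exact: mcf_real.
    by move=> x; rewrite sqc_real Im_le_sqc.
by apply/funext => x; rewrite [LHS]complexE.
Qed.

End trigpoly_dense.

(** * Fourier series on [0, 1) *)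

Lemma summable_cvg0 (R : realType) (u : nat -> R) (B : R) :
  (forall n, 0 <= u n) -> (forall n, \sum_(i < n) u i <= B) ->
  u n @[n --> \oo] --> 0.
Proof.
move=> u0 uB; apply: cvg_series_cvg_0; apply: nondecreasing_is_cvgn.
  by apply/nondecreasing_seqP => n; rewrite /series/= big_nat_recr//= lerDl.
by exists B => _ [n _ <-]; rewrite /series/= big_mkord.
Qed.

Section fourier_series.
Variable R : realType.
Local Open Scope complex_scope.
Local Open Scope ring_scope.
Local Notation TR := (measurableTypeR R).
Local Notation e := (@fourier_exp R).
Local Notation lam := (lam R).
Local Notation ip := (L2inner lam).
Local Notation N := (nsq lam).
Implicit Types (s : seq int) (f : TR -> R[i]).

Definition sym_range (M : nat) : seq int :=
  [seq k%:Z - M%:Z | k <- iota 0 M.*2.+1].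

Lemma sym_range_uniq M : uniq (sym_range M).
Proof. by rewrite map_inj_uniq ?iota_uniq// => i j /addIr[]. Qed.

Lemma mem_sym_range M (n : int) : (n \in sym_range M) = (absz n <= M)%N.
Proof.
apply/mapP/idP => [[k]|nM].
  by rewrite mem_iota => /andP[_ kM] ->; lia.
by exists (absz (n + M%:Z)); [rewrite mem_iota|]; lia.
Qed.

Lemma big_sym_range (V : nmodType) M (F : int -> V) :
  \sum_(k < M.*2.+1) F (k%:Z - M%:Z) = \sum_(n <- sym_range M) F n.
Proof. by rewrite big_map -(big_mkord xpredT (fun k => F (k%:Z - M%:Z))) /index_iota subn0. Qed.

Definition fourier_sum s f : TR -> R[i] := \sum_(n <- s) ip f (e n) *: e n.

Lemma L2_exp_sum (nu : {finite_measure set TR -> \bar R}) (a : int -> R[i]) s :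
  L2 nu (\sum_(n <- s) a n *: e n).
Proof. by apply: L2_sum => n _; apply: L2Z; exact: L2_fourier_exp. Qed.

Lemma nsq_exp_sum (a : int -> R[i]) s : uniq s ->
  N (\sum_(n <- s) a n *: e n) = \sum_(n <- s) sqc (a n).
Proof.
elim: s => [|m s IH] /=; first by rewrite !big_nil nsq0.
move=> /andP[ms us]; have Le n := L2_fourier_exp lam n.
have Lae n : L2 lam (a n *: e n) by exact: L2Z.
rewrite !big_cons nsqD//; last exact: L2_exp_sum.
rewrite IH// ip_sumr//.
have -> : \sum_(i <- s) ip (a m *: e m) (a i *: e i) = 0.
  apply: big1_seq => n /andP[_ ns]; rewrite ipZl ?ipZr ?ip_fourier_exp//.
  by case: eqP => [mn|_]; [rewrite mn ns in ms|rewrite !mulr0].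
rewrite mulr0 addr0; congr (_ + _).
by rewrite nsqZ// /nsq; under eq_Rintegral do rewrite sqc_fourier_exp;
   rewrite Rintegral_cst// mul1r [fine _]mass_lam mulr1.
Qed.

Lemma nsq_fourier_sumB s f : uniq s -> L2 lam f ->
  N (f - fourier_sum s f) = N f - \sum_(n <- s) sqc (ip f (e n)).
Proof.
move=> us Lf; have Le n := L2_fourier_exp lam n.
rewrite nsqB//; last exact: L2_exp_sum.
rewrite nsq_exp_sum// ip_sumr//; last by move=> n; exact: L2Z.
rewrite (_ : \sum_(n <- s) ip f _ = (\sum_(n <- s) sqc (ip f (e n)))%:C) /=.
  by ring.
rewrite rmorph_sum; apply: eq_bigr => n _.
by rewrite ipZr// mulrC mulc_conj.
Qed.

Lemma bessel_ineq s f : uniq s -> L2 lam f ->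
  \sum_(n <- s) sqc (ip f (e n)) <= N f.
Proof. by move=> us Lf; rewrite -subr_ge0 -nsq_fourier_sumB// nsq_ge0. Qed.

Lemma fourier_sumD s f g : L2 lam f -> L2 lam g ->
  fourier_sum s (f + g) = fourier_sum s f + fourier_sum s g.
Proof.
move=> Lf Lg; rewrite /fourier_sum -big_split /=; apply: eq_bigr => n _.
by rewrite ipDl ?scalerDl//; exact: L2_fourier_exp.
Qed.

Lemma fourier_sumZ s a f : L2 lam f -> fourier_sum s (a *: f) = a *: fourier_sum s f.
Proof.
move=> Lf; rewrite /fourier_sum scaler_sumr; apply: eq_bigr => n _.
by rewrite ipZl ?scalerA//; exact: L2_fourier_exp.
Qed.

Lemma fourier_sum_trigpoly p : trigpoly p ->
  exists M0, forall M, (M0 <= M)%N -> fourier_sum (sym_range M) p = p.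
Proof.
elim=> [n|f g Hf [M1 H1] Hg [M2 H2]|a f Hf [M1 H1]].
- exists (absz n) => M nM; rewrite /fourier_sum (bigD1_seq n) ?sym_range_uniq//=; last first.
    by rewrite mem_sym_range.
  rewrite ip_fourier_exp eqxx scale1r big1 ?addr0// => m mn.
  by rewrite ip_fourier_exp eq_sym (negPf mn) scale0r.
- exists (maxn M1 M2) => M; rewrite geq_max => /andP[/H1 E1 /H2 E2].
  by rewrite fourier_sumD ?E1 ?E2//; exact: trigpoly_L2.
- by exists M1 => M /H1 E1; rewrite fourier_sumZ ?E1//; exact: trigpoly_L2.
Qed.

Lemma fourier_sum_cvg f : L2 lam f ->
  N (f - fourier_sum (sym_range M) f) @[M --> \oo] --> 0.
Proof.
move=> Lf; apply: near_cvg0 => eps eps0.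
have [_ /(_ _ eps0)[p Hp fp]] := trigpoly_dense (@lam_setC R) Lf.
have [M0 HM0] := fourier_sum_trigpoly Hp; exists M0 => M /HM0 E.
rewrite ger0_norm ?nsq_ge0//; have Lp := trigpoly_L2 lam Hp.
(* For large M the partial sum reproduces p, so the error for f is the error for f - p, and removing
   a partial sum does not increase the norm. *)
rewrite (_ : f - _ = (f - p) - fourier_sum (sym_range M) (f - p)); last first.
  rewrite fourier_sumD//; last exact: L2N.
  have -> : fourier_sum (sym_range M) (- p) = - p.
    by rewrite -[in LHS]scaleN1r fourier_sumZ// E scaleN1r.
  by rewrite opprD opprK addrACA addNr addr0.
rewrite nsq_fourier_sumB ?sym_range_uniq//; last exact: L2B.
apply: le_lt_trans fp; rewrite gerBl; apply: sumr_ge0 => n _; exact: sqc_ge0.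
Qed.

(** Stated along an injection of indices so that it applies to frequencies tending to either end of
    the integers. *)
Lemma fourier_coef_cvg0 f (g : nat -> int) : L2 lam f -> injective g ->
  sqc (ip f (e (g n))) @[n --> \oo] --> 0.
Proof.
move=> Lf ginj; apply: (summable_cvg0 (B := N f)) => [n|n]; first exact: sqc_ge0.
rewrite -(big_mkord xpredT (fun i => sqc (ip f (e (g i))))) /index_iota subn0.
rewrite -(big_map g xpredT (fun i => sqc (ip f (e i)))).
by apply: bessel_ineq => //; rewrite map_inj_uniq ?iota_uniq.
Qed.

End fourier_series.

(** * The Kaczmarz algorithm *)

Section kaczmarz.
Variable R : realType.
Local Open Scope complex_scope.
Local Open Scope ring_scope.
Local Notation TR := (measurableTypeR R).
Local Notation e := (@fourier_exp R).
Variable nu : {finite_measure set TR -> \bar R}.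
Local Notation ip := (L2inner nu).
Local Notation N := (nsq nu).
Local Notation m := (mass nu).
Implicit Types (f g h : TR -> R[i]).

Definition twist (n : int) f : TR -> R[i] := fun x => e n x * f x.

Lemma L2_twist n f : L2 nu f -> L2 nu (twist n f).
Proof.
apply: (@L2M _ _ _ _ 1); first exact: mcf_fourier_exp.
by move=> x; rewrite sqc_fourier_exp.
Qed.

Lemma nsq_twist n f : N (twist n f) = N f.
Proof. by apply: eq_Rintegral => x _; rewrite sqcM sqc_fourier_exp mul1r. Qed.

Lemma ip_twist n f g : ip (twist n f) g = ip f (twist (- n) g).
Proof.
congr cintegral; apply/funext => x.
by rewrite /twist rmorphM [X in _ = _ * (X * _)]fourier_exp_conj opprK mulrCA mulrA.
Qed.

Local Notation one := ((fun=> 1) : TR -> R[i]).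

Let L1 : L2 nu one. Proof. exact: L2_cst. Qed.

Definition avg f : R[i] := ip f one / m%:C.

Definition kT f : TR -> R[i] := twist (-1) (f - avg f *: one).
Definition kTadj f : TR -> R[i] := twist 1 f - avg (twist 1 f) *: one.

Lemma L2_kT f : L2 nu f -> L2 nu (kT f).
Proof. by move=> Lf; apply: L2_twist; apply: L2B => //; exact: L2Z. Qed.

Lemma L2_iter_kT n f : L2 nu f -> L2 nu (iter n kT f).
Proof. by move=> Lf; elim: n => //= n; exact: L2_kT. Qed.

Lemma L2_kTadj f : L2 nu f -> L2 nu (kTadj f).
Proof. by move=> Lf; apply: L2B; [exact: L2_twist|exact: L2Z]. Qed.

Lemma avgD f g : L2 nu f -> L2 nu g -> avg (f + g) = avg f + avg g.
Proof. by move=> Lf Lg; rewrite /avg ipDl// mulrDl. Qed.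

Lemma avgZ a f : L2 nu f -> avg (a *: f) = a * avg f.
Proof. by move=> Lf; rewrite /avg ipZl// mulrA. Qed.

Lemma kTD f g : L2 nu f -> L2 nu g -> kT (f + g) = kT f + kT g.
Proof.
move=> Lf Lg; rewrite /kT avgD// scalerDl opprD addrACA.
by apply/funext => x; exact: mulrDr.
Qed.

Lemma kTZ a f : L2 nu f -> kT (a *: f) = a *: kT f.
Proof.
move=> Lf; rewrite /kT avgZ// -scalerA -scalerBr.
by apply/funext => x; exact: mulrCA.
Qed.

Lemma iter_kTD n f g : L2 nu f -> L2 nu g ->
  iter n kT (f + g) = iter n kT f + iter n kT g.
Proof. by move=> Lf Lg; elim: n => //= n ->; rewrite kTD//; exact: L2_iter_kT. Qed.

Lemma iter_kTZ n a f : L2 nu f -> iter n kT (a *: f) = a *: iter n kT f.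
Proof. by move=> Lf; elim: n => //= n ->; rewrite kTZ//; exact: L2_iter_kT. Qed.

Lemma kT_split f x : f x = avg f + e 1 x * kT f x.
Proof.
rewrite /kT /twist mulrA -fourier_expD subrr fourier_exp0 mul1r.
by rewrite [(f - _) x](_ : _ = f x - avg f * 1)// mulr1 addrC subrK.
Qed.

Lemma kT_expansion n f :
  f = \sum_(k < n) avg (iter k kT f) *: e k%:Z + twist n%:Z (iter n kT f).
Proof.
apply/funext => x; elim: n => [|n IH].
  by rewrite big_ord0 add0r /twist /= fourier_exp0 mul1r.
rewrite {1}IH big_ord_recr /= -[RHS]/((_ + _) + _) -[LHS]/(_ + _) -addrA.
rewrite [X in _ = _ + X](_ : _ = avg (iter n kT f) * e n x + e n.+1 x * kT (iter n kT f) x)//.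
rewrite /twist (kT_split (iter n kT f)) mulrDr mulrA -fourier_expD addrC.
by rewrite [n%:Z + 1]addrC -intS mulrC [RHS]addrC.
Qed.

Lemma kT_adj f g : L2 nu f -> L2 nu g -> ip (kT f) g = ip f (kTadj g).
Proof.
move=> Lf Lg; have Lt := L2_twist 1 Lg; have Lc a : L2 nu (a *: one) by exact: L2Z.
rewrite ip_twist opprK ipBl// ipBr// ipZl// ipZr//; congr (_ - _).
rewrite /avg conjM conjV conj_real (ipC Lt L1) conjCK.
by rewrite mulrC mulrA mulrAC.
Qed.

Lemma iter_kT_adj n f g : L2 nu f -> L2 nu g ->
  ip (iter n kT f) g = ip f (iter n kTadj g).
Proof.
move=> Lf; elim: n g => //= n IH g Lg.
rewrite (kT_adj (L2_iter_kT n Lf) Lg).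
by rewrite (IH _ (L2_kTadj Lg)) -iterSr iterS.
Qed.

(** The functional c_n = [avg (iter n kT f)] is 1/m times the inner product of the n-th residual
    with 1; moving the iterates of [kT] to the other side yields this vector. *)
Definition kaczmarz_dual (n : nat) : TR -> R[i] := (m^-1)%:C *: iter n kTadj one.

Lemma L2_kaczmarz_dual n : L2 nu (kaczmarz_dual n).
Proof. by apply: L2Z; elim: n => //= n; exact: L2_kTadj. Qed.

Lemma ip_kaczmarz_dual n f : L2 nu f ->
  ip f (kaczmarz_dual n) = avg (iter n kT f).
Proof.
move=> Lf; rewrite ipZr//; last by elim: n => //= n; exact: L2_kTadj.
by rewrite -iter_kT_adj// conj_real mulrC fmorphV.
Qed.

Hypothesis m_gt0 : 0 < m.

Let m_neq0 : m%:C != 0 :> R[i].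
Proof. by rewrite (inj_eq (@complexI R)) gt_eqF. Qed.

Lemma avg_cst a : avg (a *: one) = a.
Proof. by rewrite avgZ// /avg ip_nsq nsq_cst sqc1 mul1r divff// mulr1. Qed.

(** Pythagoras: removing the average projects onto the complement of the constants, and [twist] is
    an isometry. *)
Lemma nsq_kT f : L2 nu f -> N (kT f) = N f - m * sqc (avg f).
Proof.
move=> Lf; rewrite nsq_twist nsqB//; last exact: L2Z.
rewrite nsqZ// nsq_cst sqc1 mul1r ipZr//.
have -> : ip f one = avg f * m%:C by rewrite mulfVK.
have -> : complex.Re ((avg f)^* * (avg f * m%:C)) = m * sqc (avg f).
  by rewrite mulrA (mulrC _^*) mulc_conj -rmorphM/= mulrC.
by ring.
Qed.

Lemma nsq_iter_kT n f : L2 nu f ->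
  N (iter n kT f) = N f - m * \sum_(k < n) sqc (avg (iter k kT f)).
Proof.
move=> Lf; elim: n => [|n IH]; first by rewrite big_ord0 mulr0 subr0.
rewrite big_ord_recr /= nsq_kT ?IH; last exact: L2_iter_kT.
by ring.
Qed.

Lemma nsq_iter_kT_le n f : L2 nu f -> N (iter n kT f) <= N f.
Proof.
move=> Lf; rewrite nsq_iter_kT// gerBl mulr_ge0 ?(ltW m_gt0)//.
by apply: sumr_ge0 => k _; exact: sqc_ge0.
Qed.

Lemma nsq_iter_kT_mono n k f : L2 nu f -> (n <= k)%N ->
  N (iter k kT f) <= N (iter n kT f).
Proof. by move=> Lf nk; rewrite -(subnK nk) iterD nsq_iter_kT_le//; exact: L2_iter_kT. Qed.

Lemma kaczmarz_bessel n f : L2 nu f ->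
  \sum_(k < n) sqc (ip f (kaczmarz_dual k)) <= m^-1 * N f.
Proof.
move=> Lf; under eq_bigr do rewrite ip_kaczmarz_dual//.
have := nsq_ge0 nu (iter n kT f); rewrite nsq_iter_kT// subr_ge0 => H.
by rewrite mulrC ler_pdivlMr// mulrC.
Qed.

Definition dies f := N (iter n kT f) @[n --> \oo] --> 0.

Lemma diesD f g : L2 nu f -> L2 nu g -> dies f -> dies g -> dies (f + g).
Proof.
move=> Lf Lg df dg.
apply: (@squeeze_cvgr _ _ _ _ (cst 0) (fun n => 2 * N (iter n kT f) + 2 * N (iter n kT g))).
- apply: nearW => n; rewrite nsq_ge0/= iter_kTD//.
  by apply: nsqD_le; exact: L2_iter_kT.
- exact: cvg_cst.
- rewrite -[X in _ --> X](addr0 0) -[X in _ --> X + _](mulr0 2) -[X in _ --> _ + X](mulr0 2).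
  by apply: cvgD; apply: cvgMr.
Qed.

Lemma diesZ a f : L2 nu f -> dies f -> dies (a *: f).
Proof.
move=> Lf df; rewrite /dies (_ : (fun n => _) = fun n => sqc a * N (iter n kT f)).
  by rewrite -[X in _ --> X](mulr0 (sqc a)); apply: cvgMr.
by apply/funext => n; rewrite iter_kTZ// nsqZ//; exact: L2_iter_kT.
Qed.

(** The iterates of [kT] are contractions, so the functions whose residuals vanish in the limit form
    a closed set. *)
Lemma dies_lim f : L2 nu f ->
  (forall eps, 0 < eps -> exists h, [/\ L2 nu h, dies h & N (f - h) < eps]) -> dies f.
Proof.
move=> Lf H; apply: near_cvg0 => eps eps0.
have e4 : 0 < eps / 4 by rewrite divr_gt0.
have [h [Lh /cvg0_near/(_ _ e4)[n0 Hn] fh]] := H _ e4.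
exists n0 => n /Hn; rewrite !ger0_norm ?nsq_ge0// => hn.
rewrite -(subrK h f) iter_kTD//; last exact: L2B.
have := nsqD_le (L2_iter_kT n (L2B Lf Lh)) (L2_iter_kT n Lh).
by have := nsq_iter_kT_le n (L2B Lf Lh); lra.
Qed.

Lemma dies_shift f : dies (kT f) -> dies f.
Proof.
move=> /cvg0_near H; apply: near_cvg0 => eps /H[n0 Hn].
by exists n0.+1 => -[//|n] n0n; rewrite iterSr; exact: Hn.
Qed.

Lemma dies_sum (I : Type) (r : seq I) (F : I -> TR -> R[i]) :
  (forall i, L2 nu (F i)) -> (forall i, dies (F i)) -> dies (\sum_(i <- r) F i).
Proof.
move=> LF dF; have LS s : L2 nu (\sum_(i <- s) F i) by exact: L2_sum.
elim: r => [|i r IH]; last by rewrite big_cons; exact: diesD.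
(* The empty sum is treated as 0 times the constant 1, which a single step of the iteration
   kills. *)
rewrite big_nil; have -> : (0 : TR -> R[i]) = 0 *: one by rewrite scale0r.
apply: diesZ => //; apply: dies_shift.
rewrite (_ : kT one = 0 *: one).
  rewrite /dies; under eq_fun do rewrite iter_kTZ// scale0r nsq0.
  exact: cvg_cst.
by rewrite scale0r /kT -{2}[one]scale1r avg_cst scale1r subrr; apply/funext => x; exact: mulr0.
Qed.

Let Le n := L2_fourier_exp nu n.

Lemma kT_exp (k : int) : kT (e (k + 1)) = e k + (- avg (e (k + 1))) *: e (-1).
Proof.
apply/funext => x; rewrite /kT /twist.
rewrite [LHS](_ : _ = e (-1) x * (e (k + 1) x - avg (e (k + 1)) * 1))//.
rewrite [RHS](_ : _ = e k x + (- avg (e (k + 1))) * e (-1) x)//.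
by rewrite mulr1 mulrBr -fourier_expD addrCA addNr addr0 mulNr [in RHS]mulrC.
Qed.

Hypothesis nu_unit : nu (~` `[0, 1[%classic) = 0%E.
Hypothesis dies_m1 : dies (e (-1)).

Lemma dies_all f : L2 nu f -> dies f.
Proof.
(* One step sends e_0 to 0, and e_(k+1) to e_k plus a multiple of e_(-1), which dies by
   hypothesis. *)
have dpos (k : nat) : dies (e k%:Z).
  elim: k => [|k IH]; apply: dies_shift.
    rewrite (_ : 0%:Z = -1 + 1)// kT_exp (_ : -1 + 1 = 0 :> int)//.
    have -> : avg (e 0) = 1.
      rewrite (_ : e 0 = 1 *: one) ?avg_cst// scale1r; apply/funext => x; exact: fourier_exp0.
    rewrite scaleN1r subrr -(scale0r (e (-1))); exact: diesZ.
  rewrite intS addrC kT_exp; apply: diesD => //; first exact: L2Z.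
  exact: diesZ.
(* As e_(-1) dies, its expansion along nonnegative frequencies converges to it. Multiplied by
   e_(-k), an isometry, this approximates e_(-k-1) by frequencies i - k >= -k, which are covered by
   induction. *)
have dneg (k : nat) : forall j : nat, (j <= k)%N -> dies (e (- j%:Z)).
  elim: k => [|k IH] j; first by rewrite leqn0 => /eqP ->; exact: dpos 0%N.
  rewrite leq_eqVlt => /predU1P[->|]; last by rewrite ltnS; exact: IH.
  apply: dies_lim => // eps eps0.
  have [n /(_ n (leqnn n))] := cvg0_near dies_m1 eps0.
  rewrite ger0_norm ?nsq_ge0// => Hn.
  exists (twist (- k%:Z) (\sum_(i < n) avg (iter i kT (e (-1))) *: e i%:Z)); split.
  - by apply: L2_twist; apply: L2_sum => i _; exact: L2Z.
  - rewrite (_ : twist _ _ = \sum_(i < n) avg (iter i kT (e (-1))) *: e (i%:Z - k%:Z)).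
      apply: dies_sum => i; first exact: L2Z.
      apply: diesZ => //; have [ki|ik] := leqP k i.
        by rewrite subzn//; exact: dpos.
      by rewrite -opprB subzn ?(ltnW ik)//; apply: IH; exact: leq_subr.
    apply/funext => x; rewrite /twist !fct_sumE mulr_sumr; apply: eq_bigr => i _.
    rewrite [LHS](_ : _ = e (- k%:Z) x * (avg (iter i kT (e (-1))) * e i x))//.
    by rewrite mulrCA -fourier_expD addrC.
  - apply: le_lt_trans Hn; rewrite -[leRHS](nsq_twist n%:Z) -[leRHS](nsq_twist (- k%:Z)).
    rewrite le_eqVlt; apply/predU1P; left; congr nsq; apply/funext => x.
    have /(congr1 (fun F => F x)) := kT_expansion n (e (-1)).
    rewrite -[X in _ = X]/(_ + _) => E.
    rewrite [LHS](_ : _ = e (- k.+1%:Z) x - e (- k%:Z) x * (\sum_(i < n) avg (iter i kT (e (-1))) *: e i%:Z) x)//.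
    rewrite [RHS](_ : _ = e (- k%:Z) x * twist n (iter n kT (e (-1))) x)//.
    rewrite (_ : - k.+1%:Z = - k%:Z - 1); last by rewrite intS opprD addrC.
    rewrite fourier_expD E -mulrBr; congr (_ * _).
    by rewrite addrAC subrr add0r.
have dexp n : dies (e n).
  case: n => k; first exact: dpos.
  by rewrite NegzE; exact: (dneg k.+1).
have dtrig p : trigpoly p -> dies p.
  elim=> [//|g h Hg dg Hh dh|a g Hg dg].
  - by apply: diesD => //; exact: trigpoly_L2.
  - by apply: diesZ => //; exact: trigpoly_L2.
move=> Lf; apply: dies_lim => // eps eps0.
have [_ /(_ _ eps0)[p Hp fp]] := trigpoly_dense nu_unit Lf.
by exists p; split => //; [exact: trigpoly_L2|exact: dtrig].
Qed.

End kaczmarz.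

(** * Cauchy transforms *)

Section cauchy_transform.
Variable R : realType.
Local Open Scope complex_scope.
Local Open Scope ring_scope.
Local Notation TR := (measurableTypeR R).
Local Notation e := (@fourier_exp R).
Variable nu : {finite_measure set TR -> \bar R}.
Local Notation ip := (L2inner nu).
Local Notation N := (nsq nu).
Local Notation m := (mass nu).
Local Notation one := ((fun=> 1) : TR -> R[i]).
Implicit Types (f g h ker : TR -> R[i]) (z : R[i]).

(** The conjugate undoes that of the inner product: this is the integral of ker f against the
    normalized measure nu / m. *)
Definition cauchyT ker f : R[i] := ip f (fun x => (ker x)^*) / m%:C.

(** The kernel is prescribed only on X, which lets one record serve two cases: |z| < 1 with X the
    whole line, and |z| = 1 at a point away from the support of nu. *)
Record cauchy_kernel (X : set TR) (K : R) z ker : Prop := CauchyKernel {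
  ck_measurable : measurable_cfun ker;
  ck_bound : forall x, sqc (ker x) <= K;
  ck_eq : forall x, X x -> ker x * (1 - z * e (-1) x) = 1 }.

Lemma L2_ker (K : R) ker : measurable_cfun ker ->
  (forall x, sqc (ker x) <= K) -> L2 nu (fun x => (ker x)^*).
Proof.
move=> mk kK; apply: (@L2_bounded _ _ _ _ K); first exact: mcf_conj.
by move=> x; rewrite sqc_conj.
Qed.

Variable X : set TR.
Hypotheses (mX : measurable X) (X0 : nu (~` X) = 0%E).
Hypothesis m_gt0 : 0 < m.

Let m_neq0 : m%:C != 0 :> R[i].
Proof. by rewrite (inj_eq (@complexI R)) gt_eqF. Qed.

Let L1 : L2 nu one. Proof. exact: L2_cst. Qed.

Section kernel.
Variables (K : R) (z : R[i]) (ker : TR -> R[i]).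
Hypothesis kerP : cauchy_kernel X K z ker.

Let Lk : L2 nu (fun x => (ker x)^*).
Proof. by case: kerP => mk kK _; exact: L2_ker mk kK. Qed.

Lemma cauchyT_le f : L2 nu f -> sqc (cauchyT ker f) <= K / m * N f.
Proof.
move=> Lf; rewrite /cauchyT sqcM sqcV sqc_real ler_pdivrMr ?exprn_gt0//.
apply: le_trans (cauchy_schwarz Lf Lk) _.
have -> : K / m * N f * m ^+ 2 = N f * (K * m) by field; rewrite gt_eqF.
rewrite ler_wpM2l ?nsq_ge0//; case: kerP => mk kK _.
by apply: nsq_bounded; [exact: mcf_conj|move=> x; rewrite sqc_conj].
Qed.

Lemma cauchyTD f g : L2 nu f -> L2 nu g -> cauchyT ker (f + g) = cauchyT ker f + cauchyT ker g.
Proof. by move=> Lf Lg; rewrite /cauchyT ipDl// mulrDl. Qed.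

(** Integrates the identity z e_(-1) ker = ker - 1, valid on X. *)
Lemma cauchyT_mulz f : L2 nu f ->
  z * cauchyT ker (twist (-1) f) = cauchyT ker f - avg nu f.
Proof.
move=> Lf; rewrite /cauchyT /avg mulrA -mulrBl; congr (_ / _).
have Lt := L2_twist (nu := nu) (-1) Lf.
rewrite -ipZl// -ipBr//; apply: (eq_ip_on mX X0) => //; [exact: L2Z|exact: L2B|].
move=> x Xx; case: kerP => _ _ /(_ _ Xx) E.
rewrite [X in _ = _ * X^*](_ : _ = (ker x)^* - 1)// rmorphB/= conjCK rmorph1.
rewrite [X in X * _](_ : _ = z * (e (-1) x * f x))//.
have : ker x - 1 = z * e (-1) x * ker x by rewrite -[X in _ - X = _]E; ring.
by move=> ->; ring.
Qed.

Lemma cauchyT_step f : L2 nu f ->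
  cauchyT ker f = avg nu f * cauchyT ker one + z * cauchyT ker (kT nu f).
Proof.
move=> Lf; have Lc : L2 nu (avg nu f *: one) by exact: L2Z.
rewrite cauchyT_mulz; last exact: L2B.
have Lc' : L2 nu (- (avg nu f *: one)) by exact: L2N.
rewrite avgD// -scaleNr avg_cst// subrr subr0 cauchyTD ?scaleNr//.
have -> : cauchyT ker (- (avg nu f *: one)) = - (avg nu f * cauchyT ker one).
  by rewrite /cauchyT ipNl// ipZl// mulNr -mulrA.
by rewrite addrCA subrr addr0.
Qed.

(** Transports the Kaczmarz expansion to Cauchy transforms: the coefficients c_k become those of a
    polynomial in z, and the residual r_n leaves a remainder with factor z^n. *)
Lemma cauchyT_iter n f : L2 nu f ->
  cauchyT ker f = (\sum_(k < n) avg nu (iter k (kT nu) f) * z ^+ k) * cauchyT ker one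
                  + z ^+ n * cauchyT ker (iter n (kT nu) f).
Proof.
move=> Lf; elim: n => [|n IH]; first by rewrite big_ord0 mul0r add0r expr0 mul1r.
rewrite IH big_ord_recr/= (cauchyT_step (L2_iter_kT n Lf)) exprSr; ring.
Qed.

End kernel.
End cauchy_transform.

(** * Estimates in the unit disc *)

Section disc_algebra.
Variable R : realType.
Local Open Scope complex_scope.
Local Open Scope ring_scope.
Implicit Types (B C d z : R[i]).

(* A perturbation of the fact that C (1 - B) = 1 forces 1 - |B|^2 = |1 - B|^2 (2 Re C - 1). *)
Lemma inner_defect B C d (eta P : R) : C * (1 - B) = 1 + d ->
  P = 2 * complex.Re C - 1 -> 0 <= P -> sqc d <= eta ^+ 2 -> 0 <= eta <= 1 / 2 ->
  1 - sqc B <= 9 * P + 6 * eta.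
Proof.
move=> CB PE P0 de /andP[e0 e1].
set b := Num.sqrt (sqc B); set s := Num.sqrt (sqc (1 - B)).
have b0 : 0 <= b by exact: sqrtr_ge0.
have s0 : 0 <= s by exact: sqrtr_ge0.
have bE : b ^+ 2 = sqc B by rewrite sqr_sqrtr ?sqc_ge0.
have sE : s ^+ 2 = sqc (1 - B) by rewrite sqr_sqrtr ?sqc_ge0.
have sb : s <= 1 + b.
  rewrite -(@ler_pXn2r _ 2) ?nnegrE ?addr_ge0// sE sqrrD bE.
  have : - complex.Re B <= b.
    rewrite (le_trans (ler_norm _))// normrN -sqrtr_sqr ler_wsqrtr//.
    exact: Re_le_sqc.
  by case: (B) => x y; rewrite /sqc/=; nra.
have E : s ^+ 2 * P = 1 - sqc B + 2 * complex.Re (d * (1 - B)^*).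
  have : complex.Re (C * (1 - B) * (1 - B)^*) = complex.Re ((1 + d) * (1 - B)^*) by rewrite CB.
  rewrite PE sE !conjE; case: (B) => x y; case: (C) => u v; case: (d) => p q.
  by rewrite /sqc /=; lra.
have D : - (eta * s) <= complex.Re (d * (1 - B)^*) <= eta * s.
  rewrite -ler_norml -(@ler_pXn2r _ 2) ?nnegrE ?mulr_ge0// real_normK ?num_real//.
  apply: le_trans (Re_le_sqc _) _; rewrite sqcM sqc_conj exprMn sE.
  by rewrite ler_wpM2r ?sqc_ge0.
(* If b > 1 + 2 eta, the right-hand side of [E] is at most (1 + b) (1 - b + 2 eta) < 0, although s^2
   P >= 0. *)
have b1 : b <= 1 + 2 * eta.
  rewrite leNgt; apply/negP => lb.
  have : 0 <= s ^+ 2 * P by rewrite mulr_ge0 ?sqr_ge0.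
  case/andP: D => D1 D2; rewrite E -bE; nra.
(* From s <= 1 + b <= 2 + 2 eta; the constants 9 and 6 of the statement are 3^2 and 2 times 3. *)
have s3 : s <= 3 by lra.
have : s ^+ 2 * P <= 9 * P by rewrite ler_wpM2r//; nra.
have : eta * s <= eta * 3 by rewrite ler_wpM2l.
case/andP: D => D1 D2; rewrite E; lra.
Qed.

Lemma poisson_identity z : sqc z < 1 ->
  2 * complex.Re (1 - z)^-1 - 1 = (1 - sqc z) * sqc (1 - z)^-1.
Proof.
move=> z1; have w0 : sqc (1 - z) != 0.
  rewrite sqc_eq0; apply/eqP => /eqP; rewrite subr_eq0 => /eqP z1'.
  by rewrite -z1' sqc1 ltxx in z1.
have -> : complex.Re (1 - z)^-1 = complex.Re (1 - z) / sqc (1 - z).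
  by case: (1 - z) => x y.
rewrite sqcV; apply: (mulIf w0).
rewrite mulrBl mulrA -!(mulrA _ (_ ^-1)) mulVf// !mulr1.
by case: z {z1 w0} => x y; rewrite /sqc/=; ring.
Qed.

Lemma sqc_1B_ge z (r : R) : 0 <= r < 1 -> sqc z = r ^+ 2 -> (1 - r) ^+ 2 <= sqc (1 - z).
Proof.
move=> /andP[r0 r1] zr; have : complex.Re z <= r.
  rewrite (le_trans (ler_norm _))// -(@ler_pXn2r _ 2) ?nnegrE// real_normK ?num_real// -zr.
  exact: Re_le_sqc.
by move: zr; case: z => x y; rewrite /sqc/=; nra.
Qed.

End disc_algebra.

(** * Fubini for real integrals, with a bound in the second variable *)

Section real_fubini.
Context d1 d2 (T1 : measurableType d1) (T2 : measurableType d2) (R : realType).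
Variables (m1 : {finite_measure set T1 -> \bar R}) (m2 : {finite_measure set T2 -> \bar R}).
Variables (F : T1 * T2 -> R) (u : T2 -> R).
Hypotheses (mF : measurable_fun [set: T1 * T2] F)
  (iu : m2.-integrable [set: T2] (EFin \o u)) (Fu : forall p, `|F p| <= u p.2).

Let mF1 x : measurable_fun [set: T2] (fun y => F (x, y)).
Proof. exact: (measurableT_comp mF (pair1_measurable x)). Qed.

Let mF2 y : measurable_fun [set: T1] (fun x => F (x, y)).
Proof. exact: (measurableT_comp mF (pair2_measurable y)). Qed.

Lemma fubini_rint1 x : m2.-integrable [set: T2] (EFin \o (fun y => F (x, y))).
Proof. by apply: (le_rint _ iu) => // y; exact: (Fu (x, y)). Qed.

Lemma fubini_rint2 y : m1.-integrable [set: T1] (EFin \o (fun x => F (x, y))).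
Proof. by apply: (le_rint _ (rint_cst m1 (u y))) => // x; exact: (Fu (x, y)). Qed.

Let E1 x : (\int[m2]_y (F (x, y))%:E = (\int[m2]_y F (x, y))%:E)%E.
Proof. rewrite fineK//; apply: integrable_fin_num => //; exact: fubini_rint1. Qed.

Let E2 y : (\int[m1]_x (F (x, y))%:E = (\int[m1]_x F (x, y))%:E)%E.
Proof. rewrite fineK//; apply: integrable_fin_num => //; exact: fubini_rint2. Qed.

Let iF : (m1 \x m2)%E.-integrable setT (EFin \o F).
Proof.
apply/integrable21ltyP; first exact/measurable_EFinP.
apply: (@le_lt_trans _ _ (\int[m2]_y (mass m1 * u y)%:E)%E).
  apply: ge0_le_integral => //=.
  - by move=> y _; apply: integral_ge0 => x _; rewrite lee_fin.
  - apply: (measurable_fun_fubini_tonelli_G (fun p => `|F p|%:E)) => //.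
    by apply/measurable_EFinP; exact: measurableT_comp.
  - by apply/measurable_EFinP; apply: measurable_funM => //; exact/measurable_EFinP/(measurable_int m2).
  - move=> y _; rewrite mulrC EFinM -massE -[leRHS]integral_cst//.
    apply: ge0_le_integral => //=.
    + by apply/measurable_EFinP; apply: measurableT_comp => //; exact: mF2.
    + by move=> x _; rewrite lee_fin (Fu (x, y)).
by apply: integrable_lty => //; exact: (rintZ (mass m1) iu).
Qed.

Lemma Rfubini : \int[m1]_x (\int[m2]_y F (x, y)) = \int[m2]_y (\int[m1]_x F (x, y)).
Proof.
have := Fubini iF; rewrite /= => H; congr fine.
rewrite (eq_integral _ _ (fun x _ => esym (E1 x))) H.
exact: eq_integral.
Qed.

Lemma measurable_Rfubini1 : measurable_fun [set: T1] (fun x => \int[m2]_y F (x, y)).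
Proof.
apply/measurable_EFinP; rewrite (_ : EFin \o _ = fubini_F m2 (EFin \o F)).
  exact: (measurable_fubini_F iF).
by apply/funext => x; rewrite /= -E1.
Qed.

Lemma measurable_Rfubini2 : measurable_fun [set: T2] (fun y => \int[m1]_x F (x, y)).
Proof.
apply/measurable_EFinP; rewrite (_ : EFin \o _ = fubini_G m1 (EFin \o F)).
  exact: (measurable_fubini_G iF).
by apply/funext => x; rewrite /= -E2.
Qed.

Lemma Rfubini1_le x : `|\int[m2]_y F (x, y)| <= \int[m2]_y u y.
Proof.
apply: le_trans (le_normr_Rintegral _ _) _ => //; first exact: fubini_rint1.
apply: le_Rintegral => //.
exact: (integrable_norm (fubini_rint1 x)).
Qed.

Lemma Rfubini2_le y : `|\int[m1]_x F (x, y)| <= mass m1 * u y.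
Proof.
apply: le_trans (le_normr_Rintegral _ _) _ => //; first exact: fubini_rint2.
rewrite mulrC -Rintegral_cst//; apply: le_Rintegral => //.
- exact: (integrable_norm (fubini_rint2 y)).
- exact: rint_cst.
Qed.

End real_fubini.

(** * Singular measures are effective for the Kaczmarz algorithm *)

Lemma expr_small (R : realType) (r eps : R) : 0 <= r < 1 -> 0 < eps ->
  exists n, r ^+ n <= eps.
Proof.
move=> /andP[r0 r1] e0; have /cvg_expr/cvg0_near/(_ _ e0)[n /(_ n (leqnn n))] : `|r| < 1.
  by rewrite ger0_norm.
by rewrite ger0_norm ?exprn_ge0// => /ltW H; exists n.
Qed.

(** * Distance on the circle *)

Section circle_distance.
Variable R : realType.
Local Open Scope complex_scope.
Local Open Scope ring_scope.
Local Notation e := (@fourier_exp R).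

Lemma ler_cos_0pi (x y : R) : 0 <= x <= pi -> 0 <= y <= pi -> x <= y -> cos y <= cos x.
Proof.
move=> x0 y0 xy; rewrite leNgt; apply/negP.
by have /= -> := @ltr_cos R y x; rewrite ?in_itv//= ltNge xy.
Qed.

(** For differences of points of [0, 1) the hypothesis is distance at least rho modulo 1. Symmetry
    of the cosine about a half turn folds |s| > 1/2 back to 1 - |s|, where monotonicity on [0, pi]
    applies. *)
Lemma cos_2pi_le (rho s : R) : 0 <= rho -> rho <= `|s| <= 1 - rho ->
  cos (2 * pi * s) <= cos (2 * pi * rho).
Proof.
move=> r0 /andP[rs sr]; have p0 := @pi_gt0 R.
have -> : cos (2 * pi * s) = cos (2 * pi * `|s|).
  by case: (ger0P s) => // _; rewrite mulrN cosN.
have [h|h] := leP `|s| (1/2).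
  by apply: ler_cos_0pi; [apply/andP; split; nra|apply/andP; split; nra|rewrite ler_pM2l ?mulr_gt0].
have -> : cos (2 * pi * `|s|) = cos (2 * pi * (1 - `|s|)).
  by rewrite mulrBr mulr1 -[RHS]cosN opprB -[RHS]cosD2pi mulr_natl subrK.
apply: ler_cos_0pi; [apply/andP; split; nra|apply/andP; split; nra|].
by rewrite ler_pM2l ?mulr_gt0//; lra.
Qed.

Lemma cos_2pi_lt1 (rho : R) : 0 < rho <= 1 / 2 -> cos (2 * pi * rho) < 1.
Proof.
move=> /andP[r0 r1]; have p0 := @pi_gt0 R.
have h1 : (0 : R) \in `[0, pi] by rewrite in_itv/= lexx ltW.
have h2 : 2 * pi * rho \in `[0, pi] by rewrite in_itv/=; apply/andP; split; nra.
rewrite -[X in _ < X]cos0; have /= -> := ltr_cos h1 h2.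
by rewrite !mulr_gt0.
Qed.

Lemma sqc_1B_exp (r s : R) :
  sqc (1 - r%:C * e 1 s) = (1 - r) ^+ 2 + 2 * r * (1 - cos (2 * pi * s)).
Proof.
have := cos2Dsin2 (2 * pi * s); rewrite /fourier_exp mulr1 /sqc /= !mul0r subr0 addr0 add0r => E.
set c := cos _ in E *; set d := sin _ in E *.
rewrite [LHS](_ : _ = 1 - 2 * r * c + r ^+ 2 * (c ^+ 2 + d ^+ 2)); last by ring.
by rewrite E; ring.
Qed.

(** The bound does not degenerate as r tends to 1; the case r = 1 serves off the support of nu. *)
Lemma sqc_1B_exp_ge (r rho s : R) : 0 <= r -> 0 <= rho -> rho <= `|s| <= 1 - rho ->
  2 * r * (1 - cos (2 * pi * rho)) <= sqc (1 - r%:C * e 1 s).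
Proof.
move=> r0 rho0 rs; rewrite sqc_1B_exp; have := cos_2pi_le rho0 rs.
have := sqr_ge0 (1 - r); nra.
Qed.

End circle_distance.

(** * Poisson integral and truncated function b at a fixed radius *)

Section singular_measure.
Variable R : realType.
Local Open Scope complex_scope.
Local Open Scope ring_scope.
Local Notation TR := (measurableTypeR R).
Local Notation e := (@fourier_exp R).
Local Notation lam := (lam R).
Variable nu : {finite_measure set TR -> \bar R}.
Local Notation N := (nsq nu).
Local Notation m := (mass nu).
Local Notation one := ((fun=> 1) : TR -> R[i]).
Hypothesis m_gt0 : 0 < m.

Definition disc_ker (r : R) (t x : R) : R[i] := (1 - r%:C * e 1 t * e (-1) x)^-1.

Lemma mcf_comp d1 d2 (T1 : measurableType d1) (T2 : measurableType d2)
  (f : T2 -> R[i]) (g : T1 -> T2) : measurable_cfun f -> measurable_fun setT g ->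
  measurable_cfun (f \o g).
Proof. by move=> [f1 f2] mg; split; [exact: (measurableT_comp f1 mg)|exact: (measurableT_comp f2 mg)]. Qed.

Lemma mcf_disc_ker r : measurable_cfun (fun p : TR * TR => disc_ker r p.1 p.2).
Proof.
apply: mcf_inv; apply: mcfD; first exact: mcf_cst.
rewrite (_ : (fun p => _) = -1 *: (fun p : TR * TR => r%:C * e 1 p.1 * e (-1) p.2)).
  apply: mcfZ; apply: mcfM; first apply: mcfM; first exact: mcf_cst.
  - by apply: (@mcf_comp _ _ _ _ (e 1) fst) => //; exact: mcf_fourier_exp.
  - by apply: (@mcf_comp _ _ _ _ (e (-1)) snd) => //; exact: mcf_fourier_exp.
by apply/funext => p; exact/esym/mulN1r.
Qed.

Section fixed_r.
Variable r : R.
Hypothesis r01 : 0 < r < 1.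

Let r0 : 0 < r. Proof. by case/andP: r01. Qed.
Let r1 : r < 1. Proof. by case/andP: r01. Qed.
Let r1_gt0 : 0 < 1 - r. Proof. by rewrite subr_gt0. Qed.
Let r2_gt0 : 0 < 1 - r ^+ 2. Proof. by rewrite subr_gt0 expr_lt1// ltW. Qed.

Let sqcz t x : sqc (r%:C * e 1 t * e (-1) x) = r ^+ 2.
Proof. by rewrite !sqcM !sqc_fourier_exp !mulr1 sqc_real. Qed.

Let den_ge t x : (1 - r) ^+ 2 <= sqc (1 - r%:C * e 1 t * e (-1) x).
Proof. by apply: sqc_1B_ge; rewrite ?sqcz// ltW. Qed.

Let den_neq0 t x : 1 - r%:C * e 1 t * e (-1) x != 0.
Proof.
by rewrite -sqc_eq0 gt_eqF// (lt_le_trans _ (den_ge t x))// exprn_gt0.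
Qed.

Lemma disc_ker_le t x : sqc (disc_ker r t x) <= (1 - r) ^- 2.
Proof.
rewrite sqcV lef_pV2 ?posrE ?exprn_gt0// (lt_le_trans _ (den_ge t x))//.
by rewrite exprn_gt0.
Qed.

Lemma disc_kernel t : cauchy_kernel setT ((1 - r) ^- 2) (r%:C * e 1 t) (disc_ker r t).
Proof.
split.
- exact: (mcf_comp (mcf_disc_ker r) (pair1_measurable t)).
- exact: disc_ker_le.
- by move=> x _; rewrite mulVf.
Qed.

Let bb k := avg nu (iter k (kT nu) (e (-1))).

Let Lm1 : L2 nu (e (-1)). Proof. exact: L2_fourier_exp. Qed.

Let X0 : nu (~` setT) = 0%E. Proof. by rewrite setCT measure0. Qed.

(** The Poisson integral of nu / m at the point r e_1(t), written as a squared norm so that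
    positivity is visible; [poissonE] gives the form 2 Re C - 1. *)
Definition poisson t : R := (1 - r ^+ 2) / m * N (disc_ker r t).

Lemma poissonE t : poisson t = 2 * complex.Re (cauchyT nu (disc_ker r t) one) - 1.
Proof.
have [mk kK _] := disc_kernel t.
have Lk : L2 nu (disc_ker r t) by exact: (@L2_bounded _ _ _ _ ((1 - r) ^- 2)).
have /(@cintegrable_inner _ _ _ _ _ _ (L2_cst nu 1)) [i1 i2] := L2_ker nu mk kK.
rewrite /cauchyT /L2inner /cintegral ReM.
set I := (X in X +i* _); set J := (X in _ +i* X).
have -> : complex.Re (m%:C^-1) = m^-1 :> R by rewrite -fmorphV.
have -> : complex.Im (m%:C^-1) = 0 :> R by rewrite -fmorphV.
rewrite /= mulr0 subr0.
have IE : I = \int[nu]_x complex.Re (disc_ker r t x).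
  by apply: eq_Rintegral => x _; rewrite mul1r conjCK.
have i1' : nu.-integrable setT (EFin \o (fun x => complex.Re (disc_ker r t x))).
  apply: eq_integrable i1 => // x _.
  by rewrite -[LHS]/((complex.Re (1 * (disc_ker r t x)^*^*))%:E) mul1r conjCK.
have E : (1 - r ^+ 2) * N (disc_ker r t) = 2 * I - m.
  rewrite IE -[m in RHS]mul1r -Rintegral_cst// -RintegralZl//; last exact: (L2_rint Lk).
  rewrite -[2 * _]RintegralZl// -RintegralB//; [|exact: (rintZ 2 i1')|exact: rint_cst].
  apply: eq_Rintegral => x _; rewrite /disc_ker poisson_identity ?sqcz//.
  by rewrite expr_lt1// ltW.
by rewrite /poisson mulrAC E mulrBl divff ?gt_eqF// mulrA.
Qed.

Lemma poisson_ge0 t : 0 <= poisson t.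
Proof. by rewrite mulr_ge0 ?nsq_ge0// divr_ge0// ltW. Qed.

Definition schur_poly n (z : R[i]) : R[i] := z * \sum_(k < n) bb k * z ^+ k.

(** Truncation spoils C (1 - b) = 1 only by z^(n+1) times the Cauchy transform of the n-th residual.
    Cauchy-Schwarz and contractivity bound this by r^(n+1) / (1 - r), and [inner_defect] applies. *)
Lemma schur_defect n t : r ^+ n.+1 / (1 - r) <= 1 / 2 ->
  1 - sqc (schur_poly n (r%:C * e 1 t)) <= 9 * poisson t + 6 * (r ^+ n.+1 / (1 - r)).
Proof.
move=> h; set z := r%:C * e 1 t; have kP := disc_kernel t.
have zr : sqc z = r ^+ 2 by rewrite sqcM sqc_fourier_exp mulr1 sqc_real.
pose C0 := cauchyT nu (disc_ker r t) one.
pose D := z ^+ n.+1 * cauchyT nu (disc_ker r t) (iter n (kT nu) (e (-1))).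
apply: (@inner_defect _ _ C0 D _ (poisson t)).
- have := cauchyT_mulz measurableT X0 kP (L2_cst nu 1).
  have -> : twist (-1) one = e (-1) by apply/funext => x; exact: mulr1.
  rewrite -[X in _ - avg nu X]scale1r avg_cst//.
  rewrite (cauchyT_iter measurableT X0 m_gt0 kP n Lm1) -/C0 -/z.
  rewrite /D /schur_poly exprS -/C0 => E.
  set S := \sum_(k < n) _ in E *; set W := cauchyT _ _ _ in E *.
  have E' : C0 = 1 + z * (S * C0 + z ^+ n * W) by rewrite E addrC subrK.
  by rewrite mulrBr mulr1 [X in X - _ = _]E'; ring.
- exact: poissonE.
- exact: poisson_ge0.
- rewrite /D sqcM sqcX zr.
  apply: le_trans (ler_wpM2l _ (cauchyT_le m_gt0 kP (L2_iter_kT n Lm1))) _.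
    by rewrite exprn_ge0 ?exprn_ge0// ltW.
  have := nsq_iter_kT_le m_gt0 n Lm1.
  have -> : N (e (-1)) = m.
    rewrite /nsq; under eq_Rintegral do rewrite sqc_fourier_exp.
    by rewrite Rintegral_cst// mul1r.
  have -> : (r ^+ n.+1 / (1 - r)) ^+ 2 = r ^+ 2 ^+ n.+1 * (1 - r) ^- 2.
    by rewrite exprMn exprVn -!exprM mulnC.
  move=> H; apply: ler_wpM2l; first by rewrite exprn_ge0 ?sqr_ge0.
  rewrite -mulrA ler_piMr ?invr_ge0 ?sqr_ge0//.
  by rewrite mulrC ler_pdivrMr// mul1r.
- by rewrite h andbT divr_ge0 ?exprn_ge0 ?ltW.
Qed.

(** Parseval on the circle of radius r; the powers of r only decrease the coefficients. *)
Lemma nsq_schur n :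
  nsq lam (fun t => schur_poly n (r%:C * e 1 t)) <= \sum_(k < n) sqc (bb k) /\
  L2 lam (fun t => schur_poly n (r%:C * e 1 t)).
Proof.
pose a (j : int) := (r%:C) ^+ absz j * bb (absz j).-1.
pose s := [seq k.+1%:Z | k <- iota 0 n].
have E : (fun t => schur_poly n (r%:C * e 1 t)) = \sum_(j <- s) a j *: e j.
  apply/funext => t; rewrite /schur_poly mulr_sumr big_map -(big_mkord xpredT (fun k => r%:C * e 1 t * (bb k * (r%:C * e 1 t) ^+ k))) /index_iota subn0.
  rewrite fct_sumE; apply: eq_bigr => k _.
  rewrite [RHS](_ : _ = a k.+1%:Z * e k.+1%:Z t)// /a fourier_exp_nat /=.
  by rewrite mulrCA -exprS exprMn; ring.
have us : uniq s by rewrite map_inj_uniq ?iota_uniq// => i j [].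
rewrite E; split; last exact: L2_exp_sum.
rewrite nsq_exp_sum// big_map -[leRHS](big_mkord xpredT (fun k => sqc (bb k))) /index_iota subn0.
apply: ler_sum => k _; rewrite /a /= sqcM ler_piMl ?sqc_ge0// sqcX sqc_real.
by rewrite exprn_ile1 ?exprn_ge0 ?ltW// expr_lt1 ?ltW.
Qed.

(** The exact value is 1 / (1 - r^2). Cutting the geometric series costs a factor 2 and an additive
    1/2, which the constant 3 absorbs. *)
Lemma int_disc_ker x : \int[lam]_t sqc (disc_ker r t x) <= 3 / (1 - r ^+ 2).
Proof.
have Lk : L2 lam (fun t => disc_ker r t x).
  apply: (@L2_bounded _ _ _ _ ((1 - r) ^- 2)).
    exact: (mcf_comp (mcf_disc_ker r) (pair2_measurable x)).
  by move=> t; exact: disc_ker_le.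
(* With this n the tail u^n / (1 - u) has modulus at most r^n / (1 - r) <= 1/2. *)
have [n Hn] : exists n, r ^+ n <= (1 - r) / 2.
  by apply: expr_small; rewrite ?divr_gt0// ltW.
pose a (j : int) := (r%:C * e (-1) x) ^+ absz j.
pose s := [seq k%:Z | k <- iota 0 n].
have us : uniq s by rewrite map_inj_uniq ?iota_uniq// => i j [].
have LS := L2_exp_sum lam a s.
pose u t := r%:C * e 1 t * e (-1) x.
have uE t : sqc (u t ^+ n * disc_ker r t x) <= 1 / 4.
  rewrite sqcM sqcX sqcz; apply: le_trans (ler_wpM2l _ (disc_ker_le t x)) _.
    by rewrite exprn_ge0// sqr_ge0.
  rewrite ler_pdivrMr ?exprn_gt0// -exprM mulnC exprM.
  have : 0 <= r ^+ n by rewrite exprn_ge0// ltW.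
  by move=> H; nra.
have pw t : sqc (disc_ker r t x) <= 2 * sqc ((\sum_(j <- s) a j *: e j) t) + 1 / 2.
  have -> : disc_ker r t x = (\sum_(j <- s) a j *: e j) t + u t ^+ n * disc_ker r t x.
    have d0 : 1 - u t != 0 by exact: (den_neq0 t x).
    rewrite /disc_ker -/(u t); apply: (mulIf d0).
    rewrite [RHS]mulrDl -[X in _ = _ + X]mulrA !mulVf// mulr1.
    rewrite (_ : (\sum_(j <- s) a j *: e j) t = \sum_(k < n) u t ^+ k).
      by rewrite mulrC -opprB mulNr -subrX1 opprB subrK.
    rewrite fct_sumE big_map -[RHS](big_mkord xpredT (fun k => u t ^+ k)) /index_iota subn0.
    apply: eq_bigr => k _; rewrite [LHS](_ : _ = a k * e k t)// /a /= fourier_exp_nat.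
    by rewrite -exprMn /u; congr (_ ^+ _); ring.
  by apply: le_trans (sqcD_le _ _) _; have := uE t; lra.
have i1 : lam.-integrable setT (EFin \o (fun t => 2 * sqc ((\sum_(j <- s) a j *: e j) t))).
  exact: (rintZ 2 (L2_rint LS)).
apply: (@le_trans _ _ (\int[lam]_t (2 * sqc ((\sum_(j <- s) a j *: e j) t) + 1 / 2))).
  apply: le_Rintegral => //; first exact: (L2_rint Lk).
  by apply: rintD => //; exact: rint_cst.
rewrite RintegralD//; last exact: rint_cst.
rewrite RintegralZl//; last exact: (L2_rint LS).
rewrite -/(nsq _ _) nsq_exp_sum// Rintegral_cst// [fine _]mass_lam mulr1.
have S1 : \sum_(j <- s) sqc (a j) <= (1 - r ^+ 2)^-1.
  rewrite big_map (eq_bigr (fun k => (r ^+ 2) ^+ k)); last first.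
    by move=> k _; rewrite /a sqcX sqcM sqc_fourier_exp mulr1 sqc_real.
  rewrite -[leRHS]mul1r ler_pdivlMr// -[X in iota _ X]subn0 -/(index_iota _ _) big_mkord.
  rewrite mulrC -opprB mulNr -subrX1 opprB gerBl.
  by rewrite exprn_ge0// sqr_ge0.
have S2 : 1 / 2 <= (1 - r ^+ 2)^-1.
  by rewrite (@le_trans _ _ 1)//; [lra|rewrite invf_ge1// gerBl sqr_ge0].
rewrite -[3 / _]/(3 * _); lra.
Qed.

End fixed_r.
End singular_measure.

(** * Vanishing of the residuals for a singular measure *)

Section singular_kaczmarz.
Variable R : realType.
Local Open Scope complex_scope.
Local Open Scope ring_scope.
Local Notation TR := (measurableTypeR R).
Local Notation leb := (@lebesgue_measure R).
Local Notation e := (@fourier_exp R).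
Local Notation lam := (lam R).
Variable nu : {finite_measure set TR -> \bar R}.
Local Notation N := (nsq nu).
Local Notation m := (mass nu).
Hypothesis m_gt0 : 0 < m.

Let bb k := avg nu (iter k (kT nu) (e (-1))).

Lemma Rintegral_indic (mu : {finite_measure set TR -> \bar R}) (A : set TR) :
  measurable A -> \int[mu]_x (\1_A x : R) = fine (mu A).
Proof. by move=> mA; rewrite /Rintegral integral_indic// setIT. Qed.

Lemma rint_indic (mu : {finite_measure set TR -> \bar R}) (A : set TR) :
  measurable A -> mu.-integrable setT (EFin \o (\1_A : TR -> R)).
Proof.
move=> mA; apply: (le_rint _ (rint_cst mu 1)); first exact: measurable_indic.
by move=> x; rewrite indicE; case: (_ \in _); rewrite ?normr0 ?normr1.
Qed.

(** Integrate [schur_defect] over t. On U the defect is simply at most 1. Off U the Poisson kernel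
    is at most (1 - r^2) / (2 r q) for x outside V, while the part of the integral from x in V is
    averaged in t first, which leaves a multiple of nu(V) independent of r. *)
Lemma schur_sum_ge (r q : R) (U V : set TR) n : 0 < r < 1 -> 0 < q ->
  measurable U -> measurable V ->
  (forall t x, ~ U t -> ~ V x -> 2 * r * q <= sqc (1 - r%:C * e 1 t * e (-1) x)) ->
  r ^+ n.+1 / (1 - r) <= 1 / 2 ->
  1 - \sum_(k < n) sqc (bb k) <= fine (lam U) + 9 * ((1 - r ^+ 2) / (2 * r * q))
     + 27 * (fine (nu V) / m) + 6 * (r ^+ n.+1 / (1 - r)).
Proof.
move=> r01 q0 mU mV HUV hn; have /andP[r0 r1] := r01.
have r2_gt0 : 0 < 1 - r ^+ 2 by rewrite subr_gt0 expr_lt1// ltW.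
pose F (p : TR * TR) := \1_V p.2 * sqc (disc_ker r p.1 p.2).
have mF : measurable_fun setT F.
  apply: measurable_funM; last exact: mcf_sqc (mcf_disc_ker r).
  by apply: (@measurableT_comp _ _ _ _ _ _ (\1_V : TR -> R) _ snd) => //; exact: measurable_indic.
have FK p : `|F p| <= (1 - r) ^- 2.
  rewrite ger0_norm /F ?mulr_ge0 ?sqc_ge0// indicE; case: (_ \in _) => /=; last first.
    by rewrite mul0r invr_ge0 sqr_ge0.
  by rewrite mul1r; exact: disc_ker_le.
have iK : nu.-integrable [set: TR] (EFin \o (fun=> (1 - r) ^- 2)) by exact: rint_cst.
pose H t := \int[nu]_x F (t, x).
have mH := measurable_Rfubini1 lam mF iK FK.
have HK := Rfubini1_le mF iK FK.
have iH : lam.-integrable setT (EFin \o H) by apply: (le_rint mH (rint_cst lam _)) => t; exact: HK.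
have [BS LB] := nsq_schur nu r01 n.
have pw t : 1 - sqc (schur_poly nu n (r%:C * e 1 t)) <= \1_U t +
    (9 * ((1 - r ^+ 2) / (2 * r * q)) + 6 * (r ^+ n.+1 / (1 - r))) + 9 * ((1 - r ^+ 2) / m) * H t.
  have H0 : 0 <= H t by apply: Rintegral_ge0 => x _; rewrite /F mulr_ge0 ?sqc_ge0.
  have c1 : 0 <= 9 * ((1 - r ^+ 2) / (2 * r * q)) by rewrite mulr_ge0// divr_ge0 ?mulr_ge0// ltW.
  have c2 : 0 <= r ^+ n.+1 / (1 - r) by rewrite divr_ge0 ?exprn_ge0 ?subr_ge0 ?ltW.
  have c3 : 0 <= 9 * ((1 - r ^+ 2) / m) * H t 
    by rewrite mulr_ge0// mulr_ge0// divr_ge0// ltW.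
  rewrite indicE; case: (boolP (t \in U)) => [_|].
    by have := sqc_ge0 (schur_poly nu n (r%:C * e 1 t)); rewrite /=; lra.
  rewrite notin_setE => Ut; apply: le_trans (schur_defect m_gt0 r01 t hn) _.
  have NK : N (disc_ker r t) <= H t + m / (2 * r * q).
    have Lk : L2 nu (disc_ker r t).
      have [mk kK _] := disc_kernel r01 t.
      exact: (@L2_bounded _ _ _ _ ((1 - r) ^- 2)).
    have i1 := fubini_rint1 mF iK FK t.
    rewrite mulrC -Rintegral_cst// -RintegralD//; last exact: rint_cst.
    apply: le_Rintegral => //; first exact: (L2_rint Lk).
      by apply: rintD => //; exact: rint_cst.
    move=> x _; rewrite /F /= indicE; case: (boolP (x \in V)) => [_|].
      by rewrite mul1r lerDl invr_ge0 mulr_ge0 ?mulr_ge0 ?ltW.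
    rewrite notin_setE => Vx; rewrite mul0r add0r sqcV.
    by rewrite lef_pV2 ?posrE; [exact: HUV|apply: lt_le_trans (HUV _ _ Ut Vx)|]; rewrite !mulr_gt0.
  have -> : 9 * ((1 - r ^+ 2) / (2 * r * q)) = 9 * ((1 - r ^+ 2) / m * (m / (2 * r * q))).
    by congr (_ * _); rewrite [RHS]mulrA [in RHS]divfK ?gt_eqF.
  have a0 : 0 <= (1 - r ^+ 2) / m by rewrite divr_ge0// ltW.
  by have := ler_wpM2l a0 NK; rewrite /poisson mulrDr /=; lra.
have iB : lam.-integrable setT (EFin \o (fun t => 1 - sqc (schur_poly nu n (r%:C * e 1 t)))).
  exact: (integrableB measurableT (rint_cst lam 1) (L2_rint LB)).
have i1 := rint_indic lam mU.
have iC := rint_cst lam (9 * ((1 - r ^+ 2) / (2 * r * q)) + 6 * (r ^+ n.+1 / (1 - r))).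
have iH9 := rintZ (9 * ((1 - r ^+ 2) / m)) iH.
have i2 := rintD i1 iC.
have := @le_Rintegral _ _ _ lam setT _ _ measurableT iB (rintD i2 iH9) (fun t _ => pw t).
rewrite RintegralB//; [|exact: rint_cst|exact: (L2_rint LB)].
rewrite RintegralD// RintegralD// RintegralZl// Rintegral_indic// !Rintegral_cst// [fine (lam setT)]mass_lam !mulr1 -/(nsq _ _).
(* Exchanging the integrals, the mean of the squared kernel in t is bounded uniformly in x; its 1 /
   (1 - r^2) cancels the factor in front of H. *)
have IH : \int[lam]_t H t <= 3 / (1 - r ^+ 2) * fine (nu V).
  rewrite (Rfubini lam mF iK FK) -Rintegral_indic// -RintegralZl//; last exact: rint_indic.
  apply: le_Rintegral => //.
  - apply: (le_rint (measurable_Rfubini2 lam mF iK FK) (rintZ (mass lam) iK)) => x.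
    exact: (Rfubini2_le lam mF FK x).
  - by apply: rintZ; exact: rint_indic.
  - move=> x _; rewrite /F /=; case: (boolP (x \in V)) => xV.
      rewrite indicE xV /= mulr1; under eq_Rintegral do rewrite mul1r.
      exact: int_disc_ker.
    by rewrite indicE (negPf xV) mulr0; under eq_Rintegral do rewrite mul0r; rewrite Rintegral_cst// mul0r.
have : 9 * ((1 - r ^+ 2) / m) * \int[lam]_t H t <= 27 * (fine (nu V) / m).
  have -> : 27 * (fine (nu V) / m) = 9 * ((1 - r ^+ 2) / m) * (3 / (1 - r ^+ 2) * fine (nu V)).
    by field; rewrite !gt_eqF.
  by rewrite ler_wpM2l// mulr_ge0// divr_ge0// ltW.
move: BS; rewrite -/bb; lra.
Qed.

Variable Z : set TR.
Hypotheses (mZ : measurable Z) (Z0 : leb Z = 0%E) (nuZ : nu (~` Z) = 0%E).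
Hypothesis nu01 : nu (~` `]0, 1[%classic) = 0%E.

Let bad (U : set R) (rho : R) : set TR :=
  \bigcup_(y in ~` U) ball y rho `|` ~` `]rho, 1 - rho[%classic.

Let mbad U rho : measurable (bad U rho).
Proof.
apply: measurableU; last by apply: measurableC; exact: measurable_itv.
apply: open_measurable; apply: bigcup_open => y _; exact: ball_open.
Qed.

(** As rho decreases to 0 the sets [bad U rho] decrease to a set that misses U inside ]0, 1[ because
    U is open, and nu is carried by Z inside ]0, 1[. Continuity from above concludes. *)
Lemma bad_small (U : set R) (eps : R) : open U -> Z `<=` U -> 0 < eps ->
  exists2 rho, 0 < rho <= 1 / 2 & fine (nu (bad U rho)) < eps.
Proof.
move=> oU ZU eps0; pose rho (n : nat) : R := n.+2%:R^-1.
have rho0 n : 0 < rho n by rewrite invr_gt0.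
have rho1 n : rho n <= 1 / 2 by rewrite mul1r lef_pV2 ?posrE// ler_nat.
pose F n := bad U (rho n).
have mcap : measurable (\bigcap_n F n) by apply: bigcapT_measurable => n; exact: mbad.
have H : nu (F n) @[n --> \oo] --> nu (\bigcap_n F n).
  apply: nonincreasing_cvg_mu => //.
  - by rewrite ltey_eq fin_num_measure//; exact: mbad.
  - by move=> n; exact: mbad.
  - move=> i j ij; have rij : rho j <= rho i by rewrite lef_pV2 ?posrE// ler_nat !ltnS.
    apply/subsetPset => x; case=> [[y Uy yx]|xN].
      by left; exists y => //; exact: le_ball yx.
    right; apply: contra_not xN; rewrite /= !in_itv/= => /andP[x1 x2].
    by rewrite (le_lt_trans rij)//= (lt_le_trans x2)// lerD2l lerN2.
have H0 : nu (\bigcap_n F n) = 0%E.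
  apply/eqP; rewrite eq_le measure_ge0 andbT.
  have mU : measurable (U : set TR) by exact: open_measurable.
  have m01 : measurable (`]0, 1[%classic : set TR) by exact: measurable_itv.
  apply: (@le_trans _ _ (nu (~` Z `|` ~` `]0, 1[%classic))); last first.
    apply: le_trans (measureU2 _ _ _) _; [exact: measurableC|exact: measurableC|].
    by rewrite [X in (X + _)%E]nuZ [X in (_ + X)%E]nu01 adde0.
  apply: le_measure; rewrite ?inE//; first by apply: measurableU; exact: measurableC.
  move=> x Fx; apply: contrapT => /not_orP[/contrapT /ZU Ux /contrapT].
  rewrite /= in_itv/= => /andP[x0 x1].
  have /nbhs_ballP[d /= d0 dU] := oU x Ux.
  have d1 : 0 < Num.min d (Num.min x (1 - x)) by rewrite !lt_min d0 x0 subr_gt0.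
  have [k] := ltr_add_invr d1; rewrite add0r !lt_min => /and3P[kd kx k1].
  have rk : rho k <= k.+1%:R^-1 by rewrite lef_pV2 ?posrE// ler_nat.
  case: (Fx k I) => [[y Uy yx]|].
    apply: Uy; apply: dU; apply: (le_ball _ (ball_sym yx)).
    exact: le_trans rk (ltW kd).
  rewrite /= in_itv/= => xN; apply: xN; rewrite (le_lt_trans rk kx)/=.
  by rewrite ltrBrDr addrC -ltrBrDr (le_lt_trans rk k1).
move: H; rewrite H0 => /fine_cvgP[_ /cvg0_near /(_ _ eps0)[n /(_ n (leqnn n))]].
rewrite ger0_norm ?fine_ge0// => Hn; exists (rho n) => //.
by rewrite rho0 rho1.
Qed.

Lemma kaczmarz_dies_m1 : dies nu (e (-1)).
Proof.
apply: near_cvg0 => eps eps0.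
have Lm1 := L2_fourier_exp nu (-1).
have Nm1 : N (e (-1)) = m.
  rewrite /nsq; under eq_Rintegral do rewrite sqc_fourier_exp.
  by rewrite Rintegral_cst// mul1r.
(* Three terms of [schur_sum_ge] will be at most d and the last at most d / 2; times m, the total
   stays below 5 m d = eps. *)
set d := eps / (5 * m); have d0 : 0 < d by rewrite divr_gt0// mulr_gt0.
suff [n Hn] : exists n, 1 - \sum_(k < n) sqc (bb k) < 4 * d + d / 2.
  exists n => k nk; rewrite ger0_norm ?nsq_ge0//.
  apply: le_lt_trans (nsq_iter_kT_mono m_gt0 Lm1 nk) _.
  rewrite nsq_iter_kT// Nm1 -[X in X - _]mulr1 -mulrBr mulrC -ltr_pdivlMr//.
  apply: lt_trans Hn _; rewrite /d invfM.
  have : 0 < eps / m by rewrite divr_gt0.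
  by lra.
(* The parameters are chosen in the order U, rho, r, n, each depending on the previous ones. They
   control, respectively, the Lebesgue measure of U, the nu-measure of V, the kernel off both sets,
   and the truncation error. *)
have Zoo : (leb Z < +oo)%E by rewrite Z0.
have [U [oU ZU lU]] := lebesgue_regularity_outer mZ Zoo d0.
have mU : measurable (U : set TR) by exact: open_measurable.
have {}lU : (leb U < d%:E)%E.
  apply: le_lt_trans lU; rewrite -(setDUK ZU) setDUl setDv set0U setDDl setUid.
  have mUZ : measurable (U `\` Z : set TR) by exact: measurableD.
  by apply: le_trans (measureU2 _ mZ mUZ) _; rewrite [X in (X + _)%E]Z0 add0e.
have [|rho /andP[rho0 rho1] nV] := bad_small (eps := d * m / 27) oU ZU.
  by rewrite divr_gt0// mulr_gt0.
pose q := 1 - cos (2 * pi * rho); have q0 : 0 < q.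
  by rewrite subr_gt0 cos_2pi_lt1// rho0.
(* Since 2 r >= 1 and 1 + r <= 2, the bound 1 - r <= d q / 18 gives 9 (1 - r^2) / (2 r q) <= d. *)
pose r := Num.max (1 / 2) (1 - d * q / 18).
have r01 : 0 < r < 1.
  rewrite /r lt_max gt_max; apply/andP; split; first by apply/orP; left; lra.
  apply/andP; split; first lra.
  by rewrite ltrBlDr ltrDl divr_gt0// mulr_gt0.
have /andP[r0 r1] := r01.
have rd : 1 - r <= d * q / 18 by rewrite lerBlDl -lerBlDr /r le_max lexx orbT.
have r2 : 1 / 2 <= r by rewrite /r le_max lexx.
have s1 : 0 < 1 - r by rewrite subr_gt0.
have h1 : 0 <= r < 1 by rewrite r1 ltW.
have h2 : 0 < Num.min ((1 - r) / 2) ((1 - r) * (d / 12)).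
  by rewrite lt_min divr_gt0//= mulr_gt0// divr_gt0.
have [n Hn] := expr_small h1 h2.
move: Hn; rewrite le_min => /andP[Hn1 Hn2].
have rn : r ^+ n.+1 <= r ^+ n by rewrite exprS ler_piMl ?exprn_ge0// ltW.
exists n.
(* Points outside [0, 1), invisible to [lam], are discarded too, so that t - x can be read as a
   difference on the circle. *)
pose U' : set TR := U `|` ~` `[0, 1[%classic.
have mU' : measurable U' by apply: measurableU => //; apply: measurableC; exact: measurable_itv.
have lamU' : fine (lam U') <= d.
  have : (lam U' <= d%:E)%E.
    rewrite lamE; apply: le_trans (ltW lU); apply: le_measure; rewrite ?inE//.
      by apply: measurableI => //; exact: measurable_itv.
    by move=> x [[]].
  by move=> H; rewrite -lee_fin fineK// fin_num_measure.
have HUV t x : ~ U' t -> ~ bad U rho x -> 2 * r * q <= sqc (1 - r%:C * e 1 t * e (-1) x).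
  move=> /not_orP[Ut /contrapT]; rewrite /= in_itv/= => /andP[t0 t1] /not_orP[xW /contrapT].
  rewrite /= in_itv/= => /andP[x0 x1].
  have -> : r%:C * e 1 t * e (-1) x = r%:C * e 1 (t - x) by rewrite fourier_expB mulrA.
  rewrite /q; apply: sqc_1B_exp_ge; rewrite ?(ltW r0) ?(ltW rho0)//.
  apply/andP; split.
    by rewrite leNgt; apply/negP => tx; apply: xW; exists t.
  move: x t t0 t1 x0 x1 {Ut xW} => /= x t t0 t1 x0 x1.
  by rewrite ler_norml; apply/andP; split; lra.
have hn : r ^+ n.+1 / (1 - r) <= 1 / 2 by rewrite ler_pdivrMr//; lra.
apply: le_lt_trans (schur_sum_ge r01 q0 mU' (mbad U rho) HUV hn) _.
have t1 : 9 * ((1 - r ^+ 2) / (2 * r * q)) <= d.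
  rewrite mulrA ler_pdivrMr ?mulr_gt0//.
  have : (1 - r) * (1 + r) <= d * q / 18 * 2 by apply: ler_pM; lra.
  have : 0 < d * q by rewrite mulr_gt0.
  have : d * q * (1 / 2) <= d * q * r by rewrite ler_wpM2l// mulr_ge0// ltW.
  have -> : d * (2 * r * q) = 2 * (d * q * r) by ring.
  have -> : 1 - r ^+ 2 = (1 - r) * (1 + r) by ring.
  lra.
have t2 : 27 * (fine (nu (bad U rho)) / m) < d.
  by rewrite mulrA ltr_pdivrMr//; lra.
have t3 : 6 * (r ^+ n.+1 / (1 - r)) <= d / 2.
  rewrite mulrA ler_pdivrMr ?subr_gt0//; lra.
lra.
Qed.

End singular_kaczmarz.

(** * The expansion off the support of the singular part *)

Section arc.
Variable R : realType.
Local Open Scope complex_scope.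
Local Open Scope ring_scope.
Local Notation TR := (measurableTypeR R).
Local Notation e := (@fourier_exp R).
Variables (X Y : set TR) (rho : R).
Hypotheses (mX : measurable X) (mY : measurable Y) (rho01 : 0 < rho <= 1 / 2).
Hypothesis XY : forall x t, X x -> Y t -> rho <= `|t - x| <= 1 - rho.

Definition arc_bound : R := (2 * (1 - cos (2 * pi * rho)))^-1.

Lemma arc_bound_gt0 : 0 < arc_bound.
Proof. by rewrite invr_gt0 mulr_gt0// subr_gt0 cos_2pi_lt1. Qed.

Definition arc_ker (t x : TR) : R[i] :=
  (\1_Y t : R)%:C * (\1_X x : R)%:C * (1 - e 1 t * e (-1) x)^-1.

Lemma arc_den_ge x t : X x -> Y t -> arc_bound^-1 <= sqc (1 - e 1 t * e (-1) x).
Proof.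
move=> Xx Yt; rewrite invrK -fourier_expB -[e 1 _]mul1r.
have /andP[r0 _] := rho01.
by have := sqc_1B_exp_ge ler01 (ltW r0) (XY Xx Yt); rewrite mulr1.
Qed.

Lemma arc_den_neq0 x t : X x -> Y t -> 1 - e 1 t * e (-1) x != 0.
Proof.
move=> Xx Yt; rewrite -sqc_eq0 gt_eqF// (lt_le_trans _ (arc_den_ge Xx Yt))//.
by rewrite invr_gt0 arc_bound_gt0.
Qed.

Lemma arc_kerE x t : X x -> Y t -> arc_ker t x = (1 - e 1 t * e (-1) x)^-1.
Proof. by move=> Xx Yt; rewrite /arc_ker !indicE !mem_set//= !mul1r. Qed.

Lemma arc_ker_notin x t : ~ (X x /\ Y t) -> arc_ker t x = 0.
Proof.
move=> H; rewrite /arc_ker !indicE; case: (boolP (t \in Y)); case: (boolP (x \in X)); rewrite ?mulr0 ?mul0r//.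
by rewrite !inE => Xx Yt; case: H.
Qed.

Lemma arc_ker_le t x : sqc (arc_ker t x) <= arc_bound.
Proof.
have [[Xx Yt]|/arc_ker_notin ->] := pselect (X x /\ Y t); last by rewrite sqc0 ltW// arc_bound_gt0.
rewrite arc_kerE// sqcV -[leRHS]invrK lef_pV2 ?posrE ?arc_den_ge//.
  by rewrite (lt_le_trans _ (arc_den_ge Xx Yt))// invr_gt0 arc_bound_gt0.
by rewrite invr_gt0 arc_bound_gt0.
Qed.

Lemma mcf_arc_ker : measurable_cfun (fun p : TR * TR => arc_ker p.1 p.2).
Proof.
apply: mcfM; first apply: mcfM.
- by apply: (@mcf_comp _ _ _ _ _ (fun t => (\1_Y t : R)%:C) fst) => //; exact: mcf_indic.
- by apply: (@mcf_comp _ _ _ _ _ (fun t => (\1_X t : R)%:C) snd) => //; exact: mcf_indic.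
apply: mcf_inv; apply: mcfD; first exact: mcf_cst.
rewrite (_ : (fun p => _) = -1 *: (fun p : TR * TR => e 1 p.1 * e (-1) p.2)).
  apply: mcfZ; apply: mcfM.
  - by apply: (@mcf_comp _ _ _ _ _ (e 1) fst) => //; exact: mcf_fourier_exp.
  - by apply: (@mcf_comp _ _ _ _ _ (e (-1)) snd) => //; exact: mcf_fourier_exp.
by apply/funext => p; exact/esym/mulN1r.
Qed.

Lemma arc_cauchy_kernel t : Y t -> cauchy_kernel X arc_bound (e 1 t) (arc_ker t).
Proof.
move=> Yt; split.
- exact: (mcf_comp mcf_arc_ker (pair1_measurable t)).
- exact: arc_ker_le.
- by move=> x Xx; rewrite arc_kerE// mulVf// arc_den_neq0.
Qed.

Section expansion.
Variable nu : {finite_measure set TR -> \bar R}.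
Hypotheses (X0 : nu (~` X) = 0%E) (m_gt0 : 0 < mass nu).
Local Notation ip := (L2inner nu).
Local Notation N := (nsq nu).
Local Notation m := (mass nu).
Local Notation one := ((fun=> 1) : TR -> R[i]).

Let C1 (t : TR) := cauchyT nu (arc_ker t) one.

Let mk t : measurable_cfun (arc_ker t).
Proof. exact: (mcf_comp mcf_arc_ker (pair1_measurable t)). Qed.

(** For |u| = 1 with u different from 1, the real part of 1 / (1 - u) is 1/2. So the Cauchy
    transform of nu / m stays away from 0 on Y and may be divided by. *)
Lemma Re_cauchy_arc t : Y t -> complex.Re (C1 t) = 1 / 2.
Proof.
move=> Yt; have Lk := L2_ker nu (mk t) (arc_ker_le t).
have /(@cintegrable_inner _ _ _ _ _ _ (L2_cst nu 1)) [i1 i2] := Lk.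
rewrite /C1 /cauchyT /L2inner /cintegral ReM.
have -> : complex.Re (m%:C^-1) = m^-1 :> R by rewrite -fmorphV.
have -> : complex.Im (m%:C^-1) = 0 :> R by rewrite -fmorphV.
set I := (X in X +i* _); set J := (X in _ +i* X); rewrite /= mulr0 subr0.
have -> : I = \int[nu]_x (1 / 2).
  apply: (eq_Rintegral_on mX X0).
  - by case: (mcfM (mcf_cst _ 1) (mcf_conj (mcf_conj (mk t)))).
  - exact: measurable_cst.
  - move=> x Xx; rewrite mul1r conjCK arc_kerE//.
    set u := e 1 t * e (-1) x; have su : sqc u = 1 by rewrite sqcM !sqc_fourier_exp mulr1.
    have d0 : sqc (1 - u) != 0 by rewrite sqc_eq0 arc_den_neq0.
    have -> : complex.Re (1 - u)^-1 = complex.Re (1 - u) / sqc (1 - u) by case: (1 - u) => p q.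
    apply: (mulIf d0); rewrite divfK//.
    by move: su; case: (u) => p q; rewrite /sqc/=; lra.
by rewrite Rintegral_cst// -/(mass nu) mulfK// gt_eqF.
Qed.

Lemma sqc_cauchy_arc t : Y t -> 1 / 4 <= sqc (C1 t).
Proof.
by move=> Yt; apply: le_trans (Re_le_sqc _); rewrite Re_cauchy_arc//; lra.
Qed.

Lemma mcf_cauchy_arc : measurable_cfun C1.
Proof.
have mk2 := mcf_arc_ker.
have iK : nu.-integrable [set: TR] (EFin \o (fun=> arc_bound + 1)) by exact: rint_cst.
(* Avoids a square root: a^2 <= K implies |a| <= K + 1. *)
have bnd (a : R) p : a ^+ 2 <= sqc (arc_ker p.1 p.2) -> `|a| <= arc_bound + 1.
  move=> H; have := arc_ker_le p.1 p.2; have := arc_bound_gt0; move=> b0 bk.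
  rewrite -(@ler_pXn2r _ 2) ?nnegrE ?real_normK ?num_real//; last lra.
  by nra.
case: (mk2) => m1 m2.
have M1 := @measurable_Rfubini1 _ _ _ _ _ nu nu _ _ m1 iK (fun p => bnd _ p (Re_le_sqc _)).
have M2 := @measurable_Rfubini1 _ _ _ _ _ nu nu _ _ m2 iK (fun p => bnd _ p (Im_le_sqc _)).
rewrite (_ : C1 = fun t => (m%:C)^-1 * ((\int[nu]_x complex.Re (arc_ker t x)) +i* (\int[nu]_x complex.Im (arc_ker t x)))).
  by apply: mcfM; [exact: mcf_cst|split].
apply/funext => t; rewrite /C1 /cauchyT mulrC; congr (_ * (_ +i* _)).
- by apply: eq_Rintegral => x _; rewrite mul1r conjCK.
- by apply: eq_Rintegral => x _; rewrite mul1r conjCK.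
Qed.

(** The kernel Q of the overview: its inner product with f is the quotient of the Cauchy transforms
    of f and of 1 at e_1(t). *)
Definition arc_dual (t x : TR) : R[i] := (arc_ker t x / (m%:C * C1 t))^*.

Lemma mcf_arc_dual : measurable_cfun (fun p : TR * TR => arc_dual p.1 p.2).
Proof.
apply: mcf_conj; apply: mcfM; first exact: mcf_arc_ker.
apply: mcf_inv; apply: mcfM; first exact: mcf_cst.
by apply: (@mcf_comp _ _ _ _ _ C1 fst) => //; exact: mcf_cauchy_arc.
Qed.

Lemma arc_dual_le t x : sqc (arc_dual t x) <= 4 * arc_bound / m ^+ 2.
Proof.
rewrite sqc_conj sqcM sqcV sqcM sqc_real.
have [[Xx Yt]|/arc_ker_notin ->] := pselect (X x /\ Y t); last first.
  by rewrite sqc0 mul0r divr_ge0 ?sqr_ge0// mulr_ge0// ltW// arc_bound_gt0.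
have c4 := sqc_cauchy_arc Yt; have c0 : 0 < sqc (C1 t) by lra.
have m2 : 0 < m ^+ 2 by rewrite exprn_gt0.
rewrite invfM mulrCA [leLHS]mulrC ler_wpM2r ?invr_ge0 ?(ltW m2)//.
rewrite ler_pdivrMr//; have := arc_ker_le t x; have := arc_bound_gt0; nra.
Qed.

Lemma arc_dualE f t : L2 nu f -> ip f (arc_dual t) = cauchyT nu (arc_ker t) f / C1 t.
Proof.
move=> Lf; have Lk := L2_ker nu (mk t) (arc_ker_le t).
rewrite (_ : arc_dual t = ((m%:C * C1 t)^-1)^* *: (fun x => (arc_ker t x)^*)).
  by rewrite ipZr// conjCK /cauchyT invfM [LHS]mulrC mulrA.
by apply/funext => x; rewrite /arc_dual conjM mulrC.
Qed.

(** Divide [cauchyT_iter] at z = e_1(t) by the transform of 1. Here |z| = 1, so smallness of the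
    remainder comes from the residual alone, uniformly in t; the factor 4 is the bound for 1 /
    |C1|^2. *)
Lemma arc_expansion f t n : L2 nu f -> Y t ->
  sqc (ip f (arc_dual t) - \sum_(k < n) ip f (kaczmarz_dual nu k) * e k%:Z t)
    <= 4 * arc_bound / m * N (iter n (kT nu) f).
Proof.
move=> Lf Yt; rewrite arc_dualE//; have kP := arc_cauchy_kernel Yt.
have c4 := sqc_cauchy_arc Yt; have c0 : C1 t != 0 by rewrite -sqc_eq0 gt_eqF//; lra.
rewrite (cauchyT_iter mX X0 m_gt0 kP n Lf) -/(C1 t).
rewrite mulrDl mulfK// (eq_bigr (fun k : 'I_n => ip f (kaczmarz_dual nu k) * e k t)); last first.
  by move=> k _; rewrite ip_kaczmarz_dual// [in RHS]fourier_exp_nat.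
rewrite addrC addKr sqcM sqcM sqcX sqc_fourier_exp expr1n mul1r sqcV.
have := cauchyT_le m_gt0 kP (L2_iter_kT n Lf).
have c0' : 0 < sqc (C1 t) by lra.
rewrite ler_pdivrMr// => H; apply: le_trans H _.
have : 0 <= arc_bound / m * N (iter n (kT nu) f).
  by rewrite mulr_ge0 ?nsq_ge0// divr_ge0// ltW// arc_bound_gt0.
by move=> H; rewrite -!(mulrA 4) mulrAC; nra.
Qed.

End expansion.
End arc.

(** * The one-sided expansion as an interface *)

Section one_sided.
Variable R : realType.
Local Open Scope complex_scope.
Local Open Scope ring_scope.
Local Notation TR := (measurableTypeR R).
Local Notation leb := (@lebesgue_measure R).
Local Notation e := (@fourier_exp R).
Variable nu : {finite_measure set TR -> \bar R}.
Local Notation ip := (L2inner nu).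
Local Notation N := (nsq nu).

Definition one_sided_sum (h : nat -> TR -> R[i]) f n : TR -> R[i] :=
  \sum_(k < n) ip f (h k) *: e k%:Z.

(** Gathers what the construction uses of the Kaczmarz expansion, so that nu = 0 fits as well. In
    [osd_arc] the rate depends on f but not on t. *)
Record one_sided_dual (Y : set TR) (h : nat -> TR -> R[i])
    (Q : TR -> TR -> R[i]) (B K : R) : Prop := OneSidedDual {
  osd_L2 : forall k, L2 nu (h k) ;
  osd_mcf : measurable_cfun (fun p : TR * TR => Q p.1 p.2) ;
  osd_le : forall t x, sqc (Q t x) <= K ;
  osd_ge0 : 0 <= B ;
  osd_bessel : forall n f, L2 nu f -> \sum_(k < n) sqc (ip f (h k)) <= B * N f ;
  osd_dual : forall f, L2 nu f -> N (f - one_sided_sum h f n) @[n --> \oo] --> 0 ;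
  osd_arc : forall f, L2 nu f -> exists2 eps : nat -> R,
    eps n @[n --> \oo] --> 0 &
    forall n t, Y t -> sqc (ip f (Q t) - one_sided_sum h f n t) <= eps n }.

Lemma one_sided_sumE h f n t :
  one_sided_sum h f n t = \sum_(k < n) ip f (h k) * e k%:Z t.
Proof. by rewrite /one_sided_sum fct_sumE. Qed.

Variables (X Y Z : set TR) (rho : R).
Hypotheses (mX : measurable X) (mY : measurable Y) (rho01 : 0 < rho <= 1 / 2).
Hypothesis XY : forall x t : TR, X x -> Y t -> rho <= `|t - x| <= 1 - rho.
Hypotheses (X0 : nu (~` X) = 0%E) (X01 : X `<=` `]0, 1[).
Hypotheses (mZ : measurable Z) (Z0 : leb Z = 0%E) (nuZ : nu (~` Z) = 0%E).

Lemma nsq_mass0 f : mass nu = 0 -> L2 nu f -> N f = 0.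
Proof.
move=> m0 Lf; rewrite -(nsq0 nu); apply: (eq_nsq_on (X := set0)) => //.
- by rewrite setC0 [LHS]massE m0.
- exact: L20.
Qed.

Lemma exists_one_sided_dual : exists h Q B K, one_sided_dual Y h Q B K.
Proof.
have ci (n : int) : L2 nu (e n) := L2_fourier_exp nu n.
(* For the zero measure there is no normalization by the mass, but every norm vanishes and zero data
   suffice. *)
have [m0|mN0] := eqVneq (mass nu) 0.
  exists (fun=> 0), (fun _ => 0), 0, 0; split.
  - by move=> k; exact: L20.
  - exact: mcf_cst.
  - by move=> t x; rewrite sqc0.
  - by [].
  - by move=> n f Lf; rewrite mul0r big1// => k _; rewrite ip0r// sqc0.
  - move=> f Lf; rewrite (_ : (fun n => _) = fun=> 0); first exact: cvg_cst.
    apply/funext => n; apply: nsq_mass0 => //; apply: L2B => //.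
    by apply: L2_sum => k _; exact: L2Z.
  - move=> f Lf; exists (fun=> 0); first exact: cvg_cst.
    move=> n t _; rewrite one_sided_sumE ip0r// big1 ?subr0 ?sqc0// => k _.
    by rewrite ?ip0r// mul0r.
have m_gt0 : 0 < mass nu by rewrite lt_neqAle eq_sym mN0 mass_ge0.
have nu01 : nu (~` `]0, 1[%classic) = 0%E.
  by apply: subset_measure0 X0 => //; [exact: measurableC|exact: measurableC|exact: subsetC].
have nu_unit : nu (~` `[0, 1[%classic) = 0%E.
  apply: subset_measure0 nu01 => //; [exact: measurableC|exact: measurableC|].
  by apply: subsetC => x /=; rewrite !in_itv/= => /andP[/ltW -> ->].
have die f : L2 nu f -> dies nu f.
  exact: (dies_all m_gt0 nu_unit (kaczmarz_dies_m1 m_gt0 mZ Z0 nuZ nu01)).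
exists (kaczmarz_dual nu), (arc_dual X Y nu), (mass nu)^-1, (4 * arc_bound rho / mass nu ^+ 2).
split.
- exact: L2_kaczmarz_dual.
- exact: (mcf_arc_dual mX mY rho01 XY).
- exact: (arc_dual_le mX mY rho01 XY X0 m_gt0).
- by rewrite invr_ge0 ltW.
- by move=> n f; exact: kaczmarz_bessel.
- move=> f Lf; rewrite (_ : (fun n => _) = fun n => N (iter n (kT nu) f)); first exact: die.
  apply/funext => n; rewrite -(nsq_twist nu n%:Z (iter n (kT nu) f)); congr N.
  have -> : one_sided_sum (kaczmarz_dual nu) f n = \sum_(k < n) avg nu (iter k (kT nu) f) *: e k.
    by apply: eq_bigr => k _; rewrite ip_kaczmarz_dual.
  by rewrite {1}(kT_expansion nu n f) [X in X - _]addrC addrK.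
- move=> f Lf; exists (fun n => 4 * arc_bound rho / mass nu * N (iter n (kT nu) f)).
    rewrite -[X in _ --> X](mulr0 (4 * arc_bound rho / mass nu)).
    by apply: cvgMr; exact: die.
  by move=> n t Yt; rewrite one_sided_sumE; exact: (arc_expansion mX mY rho01 XY X0).
Qed.

End one_sided.

(** * Localization of Fourier series *)

Lemma squeeze_cvg0 (R : realType) (u v : nat -> R) :
  (forall n, 0 <= u n <= v n) -> v n @[n --> \oo] --> 0 -> u n @[n --> \oo] --> 0.
Proof.
move=> uv v0; apply: (@squeeze_cvgr _ _ _ _ (fun=> 0) v) => //; last exact: cvg_cst.
by apply: nearW => n; exact: uv.
Qed.

Lemma sqcB_le (R : realType) (z w : R[i]) : sqc (z - w) <= 2 * sqc z + 2 * sqc w.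
Proof. by rewrite -[leRHS]/(2 * _ + 2 * _) -(sqcN w); exact: sqcD_le. Qed.

Section localization.
Variable R : realType.
Local Open Scope complex_scope.
Local Open Scope ring_scope.
Local Notation TR := (measurableTypeR R).
Local Notation e := (@fourier_exp R).
Local Notation lam := (lam R).
Variables (X Y : set TR) (rho : R).
Hypotheses (mX : measurable X) (mY : measurable Y) (rho01 : 0 < rho <= 1 / 2).
Hypothesis XY : forall x t : TR, X x -> Y t -> rho <= `|t - x| <= 1 - rho.
Variable phi : TR -> R[i].
Hypotheses (Lphi : L2 lam phi) (phiY : forall t, ~ Y t -> phi t = 0).

Let kphi (x : TR) : TR -> R[i] := fun t => arc_ker X Y t x * phi t.

Let L2_kphi x : L2 lam (kphi x).
Proof.
apply: (@L2M _ _ _ lam (arc_bound rho)) => //.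
  exact: (mcf_comp (mcf_arc_ker mX mY) (pair2_measurable x)).
by move=> t; exact: arc_ker_le.
Qed.

Let a x n := L2inner lam (kphi x) (e n).

Let a_le x n : sqc (a x n) <= arc_bound rho * nsq lam phi.
Proof.
apply: le_trans (cauchy_schwarz (L2_kphi x) (L2_fourier_exp lam n)) _.
have -> : nsq lam (e n) = 1.
  by apply: (@complexI R); rewrite -ip_nsq ip_fourier_exp eqxx.
rewrite mulr1; apply: nsqM_le => //.
  exact: (mcf_comp (mcf_arc_ker mX mY) (pair2_measurable x)).
by move=> t; exact: arc_ker_le.
Qed.

(** As a function of t, phi is (1 - e_1(t) e_(-1)(x)) times [kphi x], and multiplication by e_1
    shifts coefficients by one: each term of the Fourier series at x is a difference of consecutive
    terms. *)
Let coefE x n : X x ->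
  L2inner lam phi (e n) * e n x = a x n * e n x - a x (n - 1) * e (n - 1) x.
Proof.
move=> Xx; have Le := L2_fourier_exp lam n.
have -> : phi = kphi x - e (-1) x *: twist 1 (kphi x).
  apply/funext => t; rewrite [RHS](_ : _ = (1 - e 1 t * e (-1) x) * kphi x t); last first.
    by rewrite mulrBl mul1r mulrAC mulrC.
  have [Yt|nY] := pselect (Y t); last by rewrite /kphi phiY// !mulr0.
  by rewrite /kphi arc_kerE// mulrA divff ?mul1r//; exact: (arc_den_neq0 rho01 XY).
have Lt := L2_twist 1 (L2_kphi x).
rewrite (ipBl (L2_kphi x) (L2Z _ Lt) Le) (ipZl _ Lt Le).
rewrite ip_twist mulrBl; congr (_ - _).
have -> : twist (-1) (e n) = e (n - 1).
  by apply/funext => t; rewrite /twist -fourier_expD addrC.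
by rewrite mulrAC -fourier_expD addrC mulrC addrC.
Qed.

Lemma fourier_sum_local M x : X x -> fourier_sum (sym_range M) phi x =
  a x M * e M x - a x (- M.+1%:Z) * e (- M.+1%:Z) x.
Proof.
move=> Xx; rewrite /fourier_sum fct_sumE.
rewrite (eq_bigr (fun n => a x n * e n x - a x (n - 1) * e (n - 1) x)); last first.
  by move=> n _; rewrite -coefE.
rewrite -(big_sym_range M (fun n : int => a x n * e n x - a x (n - 1) * e (n - 1) x)).
have sh1 (k : nat) : k.+1%:Z - M.+1%:Z = k%:Z - M%:Z by rewrite !intS opprD addrACA subrr add0r.
have sh2 (k : nat) : k%:Z - M.+1%:Z = k%:Z - M%:Z - 1 by rewrite intS opprD addrCA [LHS]addrC.
(* Index k stands for the frequency k - M - 1, so the 2M + 1 differences telescope from -M - 1 to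
   M. *)
pose F (k : nat) : R[i] := a x (k%:Z - M.+1%:Z) * e (k%:Z - M.+1%:Z) x.
rewrite (eq_bigr (fun k : 'I_M.*2.+1 => F k.+1 - F k)); last first.
  by move=> k _; rewrite /F sh1 sh2.
rewrite -(big_mkord xpredT (fun k => F k.+1 - F k)) telescope_sumr// /F sub0r.
by rewrite sh1 -addnn PoszD addrK.
Qed.

(** Riemann localization in L^2(nu): the two boundary terms tend to 0 for each x by the Bessel
    inequality, with a bound uniform in x, so dominated convergence applies. *)
Lemma fourier_sum_local_cvg0 (nu : {finite_measure set TR -> \bar R}) :
  nu (~` X) = 0%E ->
  nsq nu (fourier_sum (sym_range M) phi) @[M --> \oo] --> 0.
Proof.
move=> X0; pose K := arc_bound rho * nsq lam phi.
have bnd M x : X x -> sqc (fourier_sum (sym_range M) phi x) <=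
    2 * sqc (a x M) + 2 * sqc (a x (- M.+1%:Z)).
  move=> Xx; rewrite fourier_sum_local//.
  by apply: le_trans (sqcB_le _ _) _; rewrite !sqcM !sqc_fourier_exp !mulr1.
apply: (nsq_cvg0 mX X0 (u := fun=> 2 * K + 2 * K)).
- by move=> M; exact: (L2_mcf (L2_exp_sum nu _ _)).
- exact: rint_cst.
- move=> M x Xx; apply: le_trans (bnd M x Xx) _.
  by apply: lerD; rewrite ler_wpM2l.
- move=> x Xx; apply: (@squeeze_cvg0 _ _ (fun M : nat => 2 * sqc (a x M) + 2 * sqc (a x (- M.+1%:Z)))).
    by move=> M; rewrite sqc_ge0 bnd.
  rewrite -[X in _ --> X](_ : 2 * 0 + 2 * 0 = 0); last by rewrite mulr0 addr0.
  apply: cvgD; apply: cvgMr.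
  + by apply: (fourier_coef_cvg0 (g := fun M : nat => M%:Z)) => // i j [].
  + by apply: (fourier_coef_cvg0 (g := fun M : nat => - M.+1%:Z)) => // i j /oppr_inj[].
Qed.

End localization.

(** * Orthonormal bases of finite-dimensional spaces *)

Section gram_schmidt.
Context d (T : measurableType d) (R : realType).
Variable mu : {measure set T -> \bar R}.
Local Open Scope complex_scope.
Local Open Scope ring_scope.
Local Notation ip := (L2inner mu).
Local Notation N := (nsq mu).
Implicit Types (f g w : T -> R[i]) (u h : nat -> T -> R[i]).

Definition gs_rest u k f : T -> R[i] := f - \sum_(i < k) ip f (u i) *: u i.

Lemma L2_gs_rest u k f : (forall i, L2 mu (u i)) -> L2 mu f -> L2 mu (gs_rest u k f).
Proof. by move=> Lu Lf; apply: L2B => //; apply: L2_sum => i _; exact: L2Z. Qed.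

Lemma gs_restD u k f g : (forall i, L2 mu (u i)) -> L2 mu f -> L2 mu g ->
  gs_rest u k (f + g) = gs_rest u k f + gs_rest u k g.
Proof.
move=> Lu Lf Lg; rewrite /gs_rest addrACA -opprD -big_split/=.
by congr (_ - _); apply: eq_bigr => i _; rewrite ipDl// scalerDl.
Qed.

Lemma gs_restZ u k a f : (forall i, L2 mu (u i)) -> L2 mu f ->
  gs_rest u k (a *: f) = a *: gs_rest u k f.
Proof.
move=> Lu Lf; rewrite /gs_rest scalerBr scaler_sumr.
by congr (_ - _); apply: eq_bigr => i _; rewrite ipZl// scalerA.
Qed.

(** Orthogonality of the remainder to each u_i is asked for instead of orthonormality. It allows
    null u_i, so dependent vectors need not be dropped and the index k stays fixed. *)
Definition gs_orth u k := (forall i, L2 mu (u i)) /\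
  forall f, L2 mu f -> forall i, (i < k)%N -> ip (gs_rest u k f) (u i) = 0.

Lemma ip_gs_rest u k f w : gs_orth u k -> L2 mu f -> L2 mu w ->
  (forall i, (i < k)%N -> ip w (u i) = 0) -> ip (gs_rest u k f) w = ip f w.
Proof.
move=> [Lu _] Lf Lw w0; have Ls : L2 mu (\sum_(i < k) ip f (u i) *: u i).
  by apply: L2_sum => i _; exact: L2Z.
rewrite ipBl// ip_suml//; last by move=> i; exact: L2Z.
rewrite big1 ?subr0// => i _; rewrite ipZl// (ipC (Lu i) Lw) w0//.
by rewrite conj_real ?rmorph0 mulr0.
Qed.

Lemma nsq_gs_rest u k f : gs_orth u k -> L2 mu f ->
  N (gs_rest u k f) = N f - \sum_(i < k) sqc (ip f (u i)).
Proof.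
move=> /[dup] -[Lu O] H Lf; apply: (@complexI R); rewrite -ip_nsq.
have LP : L2 mu (gs_rest u k f) by exact: L2_gs_rest.
rewrite ip_gs_rest// => [|i ik]; last exact: O.
have Ls : L2 mu (\sum_(i < k) ip f (u i) *: u i).
  by apply: L2_sum => i _; exact: L2Z.
rewrite ipBr// ip_nsq ip_sumr// ?rmorphB ?rmorph_sum/=; last by move=> i; exact: L2Z.
by congr (_ - _); apply: eq_bigr => i _; rewrite ipZr// mulrC mulc_conj.
Qed.

Lemma gram_schmidt h k : (forall i, L2 mu (h i)) ->
  exists2 u, gs_orth u k & forall i, (i < k)%N -> N (gs_rest u k (h i)) = 0.
Proof.
move=> Lh; elim: k => [|k [u H Hh]].
  by exists (fun=> 0) => //; split => // i; exact: L20.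
have [Lu O] := H; set v := gs_rest u k (h k); have Lv : L2 mu v by exact: L2_gs_rest.
(* If v is null then s = 0, its inverse is 0 by convention, and w = 0. *)
pose s := Num.sqrt (N v); pose w : T -> R[i] := (s^-1)%:C *: v.
have Lw : L2 mu w by exact: L2Z.
have s2 : s ^+ 2 = N v by rewrite sqr_sqrtr// nsq_ge0.
have wu i : (i < k)%N -> ip w (u i) = 0 by move=> ik; rewrite ipZl// O// mulr0.
pose u' i := if i == k then w else u i.
have u'k : u' k = w by rewrite /u' eqxx.
have u'E i : (i < k)%N -> u' i = u i by move=> ik; rewrite /u' ltn_eqF.
have Lu' i : L2 mu (u' i) by rewrite /u'; case: eqP.
have restE f : gs_rest u' k.+1 f = gs_rest u k f - ip f w *: w.
  rewrite /gs_rest big_ord_recr/= u'k opprD addrA; congr (_ - _ - _).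
  by apply: eq_bigr => i _; rewrite u'E.
have Nw : ip v w = s%:C /\ N w = s^-1 ^+ 2 * s ^+ 2.
  rewrite nsqZ// sqc_real s2; split=> //; rewrite ipZr// ip_nsq -s2 conj_real -rmorphM.
  by have [->|s0] := eqVneq s 0; rewrite ?expr0n ?mulr0//= expr2 mulKf.
case: Nw => vw Nw.
have H' : gs_orth u' k.+1.
  split=> // f Lf i; rewrite ltnS leq_eqVlt => /orP[/eqP ->|ik]; rewrite restE.
    have Lr := L2_gs_rest k Lu Lf; have Lz := L2Z (ip f w) Lw.
    rewrite u'k ipBl// ipZl// ip_gs_rest// ip_nsq Nw.
    have [s0|s0] := eqVneq s 0.
      by rewrite /w s0 invr0 scale0r ip0r// mul0r subrr.
    by rewrite exprVn mulVf ?expf_neq0// mulr1 subrr.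
  have Lr := L2_gs_rest k Lu Lf; have Lz := L2Z (ip f w) Lw.
  by rewrite u'E// ipBl// ipZl// O// wu// mulr0 subrr.
exists u' => // i; rewrite ltnS leq_eqVlt => /orP[/eqP ->|ik]; last first.
  apply/eqP; rewrite eq_le nsq_ge0 andbT nsq_gs_rest// big_ord_recr/=.
  rewrite (eq_bigr (fun j : 'I_k => sqc (ip (h i) (u j)))) => [|j _]; last by rewrite u'E.
  by rewrite opprD addrA -nsq_gs_rest// Hh// sub0r oppr_le0 sqc_ge0.
have hw : ip (h k) w = s%:C by rewrite -vw ip_gs_rest.
rewrite restE -/v hw /w scalerA -rmorphM.
have [s0|s0] := eqVneq s 0; first by rewrite s0 mul0r scale0r subr0 -s2 s0 expr0n.
by rewrite divff// scale1r subrr nsq0.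
Qed.

(** The remainder map is linear and kills the spanning family up to null functions, hence every f;
    then [nsq_gs_rest] reads as Parseval. *)
Lemma finite_dimensional_parseval : finite_dimensional_L2 mu ->
  exists k u, (forall i, L2 mu (u i)) /\
    forall f, L2 mu f -> N f = \sum_(i < k) sqc (ip f (u i)).
Proof.
case=> k [h [Lh span]]; pose hn i : T -> R[i] := oapp h 0 (insub i).
have Lhn i : L2 mu (hn i) by rewrite /hn; case: insub => //=; exact: L20.
have [u /[dup] -[Lu _] H Hh] := gram_schmidt k Lhn.
exists k, u; split=> // f Lf; apply/eqP; rewrite -subr_eq0 -nsq_gs_rest//.
have [c fc] := span f Lf; pose f' : T -> R[i] := \sum_(i < k) c i *: hn i.
have Lf' : L2 mu f' by apply: L2_sum => i _; exact: L2Z.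
have Ld := L2B Lf Lf'.
have d0 : N (f - f') = 0.
  rewrite /nsq -[RHS]/(fine 0%:E); congr fine; rewrite -[RHS](integral0 mu setT).
  apply: ae_eq_integral => //.
  - by apply/measurable_EFinP; exact: mcf_sqc (L2_mcf Ld).
  - apply: filterS fc => x fx _ /=; congr EFin.
    rewrite [X in sqc X](_ : _ = f x - f' x)// /f' fct_sumE fx.
    rewrite (eq_bigr (fun i => c i * hn i x)) ?subrr ?sqc0// => i _.
    by rewrite /hn valK.
have R0 : N (gs_rest u k f') = 0.
  suff [] : L2 mu f' /\ N (gs_rest u k f') = 0 by [].
  rewrite /f'; elim/big_ind: _ => [|p q [Lp p0] [Lq q0]|i _].
  - by split; [exact: L20|rewrite -(scale0r f) gs_restZ// scale0r nsq0].
  - split; first exact: L2D.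
    apply/eqP; rewrite eq_le nsq_ge0 andbT gs_restD//.
    apply: le_trans (nsqD_le (L2_gs_rest k Lu Lp) (L2_gs_rest k Lu Lq)) _.
    by rewrite p0 q0 mulr0 addr0.
  - split; first exact: L2Z.
    by rewrite gs_restZ// nsqZ ?Hh ?mulr0//; exact: L2_gs_rest.
rewrite eq_le nsq_ge0 andbT -[f](subrK f') gs_restD//.
apply: le_trans (nsqD_le (L2_gs_rest k Lu Ld) (L2_gs_rest k Lu Lf')) _.
rewrite R0 nsq_gs_rest// d0 mulr0 addr0 sub0r mulrN oppr_le0 mulr_ge0//.
by apply: sumr_ge0 => i _; exact: sqc_ge0.
Qed.

End gram_schmidt.

(** * Adding an absolutely continuous part *)

Section weighted_sum.
Variable R : realType.
Local Open Scope complex_scope.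
Local Open Scope ring_scope.
Local Notation TR := (measurableTypeR R).
Local Notation lam := (lam R).
Variables (mu nu : {finite_measure set TR -> \bar R}) (E : set TR) (w : TR -> R) (m W : R).
Hypotheses (mE : measurable E) (mw : measurable_fun [set: TR] w) (m_gt0 : 0 < m).
Hypothesis w_on : forall x, E x -> m <= w x <= W.
Hypothesis w_off : forall x, ~ E x -> w x = 0.
Hypothesis W_ge0 : 0 <= W.
Hypothesis mu_split : forall v : TR -> \bar R, measurable_fun [set: TR] v ->
  (forall x, 0 <= v x)%E ->
  (\int[mu]_x v x = \int[nu]_x v x + \int[lam]_x ((w x)%:E * v x))%E.

Local Notation rint rho u := (rho.-integrable [set: TR] (EFin \o u)).

Definition restr (A : set TR) (f : TR -> R[i]) : TR -> R[i] :=
  fun x => (\1_A x : R)%:C * f x.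

Lemma restr_in A f x : A x -> restr A f x = f x.
Proof. by move=> Ax; rewrite /restr indicE mem_set// mul1r. Qed.

Lemma restr_out A f x : ~ A x -> restr A f x = 0.
Proof. by move=> Ax; rewrite /restr indicE memNset// mul0r. Qed.

Lemma sqc_restr_le A f x : sqc (restr A f x) <= sqc (f x).
Proof.
by have [Ax|nA] := pselect (A x); [rewrite restr_in|rewrite restr_out// sqc0 sqc_ge0].
Qed.

Lemma mcf_restr A f : measurable A -> measurable_cfun f -> measurable_cfun (restr A f).
Proof. by move=> mA mf; apply: mcfM => //; exact: mcf_indic. Qed.

Lemma L2_restr (rho : {finite_measure set TR -> \bar R}) A f : measurable A ->
  L2 rho f -> L2 rho (restr A f).
Proof.
move=> mA Lf; apply: (L2_of_le (mcf_restr mA (L2_mcf Lf)) (L2_rint Lf)) => x.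
exact: sqc_restr_le.
Qed.

Lemma restrB A f g : restr A (f - g) = restr A f - restr A g.
Proof. by apply/funext => x; exact: mulrBr. Qed.

Lemma w_ge0 x : 0 <= w x.
Proof.
have [/w_on/andP[+ _]|/w_off ->//] := pselect (E x).
by apply: le_trans; exact: ltW.
Qed.

Lemma w_le x : w x <= W.
Proof. by have [/w_on/andP[]|/w_off ->//] := pselect (E x). Qed.

Lemma rint_split u : measurable_fun [set: TR] u ->
  rint mu u <-> rint nu u /\ rint lam (fun x => w x * u x).
Proof.
move=> mu'; have me := (measurable_EFinP _ _).2 mu'.
have mwu : measurable_fun [set: TR] (fun x => w x * u x) by exact: measurable_funM.
have ma : measurable_fun [set: TR] (fun x => `|(u x)%:E|%E) by exact: measurableT_comp.
have := mu_split ma (fun x => abse_ge0 _).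
have -> : (\int[lam]_x ((w x)%:E * `|(u x)%:E|) = \int[lam]_x `|(w x * u x)%:E|)%E.
  by apply: eq_integral => x _; rewrite EFinM abseM (gee0_abs (x := (w x)%:E))// lee_fin w_ge0.
move=> H; split=> [/integrableP[_]|[/integrableP[_ i1] /integrableP[_ i2]]].
  rewrite [X in (X < _)%E]H => lt; split; apply/integrableP; split=> //.
  - by apply: le_lt_trans lt; rewrite leeDl// integral_ge0.
  - exact/measurable_EFinP.
  - by apply: le_lt_trans lt; rewrite leeDr// integral_ge0.
by apply/integrableP; split=> //; rewrite [X in (X < _)%E]H; exact: lte_add_pinfty.
Qed.

(** The hypothesis [mu_split] concerns nonnegative functions; a signed u is reached as the
    difference of |u| + u and |u|. *)
Lemma Rintegral_split u : rint mu u ->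
  \int[mu]_x u x = \int[nu]_x u x + \int[lam]_x (w x * u x).
Proof.
move=> iu; have mu' : measurable_fun [set: TR] u by apply/measurable_EFinP; exact: (measurable_int _ iu).
have pos v : rint mu v -> (forall x, 0 <= v x) ->
    \int[mu]_x v x = \int[nu]_x v x + \int[lam]_x (w x * v x).
  move=> iv v0; have mv : measurable_fun [set: TR] v by apply/measurable_EFinP; exact: (measurable_int _ iv).
  have [inu ilam] := (rint_split mv).1 iv.
  apply: EFin_inj; rewrite EFinD /Rintegral !fineK; try exact: integrable_fin_num.
  rewrite [LHS](mu_split (v := EFin \o v)); [by []|exact/measurable_EFinP|].
  by move=> x; rewrite lee_fin.
have ia : rint mu (fun x => `|u x|) by apply: (integrable_abse iu).
have ip : rint mu (fun x => `|u x| + u x) by exact: rintD.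
have p0 x : 0 <= `|u x| + u x by rewrite -lerBlDr sub0r -normrN ler_norm.
have ma : measurable_fun [set: TR] (fun x => `|u x|) by exact: measurableT_comp.
have [nu1 lu1] := (rint_split mu').1 iu; have [na la] := (rint_split ma).1 ia.
have := pos _ ip p0; have := pos _ ia (fun x => normr_ge0 _).
rewrite !RintegralD//.
have -> : \int[lam]_x (w x * (`|u x| + u x)) =
    \int[lam]_x (w x * `|u x|) + \int[lam]_x (w x * u x).
  by rewrite -RintegralD//; apply: eq_Rintegral => x _; rewrite mulrDr.
lra.
Qed.

(** The lower bound m on E is what controls Lebesgue measure on E by mu. *)
Lemma L2_split f : L2 mu f -> L2 nu f /\ L2 lam (restr E f).
Proof.
move=> /L2P[mf If]; have [i1 i2] := (rint_split (mcf_sqc mf)).1 If.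
split; first exact/L2P.
apply: (L2_of_le (mcf_restr mE mf) (rintZ m^-1 i2)) => x.
have [Ex|nE] := pselect (E x); last first.
  by rewrite restr_out// sqc0 !mulr_ge0 ?invr_ge0 ?w_ge0 ?sqc_ge0// ltW.
rewrite restr_in//= mulrCA mulrA ler_peMl ?sqc_ge0// ler_pdivlMr// mul1r.
by have /andP[] := w_on Ex.
Qed.

Lemma L2_join f : measurable_cfun f -> L2 nu f -> L2 lam (restr E f) -> L2 mu f.
Proof.
move=> mf /L2_rint i1 /L2_rint i2; apply/L2P; split=> //.
apply/(rint_split (mcf_sqc mf)); split=> //.
apply: (le_rint _ (rintZ W i2)) => [|x /=].
  by apply: measurable_funM => //; exact: mcf_sqc.
have [Ex|nE] := pselect (E x); last by rewrite w_off// mul0r normr0 mulr_ge0 ?sqc_ge0.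
by rewrite restr_in// ger0_norm ?mulr_ge0 ?w_ge0 ?sqc_ge0// ler_wpM2r ?sqc_ge0 ?w_le.
Qed.

Lemma nsq_split f : L2 mu f ->
  nsq mu f = nsq nu f + \int[lam]_x (w x * sqc (f x)).
Proof. by move=> /L2_rint If; exact: Rintegral_split. Qed.

Lemma nsq_split_le f : L2 mu f -> nsq mu f <= nsq nu f + W * nsq lam (restr E f).
Proof.
move=> Lf; have [L1 L2'] := L2_split Lf; rewrite nsq_split// lerD2l.
have [_ i2] := (rint_split (mcf_sqc (L2_mcf Lf))).1 (L2_rint Lf).
rewrite -RintegralZl//; last exact: L2_rint.
apply: le_Rintegral => //; first exact: (rintZ W (L2_rint L2')).
move=> x _; have [Ex|nE] := pselect (E x); last by rewrite w_off// mul0r mulr_ge0 ?sqc_ge0.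
by rewrite restr_in// ler_wpM2r ?sqc_ge0 ?w_le.
Qed.

Lemma nsq_split_ge f : L2 mu f -> nsq nu f + m * nsq lam (restr E f) <= nsq mu f.
Proof.
move=> Lf; have [L1 L2'] := L2_split Lf; rewrite (nsq_split Lf) lerD2l.
have [_ i2] := (rint_split (mcf_sqc (L2_mcf Lf))).1 (L2_rint Lf).
rewrite -RintegralZl//; last exact: L2_rint.
apply: le_Rintegral => //; first exact: (rintZ m (L2_rint L2')).
move=> x _; have [Ex|nE] := pselect (E x).
  by rewrite restr_in// ler_wpM2r ?sqc_ge0//; have /andP[] := w_on Ex.
by rewrite restr_out// sqc0 mulr0 mulr_ge0 ?w_ge0 ?sqc_ge0.
Qed.

Lemma ip_split f h : L2 mu f -> L2 mu h ->
  L2inner mu f h = L2inner nu f h + cintegral lam (fun x => (w x)%:C * (f x * (h x)^*)).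
Proof.
move=> Lf Lh; have [i1 i2] := cintegrable_inner Lf Lh.
rewrite /L2inner /cintegral -[RHS]/(_ +i* _); congr (_ +i* _).
- rewrite [LHS]Rintegral_split//; congr (_ + _).
  by apply: eq_Rintegral => x _; rewrite [in RHS]ReM/= mul0r subr0.
- rewrite [LHS]Rintegral_split//; congr (_ + _).
  by apply: eq_Rintegral => x _; rewrite [in RHS]ImM/= mul0r addr0.
Qed.

End weighted_sum.

(** * Fubini for complex integrals *)

Section complex_fubini.
Context d1 d2 (T1 : measurableType d1) (T2 : measurableType d2) (R : realType).
Local Open Scope complex_scope.
Local Open Scope ring_scope.
Variables (m1 : {finite_measure set T1 -> \bar R}) (m2 : {finite_measure set T2 -> \bar R}).
Variables (G : T1 * T2 -> R[i]) (u : T2 -> R).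
Hypotheses (mG : measurable_cfun G) (iu : m2.-integrable [set: T2] (EFin \o u))
  (u0 : forall y, 0 <= u y) (Gu : forall p, sqc (G p) <= u p.2 ^+ 2).

Let ReG p : `|complex.Re (G p)| <= u p.2.
Proof.
rewrite -(@ler_pXn2r _ 2) ?nnegrE// real_normK ?num_real//.
exact: le_trans (Re_le_sqc _) (Gu _).
Qed.

Let ImG p : `|complex.Im (G p)| <= u p.2.
Proof.
rewrite -(@ler_pXn2r _ 2) ?nnegrE// real_normK ?num_real//.
exact: le_trans (Im_le_sqc _) (Gu _).
Qed.

Lemma mcf_fubini1 : measurable_cfun (fun x => cintegral m2 (fun y => G (x, y))).
Proof.
case: mG => g1 g2; split.
- exact: (measurable_Rfubini1 m1 g1 iu ReG).
- exact: (measurable_Rfubini1 m1 g2 iu ImG).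
Qed.

Lemma mcf_fubini2 : measurable_cfun (fun y => cintegral m1 (fun x => G (x, y))).
Proof.
case: mG => g1 g2; split.
- exact: (measurable_Rfubini2 m1 g1 iu ReG).
- exact: (measurable_Rfubini2 m1 g2 iu ImG).
Qed.

Lemma complex_fubini : cintegral m1 (fun x => cintegral m2 (fun y => G (x, y))) =
  cintegral m2 (fun y => cintegral m1 (fun x => G (x, y))).
Proof.
case: mG => g1 g2; rewrite /cintegral -[RHS]/(_ +i* _); congr (_ +i* _).
- exact: (Rfubini m1 g1 iu ReG).
- exact: (Rfubini m1 g2 iu ImG).
Qed.

End complex_fubini.

(** * Bounded operators into L^2(0, 1) and their adjoints *)

Section transfer.
Variable R : realType.
Local Open Scope complex_scope.
Local Open Scope ring_scope.
Local Notation TR := (measurableTypeR R).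
Local Notation e := (@fourier_exp R).
Local Notation lam := (lam R).
Variable nu : {finite_measure set TR -> \bar R}.
Local Notation ip := (L2inner nu).
Local Notation N := (nsq nu).

(* [A] is a bounded operator L^2(nu) -> L^2([0,1)) and [a n] plays the role of A^* e_n. *)
Record transfer (A : (TR -> R[i]) -> TR -> R[i]) (a : int -> TR -> R[i]) (C : R) : Prop :=
  Transfer {
  tr_ge0 : 0 <= C ;
  tr_L2 : forall f, L2 nu f -> L2 lam (A f) ;
  tr_le : forall f, L2 nu f -> nsq lam (A f) <= C * N f ;
  tr_adj : forall n, L2 nu (a n) ;
  tr_ip : forall f n, L2 nu f -> L2inner lam (A f) (e n) = ip f (a n) }.

Lemma transferD A B a b C D : transfer A a C -> transfer B b D ->
  transfer (fun f => A f + B f) (fun n => a n + b n) (2 * C + 2 * D).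
Proof.
move=> [C0 LA leA La ipA] [D0 LB leB Lb ipB]; split.
- by rewrite addr_ge0// mulr_ge0.
- by move=> f Lf; apply: L2D; [exact: LA|exact: LB].
- move=> f Lf; apply: le_trans (nsqD_le (LA f Lf) (LB f Lf)) _.
  rewrite [leRHS]mulrDl -(mulrA 2 C) -(mulrA 2 D).
  by apply: lerD; apply: ler_wpM2l => //; [exact: leA|exact: leB].
- by move=> n; exact: L2D.
- move=> f n Lf; rewrite ipDl ?ipA ?ipB//; last exact: L2_fourier_exp.
  + by rewrite ipDr.
  + exact: LA.
  + exact: LB.
Qed.

Lemma transferN A a C : transfer A a C -> transfer (fun f => - A f) (fun n => - a n) C.
Proof.
move=> [C0 LA leA La ipA]; split=> //.
- by move=> f Lf; exact/L2N/LA.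
- by move=> f Lf; rewrite nsqN leA.
- by move=> n; exact: L2N.
- move=> f n Lf; have Le := L2_fourier_exp lam n.
  rewrite (ipNl (LA f Lf) Le) ipA// -[in RHS](sub0r (a n)) ipBr//; last exact: L20.
  by rewrite ip0r// sub0r.
Qed.

Lemma transfer0 : transfer (fun _ => 0) (fun _ => 0) 0.
Proof.
split=> // [f _|f _|_|f n Lf].
- exact: L20.
- by rewrite nsq0 mul0r.
- exact: L20.
- by rewrite ip0r// ip0l//; exact: L2_fourier_exp.
Qed.

Lemma transfer_rank1 u psi : L2 nu u -> L2 lam psi ->
  transfer (fun f => ip f u *: psi) (fun n => (L2inner lam psi (e n))^* *: u)
    (N u * nsq lam psi).
Proof.
move=> Lu Lp; split.
- by rewrite mulr_ge0// nsq_ge0.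
- by move=> f Lf; exact: L2Z.
- move=> f Lf; rewrite nsqZ// mulrAC ler_wpM2r ?nsq_ge0// mulrC; exact: cauchy_schwarz.
- by move=> n; exact: L2Z.
- move=> f n Lf; rewrite ipZl ?ipZr ?conjCK//; first exact: mulrC.
  exact: L2_fourier_exp.
Qed.

Section kernel.
Variables (Q : TR -> TR -> R[i]) (K : R) (Y : set TR).
Hypotheses (mQ : measurable_cfun (fun p : TR * TR => Q p.1 p.2))
  (QK : forall t x, sqc (Q t x) <= K) (mY : measurable Y).

Let K0 : 0 <= K.
Proof. exact: le_trans (sqc_ge0 _) (QK 0 0). Qed.

Let LQ t : L2 nu (Q t).
Proof. exact: (L2_bounded nu (mcf_comp mQ (pair1_measurable t)) (QK t)). Qed.

Let k (x t : TR) : R[i] := restr Y (fun t => (Q t x)^*) t.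

Let mk : measurable_cfun (fun p : TR * TR => k p.2 p.1).
Proof.
apply: mcfM; last exact: mcf_conj.
by apply: (@mcf_comp _ _ _ _ _ (fun t => (\1_Y t : R)%:C) fst) => //; exact: mcf_indic.
Qed.

Let kK x t : sqc (k x t) <= K.
Proof. by apply: le_trans (sqc_restr_le _ _ _) _; rewrite sqc_conj. Qed.

Let Lk x : L2 lam (k x).
Proof. exact: (L2_bounded lam (mcf_comp mk (pair2_measurable x)) (kK x)). Qed.

Let adj n x : R[i] := (L2inner lam (k x) (e n))^*.

Let mcf_ke n : measurable_cfun (fun p : TR * TR => k p.2 p.1 * (e n p.1)^*).
Proof.
apply: mcfM => //; apply: mcf_conj.
by apply: (@mcf_comp _ _ _ _ _ (e n) fst) => //; exact: mcf_fourier_exp.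
Qed.

Let ke_le n p : sqc (k p.2 p.1 * (e n p.1)^*) <= K.
Proof. by rewrite sqcM sqc_conj sqc_fourier_exp mulr1. Qed.

Let L2_adj n : L2 nu (adj n).
Proof.
apply: (L2_bounded nu (K := K)).
  apply: mcf_conj; apply: (mcf_fubini2 lam (m2 := nu) (mcf_ke n) (rint_cst nu (K + 1))) => [_|p].
    by rewrite addr_ge0.
  by apply: le_trans (ke_le n p) _; have := K0; rewrite expr2; nra.
move=> x; rewrite sqc_conj; apply: le_trans (cauchy_schwarz (Lk x) (L2_fourier_exp lam n)) _.
have -> : nsq lam (e n) = 1.
  by apply: (@complexI R); rewrite -ip_nsq ip_fourier_exp eqxx.
rewrite mulr1 -[leRHS]mulr1 -(mass_lam R).
exact: (nsq_bounded lam (mcf_comp mk (pair2_measurable x)) (kK x)).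
Qed.

(** The adjoint comes from exchanging the integrals in t and x; its value at x is a conjugated
    Fourier coefficient of the kernel in t. *)
Lemma transfer_kernel :
  transfer (fun f => restr Y (fun t => ip f (Q t))) adj (K * mass nu).
Proof.
have mA f : L2 nu f -> measurable_cfun (restr Y (fun t => ip f (Q t))).
  move=> Lf; apply: mcf_restr => //.
  have mf2 : measurable_cfun (fun p : TR * TR => f p.2 * (Q p.1 p.2)^*).
    apply: mcfM; last exact: mcf_conj.
    by apply: (@mcf_comp _ _ _ _ _ f snd) => //; exact: L2_mcf Lf.
  apply: (mcf_fubini1 lam mf2 (rintD (L2_rint Lf) (rint_cst nu K))) => [x|p].
    by rewrite addr_ge0// sqc_ge0.
  rewrite sqcM sqc_conj; have := sqc_ge0 (f p.2); have := QK p.1 p.2.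
  by have := sqc_ge0 (Q p.1 p.2); rewrite expr2/=; nra.
have Ale f t : L2 nu f -> sqc (restr Y (fun t => ip f (Q t)) t) <= K * mass nu * N f.
  move=> Lf; apply: le_trans (sqc_restr_le _ _ _) _.
  apply: le_trans (cauchy_schwarz Lf (LQ t)) _; rewrite mulrC ler_wpM2r ?nsq_ge0//.
  exact: (nsq_bounded nu (mcf_comp mQ (pair1_measurable t)) (QK t)).
split.
- by rewrite mulr_ge0// mass_ge0.
- by move=> f Lf; apply: (L2_bounded lam (mA f Lf)) => t; exact: Ale.
- move=> f Lf; rewrite -[leRHS]mulr1 -(mass_lam R).
  by apply: nsq_bounded; [exact: mA|move=> t; exact: Ale].
- exact: L2_adj.
- move=> f n Lf.
  have mG : measurable_cfun (fun p : TR * TR => f p.2 * (k p.2 p.1 * (e n p.1)^*)).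
    apply: mcfM => //.
    by apply: (@mcf_comp _ _ _ _ _ f snd) => //; exact: L2_mcf Lf.
  have Le := L2_fourier_exp lam n.
  transitivity (cintegral lam (fun t => cintegral nu (fun x => f x * (k x t * (e n t)^*)))).
    congr cintegral; apply/funext => t; rewrite /restr.
    rewrite mulrAC -cintegralZ; last exact: cintegrable_inner.
    congr cintegral; apply/funext => x.
    by rewrite [LHS](_ : _ = (\1_Y t)%:C * (e n t)^* * (f x * (Q t x)^*))// /k /restr; ring.
  rewrite (complex_fubini lam mG (rintD (L2_rint Lf) (rint_cst nu K))) => [|x|p].
  + congr cintegral; apply/funext => x; rewrite conjCK -cintegralZ//.
    exact: cintegrable_inner.
  + by rewrite addr_ge0// sqc_ge0.
  + rewrite /= sqcM; have := sqc_ge0 (f p.2); have := ke_le n p.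
    by have := sqc_ge0 (k p.2 p.1 * (e n p.1)^*); rewrite expr2/=; nra.
Qed.

End kernel.
End transfer.

(** * Unordered sums over the integers *)

Section esum_int.
Variable R : realType.
Variable F : int -> R.
Hypothesis F0 : forall n, 0 <= F n.

(** Every finite set of integers lies in a symmetric range and the terms are nonnegative, so
    symmetric sums bound all finite sums. *)
Lemma esum_int_le (C : R) : (forall M, \sum_(n <- sym_range M) F n <= C) ->
  (\esum_(n in [set: int]) (F n)%:E <= C%:E)%E.
Proof.
move=> FC; apply: ge_ereal_sup => _ [A [finA _] <-].
have [s As] := (finite_seqP _).1 finA; pose M := \max_(n <- s) `|n|%N.
apply: (@le_trans _ _ (\sum_(n \in [set` sym_range M]) (F n)%:E)%E).
  apply: lee_fsum_nneg_subset => //; first exact: finite_seq.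
    move=> n; rewrite !inE As /= => ns; rewrite mem_sym_range.
    exact: (leq_bigmax_seq (F := fun n : int => `|n|%N)).
  by move=> n _; rewrite lee_fin.
by rewrite -fsbig_seq ?sym_range_uniq// sumEFin lee_fin.
Qed.

Lemma esum_int_ge M :
  ((\sum_(n <- sym_range M) F n)%:E <= \esum_(n in [set: int]) (F n)%:E)%E.
Proof.
apply: esum_ge; exists [set` sym_range M]; first by split; [exact: finite_seq|].
by rewrite -fsbig_seq ?sym_range_uniq// sumEFin.
Qed.

End esum_int.

(** * The notions in terms of squared norms and symmetric sums *)

Section reformulation.
Variable R : realType.
Local Open Scope complex_scope.
Local Open Scope ring_scope.
Local Notation TR := (measurableTypeR R).
Local Notation e := (@fourier_exp R).
Variables (mu : {finite_measure set TR -> \bar R}) (G : int -> TR -> R[i]).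
Hypothesis LG : forall n, L2 mu (G n).

Lemma dextrodual_nsq :
  (forall f, L2 mu f -> nsq mu (f - \sum_(n <- sym_range M) L2inner mu f (G n) *: e n)
    @[M --> \oo] --> 0) -> dextrodual mu G e.
Proof.
move=> H f Lf; have Le n := L2_fourier_exp mu n.
rewrite (_ : (fun M => _) = fun M => (Num.sqrt (nsq mu (f -
    \sum_(n <- sym_range M) L2inner mu f (G n) *: e n)))%:E); last first.
  apply/funext => M; rewrite -L2norm_nsq; last first.
    by apply: L2B => //; apply: L2_sum => n _; exact: L2Z.
  congr L2norm; apply/funext => x.
  rewrite /symmetric_partial_sum (big_sym_range M (fun n => L2inner mu f (G n) * e n x)).
  by rewrite [RHS](_ : _ = f x - (\sum_(n <- sym_range M) L2inner mu f (G n) *: e n) x)// fct_sumE.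
apply: cvg_EFin; first exact: nearW.
rewrite -[X in _ --> X](sqrtr0 R).
by apply: continuous_cvg; [exact: sqrt_continuous|exact: H].
Qed.

Lemma bessel_nsq (C : R) : 0 <= C ->
  (forall f M, L2 mu f ->
    \sum_(n <- sym_range M) sqc (L2inner mu f (G n)) <= C * nsq mu f) ->
  bessel_sequence mu G.
Proof.
move=> C0 H; split=> //; exists (C + 1) => [|f Lf]; first by rewrite ltr_wpDl.
rewrite L2norm_sqr// -EFinM; under eq_esum do rewrite normc_sqc.
apply: esum_int_le => [n|M]; first exact: sqc_ge0.
by apply: le_trans (H f M Lf) _; rewrite ler_wpM2r ?nsq_ge0// lerDl.
Qed.

(** The lower bound is needed only up to an error tending to 0 with M, which may depend on f:
    partial sums increase to the full sum. *)
Lemma frame_nsq (A : R) : bessel_sequence mu G -> 0 < A ->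
  (forall f, L2 mu f -> exists2 del : nat -> R, del M @[M --> \oo] --> 0 &
    forall M, nsq mu f / A <= \sum_(n <- sym_range M) sqc (L2inner mu f (G n)) + del M) ->
  frame mu G.
Proof.
move=> HB A0 H; split=> //; exists A^-1 => [|f Lf]; first by rewrite invr_gt0.
have [del d0 Hd] := H f Lf; rewrite L2norm_sqr// -EFinM mulrC.
under eq_esum do rewrite normc_sqc.
apply/lee_addgt0Pr => eps eps0.
have [M0 /(_ _ (leqnn M0)) HM] := cvg0_near d0 eps0.
apply: (@le_trans _ _ (\sum_(n <- sym_range M0) sqc (L2inner mu f (G n)) + eps)%:E).
  rewrite lee_fin (le_trans (Hd M0))// lerD2l (le_trans (ler_norm _))// ltW//.
rewrite EFinD leeD2r//; apply: (@esum_int_ge R (fun n => sqc (L2inner mu f (G n)))).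
Qed.

End reformulation.

(** * The dual sequence *)

Lemma big_sym_range_pos (V : nmodType) M (F : int -> V) : (forall k, F (Negz k) = 0) ->
  \sum_(n <- sym_range M) F n = \sum_(k < M.+1) F k%:Z.
Proof.
move=> F0; rewrite -big_sym_range -(big_mkord xpredT (fun k : nat => F (k%:Z - M%:Z))).
rewrite (big_cat_nat (n := M))//=; last by rewrite -addnn -addnS leq_addr.
rewrite big_nat big1 ?add0r => [|i /andP[_ iM]]; last first.
  by rewrite (_ : i%:Z - M%:Z = Negz (M - i.+1)) ?F0//; lia.
rewrite -[X in index_iota X _]add0n big_addn -addnn -addSn addnK big_mkord.
by apply: eq_bigr => k _; rewrite PoszD addrK.
Qed.

Section construction.
Variable R : realType.
Local Open Scope complex_scope.
Local Open Scope ring_scope.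
Local Notation TR := (measurableTypeR R).
Local Notation e := (@fourier_exp R).
Local Notation lam := (lam R).
Variables (mu nu : {finite_measure set TR -> \bar R}) (E : set TR) (w : TR -> R) (m W : R).
Hypotheses (mE : measurable E) (mw : measurable_fun [set: TR] w) (m_gt0 : 0 < m).
Hypothesis w_on : forall x, E x -> m <= w x <= W.
Hypothesis w_off : forall x, ~ E x -> w x = 0.
Hypothesis W_ge0 : 0 <= W.
Hypothesis mu_split : forall v : TR -> \bar R, measurable_fun [set: TR] v ->
  (forall x, 0 <= v x)%E ->
  (\int[mu]_x v x = \int[nu]_x v x + \int[lam]_x ((w x)%:E * v x))%E.
Variables (X Y : set TR) (rho : R).
Hypotheses (mX : measurable X) (mY : measurable Y) (rho01 : 0 < rho <= 1 / 2).
Hypothesis XY : forall x t : TR, X x -> Y t -> rho <= `|t - x| <= 1 - rho.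
Hypotheses (X0 : nu (~` X) = 0%E) (EY : E `<=` Y).
Variables (h : nat -> TR -> R[i]) (Q : TR -> TR -> R[i]) (B K : R).
Hypothesis osd : one_sided_dual nu Y h Q B K.
Variables (P : (TR -> R[i]) -> TR -> R[i]) (p : int -> TR -> R[i]) (C : R).
Hypotheses (Ptr : transfer nu P p C)
  (PY : forall f t, ~ (Y t /\ ~ E t) -> P f t = 0).

Local Notation ip := (L2inner nu).
Let Le n : L2 lam (e n) := L2_fourier_exp lam n.
Let qf f t := ip f (Q t).

Let split := L2_split mE mw m_gt0 w_on w_off mu_split.
Let Lnu f : L2 mu f -> L2 nu f. Proof. by case/split. Qed.
Let LE f : L2 mu f -> L2 lam (restr E f). Proof. by case/split. Qed.

Let Nnu f : L2 mu f -> nsq nu f <= nsq mu f.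
Proof.
move=> Lf; apply: le_trans (nsq_split_ge mE mw m_gt0 w_on w_off mu_split Lf).
by rewrite lerDl mulr_ge0 ?nsq_ge0// ltW.
Qed.

Let NE f : L2 mu f -> nsq lam (restr E f) <= m^-1 * nsq mu f.
Proof.
move=> Lf; rewrite ler_pdivlMl//.
apply: le_trans (nsq_split_ge mE mw m_gt0 w_on w_off mu_split Lf).
by rewrite lerDr nsq_ge0.
Qed.

Let EX x : E x -> ~ X x.
Proof.
move=> /EY Yx Xx; have := XY Xx Yx; have /andP[+ _] := rho01.
by rewrite subrr normr0 => r0 /andP[]; rewrite leNgt r0.
Qed.

Let Qtr := transfer_kernel nu (osd_mcf osd) (osd_le osd) mY.

Lemma exists_transfer : exists a D, transfer nu (fun f => P f - restr Y (qf f)) a D.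
Proof. by do 2 eexists; apply: transferD Ptr (transferN Qtr). Qed.

Variables (a : int -> TR -> R[i]) (D : R).
Hypothesis Atr : transfer nu (fun f => P f - restr Y (qf f)) a D.

(** For P = 0 this is the function phi of the overview; P adds the terms that make the sequence a
    frame. *)
Definition corr f : TR -> R[i] := restr E f + (P f - restr Y (qf f)).

Definition one_sided_ext (n : int) : TR -> R[i] := if n is Posz k then h k else 0.

(** On E the division by w turns integration against w dx into a plain Fourier coefficient. On X,
    disjoint from E, the one-sided dual is supplemented by the adjoint terms [a n], which encode the
    part of [corr] that depends on f through nu. *)
Definition dual_seq (n : int) : TR -> R[i] :=
  restr E (fun x => e n x / (w x)%:C) + restr X (one_sided_ext n + a n).

Let Lext n : L2 nu (one_sided_ext n).
Proof. by case: n => k /=; [exact: (osd_L2 osd)|exact: L20]. Qed.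

Let LaA n : L2 nu (one_sided_ext n + a n).
Proof. by apply: L2D => //; exact: (tr_adj Atr). Qed.

Let Lcorr f : L2 mu f -> L2 lam (corr f).
Proof. by move=> Lf; apply: L2D; [exact: LE|exact/(tr_L2 Atr)/Lnu]. Qed.

Lemma corr_out f t : ~ Y t -> corr f t = 0.
Proof.
move=> nY; rewrite [LHS](_ : _ = restr E f t + (P f t - restr Y (qf f) t))//.
by rewrite !restr_out ?PY ?subr0 ?addr0// => [[]|/EY].
Qed.

Let m1w n : measurable_cfun (fun x : TR => e n x / (w x)%:C).
Proof. by apply: mcfM; [exact: mcf_fourier_exp|apply/mcf_inv/mcf_real]. Qed.

Let L2_ew (rho' : {finite_measure set TR -> \bar R}) n :
  L2 rho' (restr E (fun x => e n x / (w x)%:C)).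
Proof.
apply: (L2_bounded rho' (K := m ^- 2)); first exact: mcf_restr.
move=> x; have [Ex|nE] := pselect (E x); last first.
  by rewrite restr_out// sqc0 invr_ge0 exprn_ge0// ltW.
rewrite restr_in// sqcM sqc_fourier_exp mul1r sqcV sqc_real.
have /andP[mwx _] := w_on Ex; have w0 := lt_le_trans m_gt0 mwx.
by rewrite lef_pV2 ?posrE ?exprn_gt0// ler_pXn2r ?nnegrE// ltW.
Qed.

Let dual_on_E n x : E x -> dual_seq n x = e n x / (w x)%:C.
Proof.
move=> Ex; rewrite [LHS](_ : _ = restr E (fun x => e n x / (w x)%:C) x
  + restr X (one_sided_ext n + a n) x)//.
by rewrite restr_in// restr_out ?addr0//; exact: EX.
Qed.

Let dual_on_X n x : X x -> dual_seq n x = (one_sided_ext n + a n) x.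
Proof.
move=> Xx; rewrite [LHS](_ : _ = restr E (fun x => e n x / (w x)%:C) x
  + restr X (one_sided_ext n + a n) x)//.
by rewrite restr_out ?add0r ?restr_in// => /EX.
Qed.

Lemma L2_dual_seq n : L2 mu (dual_seq n).
Proof.
have mg : measurable_cfun (dual_seq n).
  by apply: mcfD; apply: mcf_restr => //; exact: L2_mcf (LaA n).
apply: (L2_join mw m_gt0 w_on w_off W_ge0 mu_split mg).
- have -> : dual_seq n = restr E (dual_seq n) + restr X (dual_seq n).
    apply/funext => x.
    rewrite [RHS](_ : _ = restr E (dual_seq n) x + restr X (dual_seq n) x)//.
    have [Ex|nE] := pselect (E x).
      by rewrite restr_in// restr_out ?addr0//; exact: EX.
    rewrite (restr_out _ nE) add0r; have [Xx|nX] := pselect (X x).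
      by rewrite restr_in.
    rewrite [RHS]restr_out// [LHS](_ : _ = restr E (fun x => e n x / (w x)%:C) x
      + restr X (one_sided_ext n + a n) x)//.
    by rewrite !restr_out// addr0.
  apply: L2D.
    rewrite (_ : restr E _ = restr E (fun x => e n x / (w x)%:C)); last first.
      apply/funext => x; have [Ex|nE] := pselect (E x); last by rewrite !restr_out.
      by rewrite !restr_in// dual_on_E.
    exact: L2_ew.
  rewrite (_ : restr X _ = restr X (one_sided_ext n + a n)); last first.
    apply/funext => x; have [Xx|nX] := pselect (X x); last by rewrite !restr_out.
    by rewrite !restr_in// dual_on_X.
  exact: L2_restr.
- rewrite (_ : restr E _ = restr E (fun x => e n x / (w x)%:C))//.
  apply/funext => x; have [Ex|nE] := pselect (E x); last by rewrite !restr_out.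
  by rewrite !restr_in// dual_on_E.
Qed.

Lemma ip_dual_seq f n : L2 mu f ->
  L2inner mu f (dual_seq n) = ip f (one_sided_ext n) + L2inner lam (corr f) (e n).
Proof.
move=> Lf; have Lf' := Lnu Lf; have Ld := L2_dual_seq n.
rewrite (ip_split mw m_gt0 w_on w_off mu_split)//.
rewrite (ipDl (LE Lf) (tr_L2 Atr Lf') (Le n)) (tr_ip Atr _ Lf').
rewrite (addrC (L2inner lam _ _)) addrA -(ipDr Lf' (Lext n) (tr_adj Atr n)).
congr (_ + _).
- by apply: (eq_ip_on mX X0 Lf' (Lnu Ld) Lf' (LaA n)) => x Xx; rewrite dual_on_X.
- congr cintegral; apply/funext => x; have [Ex|nE] := pselect (E x); last first.
    by rewrite w_off// restr_out// !mul0r.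
  have /andP[mwx _] := w_on Ex; have w0 : (w x)%:C != 0 :> R[i].
    by rewrite (inj_eq (@complexI R)) gt_eqF// (lt_le_trans m_gt0).
  by rewrite restr_in// dual_on_E// conjM conjV conj_real mulrCA (mulrCA (w x)%:C) divff ?mulr1.
Qed.

Definition dual_sum f M : TR -> R[i] :=
  one_sided_sum nu h f M.+1 + fourier_sum (sym_range M) (corr f).

Lemma dual_sumE f M : L2 mu f ->
  \sum_(n <- sym_range M) L2inner mu f (dual_seq n) *: e n = dual_sum f M.
Proof.
move=> Lf; rewrite /dual_sum /one_sided_sum /fourier_sum.
rewrite -(@big_sym_range_pos _ M (fun n => ip f (one_sided_ext n) *: e n)); last first.
  by move=> k; rewrite /= ip0r ?scale0r//; exact: Lnu.
by rewrite -big_split/=; apply: eq_bigr => n _; rewrite ip_dual_seq// scalerDl.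
Qed.

Lemma dual_seq_bessel f M : L2 mu f ->
  \sum_(n <- sym_range M) sqc (L2inner mu f (dual_seq n)) <=
    (2 * B + 2 * (2 * m^-1 + 2 * D)) * nsq mu f.
Proof.
move=> Lf; have Lf' := Lnu Lf.
have h1 : \sum_(n <- sym_range M) sqc (ip f (one_sided_ext n)) <= B * nsq mu f.
  rewrite big_sym_range_pos => [|k]; last by rewrite /= ip0r ?sqc0.
  apply: le_trans (osd_bessel osd M.+1 Lf') _.
  by rewrite ler_wpM2l ?(osd_ge0 osd)// Nnu.
have h2 : \sum_(n <- sym_range M) sqc (L2inner lam (corr f) (e n)) <=
    (2 * m^-1 + 2 * D) * nsq mu f.
  apply: le_trans (bessel_ineq (sym_range_uniq M) (Lcorr Lf)) _.
  apply: le_trans (nsqD_le (LE Lf) (tr_L2 Atr Lf')) _.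
  rewrite [leRHS]mulrDl -(mulrA 2 m^-1) -(mulrA 2 D).
  apply: lerD; apply: ler_wpM2l => //; first exact: NE.
  by apply: le_trans (tr_le Atr Lf') _; rewrite ler_wpM2l ?(tr_ge0 Atr)// Nnu.
apply: (@le_trans _ _ (2 * (\sum_(n <- sym_range M) sqc (ip f (one_sided_ext n))) +
    2 * (\sum_(n <- sym_range M) sqc (L2inner lam (corr f) (e n))))); last first.
  rewrite [leRHS]mulrDl -(mulrA 2 B) -(mulrA 2 (2 * m^-1 + 2 * D)).
  by apply: lerD; apply: ler_wpM2l.
rewrite !mulr_sumr -big_split/=; apply: ler_sum => n _.
by rewrite ip_dual_seq//; exact: sqcD_le.
Qed.

Let Lsum (rho' : {finite_measure set TR -> \bar R}) f M : L2 rho' (dual_sum f M).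
Proof.
apply: L2D; last exact: L2_exp_sum.
by apply: L2_sum => k _; apply: L2Z; exact: L2_fourier_exp.
Qed.

(** The one-sided part already converges to f in L^2(nu), and the Fourier series of [corr f]
    contributes nothing there, since [corr f] vanishes off Y. *)
Lemma dual_sum_cvg_nu f : L2 mu f -> nsq nu (f - dual_sum f M) @[M --> \oo] --> 0.
Proof.
move=> Lf; have Lf' := Lnu Lf.
have Lo M : L2 nu (one_sided_sum nu h f M).
  by apply: L2_sum => k _; apply: L2Z; exact: L2_fourier_exp.
apply: (@squeeze_cvg0 _ _ (fun M => 2 * nsq nu (f - one_sided_sum nu h f M.+1) +
   2 * nsq nu (fourier_sum (sym_range M) (corr f)))).
  move=> M; rewrite nsq_ge0/= opprD addrA -[X in _ + 2 * X]nsqN.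
  by apply: nsqD_le; [exact: L2B|apply: L2N; exact: L2_exp_sum].
rewrite -[X in _ --> X](_ : 2 * 0 + 2 * 0 = 0); last by rewrite mulr0 addr0.
apply: cvgD; apply: cvgMr.
  by have := osd_dual osd Lf'; rewrite -(cvg_shiftS (fun M => nsq nu (f - one_sided_sum nu h f M))).
apply: (fourier_sum_local_cvg0 mX mY rho01 XY (Lcorr Lf)) => //.
by move=> t; exact: corr_out.
Qed.

(** The limit of the dual sums on Y: the one-sided part tends to <f, Q_t>, the Fourier part to
    [corr f], and the terms in Q cancel. *)
Definition target f : TR -> R[i] := restr E f + P f.

Let Ltarget f : L2 mu f -> L2 lam (target f).
Proof. by move=> Lf; apply: L2D; [exact: LE|exact/(tr_L2 Ptr)/Lnu]. Qed.

Lemma dual_sum_cvg_lam f : L2 mu f ->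
  nsq lam (restr Y (target f - dual_sum f M)) @[M --> \oo] --> 0.
Proof.
move=> Lf; have Lf' := Lnu Lf; have [eps eps0 Heps] := osd_arc osd Lf'.
have Lo M : L2 lam (one_sided_sum nu h f M).
  by apply: L2_sum => k _; apply: L2Z; exact: L2_fourier_exp.
have LF M : L2 lam (fourier_sum (sym_range M) (corr f)) by exact: L2_exp_sum.
have LQ := tr_L2 Qtr Lf'.
have splitY M : restr Y (target f - dual_sum f M) =
    (restr Y (qf f) - restr Y (one_sided_sum nu h f M.+1)) +
    restr Y (corr f - fourier_sum (sym_range M) (corr f)).
  apply/funext => t; rewrite [RHS](_ : _ = (restr Y (qf f) t - restr Y (one_sided_sum nu h f M.+1) t) +
    restr Y (corr f - fourier_sum (sym_range M) (corr f)) t)//.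
  have [Yt|nY] := pselect (Y t); last by rewrite !restr_out// subr0 addr0.
  rewrite !restr_in// [LHS](_ : _ = restr E f t + P f t -
    (one_sided_sum nu h f M.+1 t + fourier_sum (sym_range M) (corr f) t))//.
  rewrite [(corr f - _) t](_ : _ = restr E f t + (P f t - restr Y (qf f) t)
    - fourier_sum (sym_range M) (corr f) t)// (restr_in (qf f) Yt); ring.
apply: (@squeeze_cvg0 _ _ (fun M => 2 * `|eps M.+1| +
   2 * nsq lam (corr f - fourier_sum (sym_range M) (corr f)))).
  move=> M; rewrite nsq_ge0/= splitY.
  have L1 : L2 lam (restr Y (qf f) - restr Y (one_sided_sum nu h f M.+1)).
    by apply: L2B => //; exact: L2_restr.
  have L2' := L2B (Lcorr Lf) (LF M).
  apply: le_trans (nsqD_le L1 (L2_restr mY L2')) _.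
  apply: lerD; apply: ler_wpM2l => //; last first.
    by apply: (le_nsq (L2_restr mY L2') L2') => t; exact: sqc_restr_le.
  rewrite -[leRHS]mulr1 -(mass_lam R); apply: nsq_bounded; first exact: L2_mcf L1.
  move=> t; rewrite [X in sqc X](_ : _ = restr Y (qf f) t - restr Y (one_sided_sum nu h f M.+1) t)//.
  have [Yt|nY] := pselect (Y t); last by rewrite !restr_out// subr0 sqc0.
  by rewrite !restr_in//; apply: le_trans (Heps _ _ Yt) (ler_norm _).
rewrite -[X in _ --> X](_ : 2 * 0 + 2 * 0 = 0); last by rewrite mulr0 addr0.
apply: cvgD; apply: cvgMr; last exact: fourier_sum_cvg (Lcorr Lf).
have : `|eps M| @[M --> \oo] --> 0 by rewrite -[X in _ --> X](normr0 R); exact: cvg_norm.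
by rewrite -(cvg_shiftS (fun M => `|eps M|)).
Qed.

(** On E the target is f itself, because E lies in Y and P f vanishes on E. *)
Lemma dual_sum_cvg f : L2 mu f -> nsq mu (f - dual_sum f M) @[M --> \oo] --> 0.
Proof.
move=> Lf; apply: (@squeeze_cvg0 _ _ (fun M => nsq nu (f - dual_sum f M) +
   W * nsq lam (restr Y (target f - dual_sum f M)))).
  move=> M; rewrite nsq_ge0/=; have Ld := L2B Lf (Lsum mu f M).
  apply: le_trans (nsq_split_le mE mw m_gt0 w_on w_off W_ge0 mu_split Ld) _.
  rewrite lerD2l ler_wpM2l//; apply: le_nsq; first exact: LE.
    exact: (L2_restr mY (L2B (Ltarget Lf) (Lsum lam f M))).
  move=> t; have [Et|nE] := pselect (E t); last by rewrite restr_out// sqc0 sqc_ge0.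
  rewrite restr_in// restr_in; last exact: EY.
  rewrite [(target f - _) t](_ : _ = restr E f t + P f t - dual_sum f M t)//.
  by rewrite restr_in// PY ?addr0// => -[].
rewrite -[X in _ --> X](_ : 0 + W * 0 = 0); last by rewrite mulr0 addr0.
by apply: cvgD; [exact: dual_sum_cvg_nu|apply: cvgMr; exact: dual_sum_cvg_lam].
Qed.

(** The dual sum is a trigonometric polynomial with coefficients <f, g_n>, so Parseval gives their
    square sum. It approximates the target on Y, and the target dominates f: its two pieces have
    disjoint supports, the first sees f on E, the second sees f in L^2(nu) through al. *)
Lemma dual_seq_lower al f : 0 < al -> (forall g, L2 nu g -> al * nsq nu g <= nsq lam (P g)) ->
  L2 mu f -> exists2 del : nat -> R, del M @[M --> \oo] --> 0 &
    forall M, nsq mu f / (2 * (al^-1 + W)) <=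
      \sum_(n <- sym_range M) sqc (L2inner mu f (dual_seq n)) + del M.
Proof.
move=> al0 HP Lf; have Lf' := Lnu Lf.
exists (fun M => nsq lam (restr Y (target f - dual_sum f M))); first exact: dual_sum_cvg_lam.
move=> M; have aW : 0 < al^-1 + W by rewrite ltr_wpDr// invr_gt0.
have LP := tr_L2 Ptr Lf'.
have NT : nsq lam (target f) = nsq lam (restr E f) + nsq lam (P f).
  rewrite nsqD//; last exact: LE.
  have -> : L2inner lam (restr E f) (P f) = L2inner lam 0 (P f).
    congr cintegral; apply/funext => x; have [Ex|nE] := pselect (E x).
      by rewrite PY ?rmorph0 ?conj_real ?mulr0 ?mul0r// => -[].
    by rewrite restr_out.
  by rewrite ip0l//= mulr0 addr0.
have T1 : nsq mu f <= (al^-1 + W) * nsq lam (target f).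
  apply: le_trans (nsq_split_le mE mw m_gt0 w_on w_off W_ge0 mu_split Lf) _.
  have h1 : nsq nu f <= al^-1 * nsq lam (P f) by rewrite ler_pdivlMl// HP.
  have h2 := nsq_ge0 lam (P f); have h3 := nsq_ge0 lam (restr E f).
  have h4 : 0 < al^-1 by rewrite invr_gt0.
  have h5 := mulr_ge0 (ltW h4) h3; have h6 := mulr_ge0 W_ge0 h2.
  by rewrite NT; lra.
have T2 : nsq lam (target f) <= 2 * nsq lam (restr Y (target f - dual_sum f M)) +
    2 * nsq lam (dual_sum f M).
  have Te : target f = restr Y (target f - dual_sum f M) + restr Y (dual_sum f M).
    rewrite restrB subrK; apply/funext => t; have [Yt|nY] := pselect (Y t).
      by rewrite restr_in.
    rewrite restr_out// [LHS](_ : _ = restr E f t + P f t)// restr_out ?PY ?addr0// => [[]|/EY]//.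
  rewrite {1}Te.
  apply: le_trans (nsqD_le (L2_restr mY (L2B (Ltarget Lf) (Lsum lam f M))) (L2_restr mY (Lsum lam f M))) _.
  rewrite lerD2l ler_wpM2l//; apply: le_nsq => //; first exact: L2_restr.
  by move=> t; exact: sqc_restr_le.
rewrite -nsq_exp_sum ?sym_range_uniq// dual_sumE// ler_pdivrMr ?mulr_gt0//.
move: T1 T2; set y := nsq lam (target f); set z := nsq lam (restr _ _) => T1 T2.
apply: le_trans T1 _; rewrite [leRHS](_ : _ = (al^-1 + W) * (2 * z + 2 * nsq lam (dual_sum f M))); last by ring.
by rewrite ler_wpM2l// ltW.
Qed.

Lemma dual_seq_dual : dextrodual mu dual_seq e.
Proof.
refine (dextrodual_nsq _) => f Lf.
by under eq_fun do rewrite dual_sumE//; exact: dual_sum_cvg.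
Qed.

Lemma bessel_dual_seq : bessel_sequence mu dual_seq.
Proof.
apply: (bessel_nsq L2_dual_seq (C := 2 * B + 2 * (2 * m^-1 + 2 * D))).
  have := osd_ge0 osd; have := tr_ge0 Atr; have : 0 < m^-1 by rewrite invr_gt0.
  lra.
by move=> f M; exact: dual_seq_bessel.
Qed.

Lemma frame_dual_seq al : 0 < al ->
  (forall g, L2 nu g -> al * nsq nu g <= nsq lam (P g)) -> frame mu dual_seq.
Proof.
move=> al0 HP; apply: (frame_nsq bessel_dual_seq (A := 2 * (al^-1 + W))).
  by rewrite mulr_gt0// ltr_wpDr// invr_gt0.
by move=> f Lf; exact: dual_seq_lower.
Qed.

End construction.

(** * The hypotheses on the measure *)

Section absolutely_continuous_part.
Variable R : realType.
Local Open Scope ring_scope.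
Local Notation TR := (measurableTypeR R).
Local Notation leb := (@lebesgue_measure R).
Local Open Scope charge_scope.
Variables (mu mu_a mu_s : {finite_measure set TR -> \bar R}) (g : R -> R) (c d m M : R).
Hypotheses (mu_unit : mu (~` `[0, 1[) = 0%E)
  (mu_add : forall A : set TR, measurable A -> mu A = (mu_a A + mu_s A)%E)
  (mu_a_leb : mu_a `<< leb) (g_meas : measurable_fun [set: R] g)
  (g_RN : ae_eq leb [set: R] (EFin \o g)
              ('d (charge_of_finite_measure mu_a) '/d leb))
  (g_supp : {ae leb, forall x : R, 0 < g x -> x \in `[c, d]})
  (g_bnd : {ae leb, forall x : R, 0 < g x -> m <= g x <= M}).

(** The almost-everywhere hypotheses on g are built into the set, so that the bounds hold at every
    one of its points. *)
Definition ac_support : set TR :=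
  [set x : R | 0 < g x] `&` [set x : R | m <= g x <= M] `&` `[c, d] `&` `[0, 1[.

Definition ac_density (x : TR) : R := g x * \1_ac_support x.

Lemma measurable_ac_support : measurable ac_support.
Proof.
have mg0 : measurable [set x : TR | 0 < g x].
  have := g_meas measurableT (measurable_itv `]0, +oo[); rewrite setTI.
  by congr measurable; apply/seteqP; split => x /=; rewrite in_itv/= andbT.
have mg1 : measurable [set x : TR | m <= g x <= M].
  have := g_meas measurableT (measurable_itv `[m, M]); rewrite setTI.
  by congr measurable; apply/seteqP; split => x /=; rewrite in_itv/=.
apply: measurableI; last exact: measurable_itv.
apply: measurableI; last exact: measurable_itv.
exact: measurableI.
Qed.

Lemma measurable_ac_density : measurable_fun [set: TR] ac_density.
Proof. by apply: measurable_funM => //; apply: measurable_indic; exact: measurable_ac_support. Qed.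

Lemma ac_density_in x : ac_support x -> ac_density x = g x.
Proof. by move=> Ex; rewrite /ac_density indicE mem_set// mulr1. Qed.

Lemma ac_density_out x : ~ ac_support x -> ac_density x = 0.
Proof. by move=> Ex; rewrite /ac_density indicE memNset// mulr0. Qed.

Lemma le_mu_a A : measurable A -> (mu_a A <= mu A)%E.
Proof. by move=> mA; rewrite mu_add// leeDl. Qed.

Lemma le_mu_s A : measurable A -> (mu_s A <= mu A)%E.
Proof. by move=> mA; rewrite mu_add// leeDr. Qed.

Lemma integral_ac_split (v : TR -> \bar R) : measurable_fun [set: TR] v ->
  (forall x, 0 <= v x)%E ->
  (\int[mu]_x v x = \int[mu_s]_x v x + \int[lam R]_x ((ac_density x)%:E * v x))%E.
Proof.
move=> mv v0; have mI : measurable (`[0, 1[%classic : set TR) by exact: measurable_itv.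
rewrite (eq_measure_integral (measure_add mu_a mu_s)); last first.
  by move=> A mA _; apply: etrans (mu_add mA) _; exact/esym/(measure_addE mu_a mu_s A).
rewrite ge0_integral_measure_add// addeC; congr (_ + _)%E.
have mu_a_unit : mu_a (~` `[0, 1[%classic) = 0%E.
  apply/eqP; rewrite eq_le measure_ge0 andbT.
  by have := le_mu_a (measurableC mI); rewrite mu_unit.
have mF := measurable_int _ (Radon_Nikodym_SigmaFinite.f_integrable mu_a_leb).
have mw : measurable_fun [set: TR] (fun x => (ac_density x)%:E).
  by apply/measurable_EFinP; exact: measurable_ac_density.
have mwv : measurable_fun [set: TR] (fun x => (ac_density x)%:E * v x)%E.
  exact: emeasurable_funM.
rewrite integral_lam//.
rewrite (eq_integral_on mI mu_a_unit (v := v \_ `[0, 1[)) //; last 2 first.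
- by apply/(measurable_restrictT v mI); exact: measurable_funTS.
- by move=> x xI; rewrite patchE mem_set.
rewrite -integral_mkcond -(Radon_Nikodym_SigmaFinite.change_of_variables mu_a_leb)//; last exact: measurable_funTS.
apply: ae_eq_integral => //.
- by apply: emeasurable_funM; exact: measurable_funTS.
- exact: measurable_funTS.
have H := ae_eq_Radon_Nikodym_SigmaFinite mu_a_leb measurableT.
have FF : Filter (nbhs (almost_everywhere leb)) := ae_filter_ringOfSetsType leb.
(* Off a null set g is the Radon-Nikodym derivative. Where g > 0, all the conditions defining
   [ac_support] hold; elsewhere g = 0, as a derivative of a positive measure is nonnegative. *)
apply: filterS (filterI (filterI H g_RN) (filterI g_supp g_bnd)) => x [[Hx gx] [sx bx]] xI.
rewrite (Hx I) -(gx I) muleC /=; congr (_%:E * _)%E.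
have [g0|g0] := ltP 0 (g x).
  rewrite ac_density_in//; split => //; split; last exact: sx.
  by split => //; exact: bx.
have : g x = 0.
  apply/eqP; rewrite eq_le g0 -lee_fin -[X in (_ <= X)%E]/((EFin \o g) x) (gx I) -(Hx I).
  exact: Radon_Nikodym_SigmaFinite.f_ge0.
by rewrite /ac_density => ->; rewrite mul0r.
Qed.

End absolutely_continuous_part.

(** * Separation of the supports on the circle *)

Section separation.
Variable R : realType.
Local Open Scope ring_scope.
Variables (a b c d : R).
Hypotheses (a_gt0 : 0 < a) (c_gt0 : 0 < c).
Hypothesis disj : `[a, b]%classic `&` `[c, d]%classic = set0.

Let gap : exists2 del : R, 0 < del &
  forall x t, a <= x <= b -> c <= t <= d -> del <= `|t - x|.
Proof.
have [ba|ab] := ltP b a.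
  by exists 1 => // x t /andP[ax xb]; have := le_lt_trans (le_trans ax xb) ba; rewrite ltxx.
have [dc|cd] := ltP d c.
  by exists 1 => // x t _ /andP[ct td]; have := le_lt_trans (le_trans ct td) dc; rewrite ltxx.
have [bc|cb] := ltP b c.
  exists (c - b); first by rewrite subr_gt0.
  move=> x t /andP[_ xb] /andP[ct _]; rewrite ger0_norm; lra.
have [da|ad] := ltP d a.
  exists (a - d); first by rewrite subr_gt0.
  by move=> x t /andP[ax _] /andP[_ td]; rewrite distrC ger0_norm; lra.
exfalso; suff : (`[a, b]%classic `&` `[c, d]%classic) (Num.max a c) by rewrite disj.
by split; rewrite /= in_itv/= !ge_max !le_max !lexx ?orbT/= ?ab ?cb ?ad ?cd.
Qed.

(** The interval [s, 2s) is room for the jumps, to the left of both [a, b] and [c, d]. The upper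
    bound 1 - rho excludes closeness across the point 0 = 1; it follows from a, c >= 3 s > 0. *)
Lemma separation : exists s rho : R, [/\ 0 < s, 2 * s < 1, 2 * s < c, 0 < rho <= 1 / 2 &
  forall x t, a <= x <= b -> 0 <= x < 1 ->
    (c <= t <= d) && (0 <= t < 1) || (s <= t < 2 * s) -> rho <= `|t - x| <= 1 - rho].
Proof.
have [del del0 Hdel] := gap; pose s := Num.min (Num.min a c) 1 / 3.
have sa : 3 * s <= a by rewrite mulrC divfK// ?ge_min ?lexx// pnatr_eq0.
have sc : 3 * s <= c by rewrite mulrC divfK// ?ge_min ?lexx ?orbT// pnatr_eq0.
have s1 : 3 * s <= 1 by rewrite mulrC divfK// ?ge_min ?lexx ?orbT// pnatr_eq0.
have s0 : 0 < s by rewrite divr_gt0// !lt_min a_gt0 c_gt0 ltr01.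
exists s, (Num.min del s).
have rs : Num.min del s <= s by rewrite ge_min lexx orbT.
have rd : Num.min del s <= del by rewrite ge_min lexx.
have r0 : 0 < Num.min del s by rewrite lt_min del0.
split; [by []|lra|lra|by rewrite r0/=; lra|].
move: (Num.min del s) rs rd r0 => rho rs rd r0 x t /andP[ax xb] /andP[x0 x1].
have up : forall y : R, - (1 - rho) <= y <= 1 - rho -> `|y| <= 1 - rho by move=> y; rewrite ler_norml.
case/orP => [/andP[/andP[ct td] /andP[t0 t1]]|/andP[st ts]].
  rewrite (le_trans rd) ?Hdel ?ax ?ct//= up//; lra.
rewrite distrC ger0_norm; lra.
Qed.

End separation.

(** * Encoding a finite-dimensional space by jumps *)

Section jumps.
Variable R : realType.
Local Open Scope complex_scope.
Local Open Scope ring_scope.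
Local Notation TR := (measurableTypeR R).
Local Notation e := (@fourier_exp R).
Local Notation lam := (lam R).

Lemma nsq_orth_sum d (T : measurableType d) (mu : {measure set T -> \bar R})
    (F : nat -> T -> R[i]) k : (forall i, L2 mu (F i)) ->
  (forall i j, (i < j)%N -> L2inner mu (F i) (F j) = 0) ->
  nsq mu (\sum_(i < k) F i) = \sum_(i < k) nsq mu (F i).
Proof.
move=> LF F0; elim: k => [|k IH]; first by rewrite !big_ord0 nsq0.
rewrite !big_ord_recr/= nsqD//; last exact: L2_sum.
rewrite IH ip_suml// (_ : \sum_(i < k) L2inner mu (F i) (F k) = 0) ?mulr0 ?addr0//.
by apply: big1 => i _; exact: F0.
Qed.

Variables (nu : {finite_measure set TR -> \bar R}) (u : nat -> TR -> R[i]) (k : nat) (s : R).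
Hypotheses (Lu : forall i, L2 nu (u i)) (s_gt0 : 0 < s) (s_lt : 2 * s < 1).
Hypothesis parseval : forall f, L2 nu f -> nsq nu f = \sum_(i < k) sqc (L2inner nu f (u i)).

(** Dividing by k + 1 rather than k keeps the length positive when k = 0; k pieces of this length
    still fit in [s, 2s). *)
Let l := s / k.+1%:R.
Let l_gt0 : 0 < l. Proof. by rewrite divr_gt0. Qed.

Let piece (i : nat) : set TR := if (i < k)%N then `[s + i%:R * l, s + i.+1%:R * l[%classic else set0.

Let mpiece i : measurable (piece i).
Proof. by rewrite /piece; case: ifP => // _; exact: measurable_itv. Qed.

Let kl : k.+1%:R * l = s.
Proof. by rewrite /l mulrC divfK// pnatr_eq0. Qed.

Let piece_sub i t : piece i t -> s <= t < 2 * s.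
Proof.
rewrite /piece; case: ifP => // ik; rewrite /= in_itv/= => /andP[t1 t2].
have h1 : 0 <= i%:R * l by rewrite mulr_ge0// ltW.
have h2 : i.+1%:R * l <= s by rewrite -[leRHS]kl ler_pM2r// ler_nat ltnS ltnW.
move: t1 t2 h1 h2; set p := i%:R * l; set q := i.+1%:R * l.
by move: t => /= t; move=> t1 t2 h1 h2; apply/andP; split; lra.
Qed.

Let piece_disj i j t : (i < j)%N -> piece i t -> ~ piece j t.
Proof.
move=> ij; rewrite /piece; case: ifP => // _; case: ifP => _; last by move=> _ [].
rewrite /= !in_itv/= => /andP[_ t1] /andP[t2 _].
have H : s + i.+1%:R * l <= s + j%:R * l by rewrite lerD2l ler_pM2r// ler_nat.
by have := lt_le_trans t1 (le_trans H t2); rewrite ltxx.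
Qed.

Let psi i : TR -> R[i] := fun t => (\1_(piece i) t : R)%:C.
Let Lpsi i : L2 lam (psi i). Proof. by apply: L2_indic. Qed.

Definition jumps f : TR -> R[i] := \sum_(i < k) L2inner nu f (u i) *: psi i.

Lemma exists_jumps_transfer : exists p C, transfer nu jumps p C.
Proof.
have H n : exists p C, transfer nu (fun f => \sum_(i < n) L2inner nu f (u i) *: psi i) p C.
  elim: n => [|n [p [C IH]]].
    exists (fun _ => 0), 0; rewrite (_ : (fun f => _) = fun _ => 0); first exact: transfer0.
    by apply/funext => f; rewrite big_ord0.
  do 2 eexists; rewrite (_ : (fun f => _) = fun f =>
    \sum_(i < n) L2inner nu f (u i) *: psi i + L2inner nu f (u n) *: psi n); last first.
    by apply/funext => f; rewrite big_ord_recr.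
  exact: transferD IH (transfer_rank1 (Lu n) (Lpsi n)).
exact: H.
Qed.

Lemma jumps_out f t : ~ (s <= t < 2 * s) -> jumps f t = 0.
Proof.
move=> nt; rewrite /jumps fct_sumE big1// => i _.
rewrite [LHS](_ : _ = L2inner nu f (u i) * psi i t)// /psi indicE memNset ?mulr0//.
by move=> /piece_sub.
Qed.

Let nsq_psi i : (i < k)%N -> nsq lam (psi i) = l.
Proof.
move=> ik; have -> : nsq lam (psi i) = \int[lam]_t (\1_(piece i) t : R).
  apply: eq_Rintegral => t _; rewrite sqc_real indicE.
  by case: (_ \in _); rewrite ?expr1n ?expr0n.
rewrite Rintegral_indic//= lamE setIidl; last first.
  move=> t /piece_sub; rewrite /= in_itv/= => /andP[t1 t2].
  by rewrite (le_trans _ t1) ?(lt_trans t2)// ltW.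
rewrite /piece ik lebesgue_measure_itv/= lte_fin ltrD2l ltr_pM2r// ltr_nat ltnSn.
rewrite -EFinD/= -natr1 mulrDl mul1r; ring.
Qed.

(** The indicators of the pieces are orthogonal with squared norm [l], so Parseval in L^2(nu)
    carries over with this factor. *)
Lemma nsq_jumps f : L2 nu f -> s / k.+1%:R * nsq nu f <= nsq lam (jumps f).
Proof.
move=> Lf; rewrite (nsq_orth_sum k (F := fun i => L2inner nu f (u i) *: psi i)).
- rewrite parseval// mulr_sumr; apply: ler_sum => i _.
  by rewrite nsqZ// nsq_psi// mulrC.
- by move=> i; exact: L2Z.
- move=> i j ij; rewrite ipZl ?ipZr//; last exact: L2Z.
  have -> : L2inner lam (psi i) (psi j) = 0; last by rewrite !mulr0.
  rewrite -(ip0l (Lpsi j)).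
  congr cintegral; apply/funext => t; have [it|nit] := pselect (piece i t).
    by rewrite /psi !indicE (memNset (piece_disj ij it)) conj_real !mulr0.
  by rewrite /psi !indicE (memNset nit) !mul0r.
Qed.

End jumps.

(** * Assembling the theorem *)

Local Open Scope charge_scope.

Theorem theorem3p10 (R : realType)
    (mu mu_a mu_s : {finite_measure set (measurableTypeR R) -> \bar R})
    (g : R -> R) (a b c d : R)
    (mu_unit : mu (~` `[0, 1[) = 0%E)
    (mu_dec : lebesgue_decomposition mu mu_a mu_s)
    (g_meas : measurable_fun [set: R] g)
    (g_RN : ae_eq (@lebesgue_measure R) [set: R] (EFin \o g)
              ('d (charge_of_finite_measure mu_a) '/d (@lebesgue_measure R)))
    (c_gt0 : 0 < c)
    (g_supp : {ae @lebesgue_measure R,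
                 forall x : R, 0 < g x -> x \in `[c, d]})
    (g_bnd : exists m M : R, 0 < m <= M /\
               {ae @lebesgue_measure R,
                  forall x : R, 0 < g x -> m <= g x <= M})
    (a_gt0 : 0 < a)
    (disj : `[a, b]%classic `&` `[c, d]%classic = set0)
    (mu_s_supp : mu_s (~` `[a, b]) = 0%E) :
  (exists G : int -> R -> R[i],
     bessel_sequence mu G /\ dextrodual mu G (@fourier_exp R)) /\
  (finite_dimensional_L2 mu_s ->
     exists G : int -> R -> R[i],
       frame mu G /\ dextrodual mu G (@fourier_exp R)).
Proof.
have [mu_add mu_a_leb [A [mA A0 A0']]] := mu_dec.
have [m [M [/andP[m0 mM] bnd]]] := g_bnd.
have [s [rho [s0 s1 sc rho01 sep]]] := separation a_gt0 c_gt0 disj.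
pose X : set (measurableTypeR R) := `[a, b] `&` `[0, 1[.
(* Besides the part that will contain the support of g, Y has the interval on which the jumps are
   placed. *)
pose Y : set (measurableTypeR R) := (`[c, d] `&` `[0, 1[) `|` `[s, 2 * s[.
have mX : measurable X by apply: measurableI; exact: measurable_itv.
have mY : measurable Y.
  by apply: measurableU; [apply: measurableI|]; exact: measurable_itv.
have XY : forall x t : measurableTypeR R, X x -> Y t -> rho <= `|t - x| <= 1 - rho.
  move=> x t [/=]; rewrite !in_itv/= => x1 x2 Yt; apply: sep => //.
  by case: Yt => [[]|] /=; rewrite !in_itv/= => t1; [move=> ->; rewrite t1|rewrite t1 orbT].
have X01 : X `<=` `]0, 1[.
  move=> x [/=]; rewrite !in_itv/= => /andP[ax _] /andP[_ ->].
  by rewrite (lt_le_trans a_gt0).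
have X0 : mu_s (~` X) = 0%E.
  rewrite setCI; apply/eqP; rewrite eq_le measure_ge0 andbT.
  have mC (i : interval R) : measurable (~` [set` i] : set (measurableTypeR R)).
    by apply: measurableC; exact: measurable_itv.
  apply: le_trans (measureU2 mu_s (mC _) (mC _)) _.
  rewrite [X in (X + _)%E]mu_s_supp add0e.
  by have := le_mu_s mu_add (mC `[0, 1[); rewrite mu_unit.
(* The Lebesgue-null carrier of [mu_s] is the complement of A. *)
have nuZ : mu_s (~` ~` A) = 0%E by rewrite setCK.
have [h [Q [B [K osd]]]] := exists_one_sided_dual mX mY rho01 XY X0 X01 (measurableC mA) A0' nuZ.
pose E := ac_support g c d m M; pose w := ac_density g c d m M.
have EY : E `<=` Y by move=> x [[_ cd] I01]; left.
have w_on x : E x -> m <= w x <= M by move=> /[dup] Ex [[[_ +] _] _]; rewrite /w ac_density_in.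
have M0 : 0 <= M by exact: le_trans (ltW m0) mM.
(* Both claims are instances: P = 0 for the Bessel sequence, P = [jumps] for the frame. *)
have main P p C : transfer mu_s P p C -> (forall f t, ~ (Y t /\ ~ E t) -> P f t = 0) ->
    exists G : int -> R -> R[i], [/\ bessel_sequence mu G, dextrodual mu G (@fourier_exp R) &
      forall al, 0 < al ->
        (forall f, L2 mu_s f -> al * nsq mu_s f <= nsq (lam R) (P f)) -> frame mu G].
  move=> Ptr PY; have [p' [D Atr]] := exists_transfer mY osd Ptr.
  have mE := measurable_ac_support c d m M g_meas.
  have mw := measurable_ac_density c d m M g_meas.
  have w_off := @ac_density_out _ g c d m M.
  have split := integral_ac_split mu_unit mu_add mu_a_leb g_meas g_RN g_supp bnd.
  exists (dual_seq E w X h p'); split.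
  - exact: (bessel_dual_seq mE mw m0 w_on w_off M0 split mX rho01 XY X0 EY osd Atr).
  - exact: (dual_seq_dual mE mw m0 w_on w_off M0 split mX mY rho01 XY X0 EY osd Ptr PY Atr).
  - move=> al; exact: (frame_dual_seq mE mw m0 w_on w_off M0 split mX mY rho01 XY X0 EY osd Ptr PY Atr).
split.
  have [G [GB GD _]] := main _ _ _ (transfer0 mu_s) (fun _ _ _ => erefl).
  by exists G.
move=> /finite_dimensional_parseval[k [u [Lu parseval]]].
have [p [C Ptr]] := exists_jumps_transfer k s Lu.
have [|G [GB GD GF]] := main _ _ _ Ptr.
  (* The jump interval lies in Y and misses E because 2 s < c. *)
  move=> f t nt; apply: jumps_out => // st; apply: nt; split; first by right; rewrite /= in_itv.
  move=> [[_ /=]]; rewrite !in_itv/= => /andP[ct _] _.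
  by case/andP: st => _; rewrite ltNge (le_trans (ltW sc)).
exists G; split=> //; apply: (GF (s / k.+1%:R)); first by rewrite divr_gt0.
by move=> f Lf; exact: nsq_jumps.
Qed.
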